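(* Let $X=X(\mathbb T)$ be a Banach lattice satisfying Assumption A, and let $r,s\in\mathbb N$ with $2r\ge s$. Let $(G_n)_{n\in\mathbb N}$ be linear sampling operators for which there are constants $K_1,K_3>0$ such that for all $n\in\mathbb N$ $$\|G_nf\|_X\le K_1\|f\|_{X_n}\ \ (f\in X),\qquad \|T-G_nT\|_X\le K_3n^{-s}\|T^{(s)}\|_X\ \ (T\in\mathcal T_n).$$ Then there is a constant $C>0$, independent of $f$ and $n$, such that for all $f\in X$ and $n\in\mathbb N$ $$\|f-G_nf\|_X\le C\left(\|(I-\dot A_{\gamma/n})^sf\|_X+\|(I-A_{\gamma/n})^rf\|_{X_n}\right).$$ If, additionally, $G_nf\in\mathcal T_n$ for all $f\in X$ and $n\in\mathbb N$ (i.e. $G_n:X_n\to\mathcal T_n$), then there is a constant $C>0$, independent of $f$ and $n$, such that for all $f\in X$ and $n\in\mathbb N$ $$\|f-G_nf\|_{X_n}\le C\left(\|(I-\dot A_{\gamma/n})^sf\|_X+\|(I-A_{\gamma/n})^rf\|_{X_n}\right).$$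
   Context: $\mathbb T$ is the unit circle identified with $[-\pi,\pi)$ (functions on $\mathbb T$ are $2\pi$-periodic), with normalized Lebesgue measure $\mu$. A Banach lattice $X=X(\mathbb T)$ is a Banach space of measurable functions on $\mathbb T$ such that: 1) if $f$ is measurable, $g\in X$ and $|f|\le|g|$, then $f\in X$ and $\|f\|_X\le\|g\|_X$; 2) if $f_n\in X$, $\sup_n\|f_n\|_X<\infty$ and $0\le f_n\uparrow f$, then $f\in X$ and $\|f_n\|_X\to\|f\|_X$; 3) for every measurable $E$ with $\mu(E)<\infty$, $\chi_E\in X$ and there is $c_E>0$ with $\int_E|f|\,d\mu\le c_E\|f\|_X$. Functions in $X$ are regarded as finite-valued and defined at every point, not as equivalence classes. Steklov averages: $A_hf(x)=\frac1h\int_{x-h/2}^{x+h/2}f(t)\,dt$ and $\dot A_hf(x)=A_hf(x+\tfrac h2)=\frac1h\int_x^{x+h}f(t)\,dt$ for $h>0$; $I$ is the identity. Assumption A: $A_hf\in X$ for all $f\in X$, $h>0$, and $\sup_{h>0,\,\|f\|_X\le1}\|A_hf\|_X<\infty$. $\mathcal T_n$ is the set of trigonometric polynomials of degree at most $n$. $(\Phi_n)$ are linear subspaces of $X$ with $\Phi_m\subset\Phi_n$ for $m\le n$, $\Phi_0=\{0\}$, satisfying $\|\varphi^{(q)}\|_X\le(Bn)^q\|\varphi\|_X$ for all $q\in\mathbb N$, $\varphi\in\Phi_n$, with a constant $B=B_X>0$. (If $X$ is translation-invariant, spline spaces of smoothness $s$ are also admitted, with this inequality required only for $q\le s$.) Sampling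 operators: $G_nf(x)=\sum_{k=1}^{m_n}f(x_{k,n})\varphi_{k,n}(x)$, $n\in\mathbb N$, $G_0:=0$, where $\varphi_{k,n}\in\Phi_n$ are $2\pi$-periodic and $x_k=x_{k,n}\in\mathbb T$ are nodes such that for some fixed $\gamma,\gamma'>0$, $\frac{\gamma}{n}\le x_{k+1,n}-x_{k,n}\le\frac{\gamma'}{n}$ for $k=1,\dots,m_n$, with $x_{m_n+1,n}=2\pi+x_{1,n}$. The constant $\gamma$ in the claim is this one. The discrete semi-norm is $\|f\|_{X_n}=\big\|\sum_{k=1}^{m_n}|f(x_k)|\chi_{[x_k,x_{k+1})}\big\|_X$. *)

(* Defs.v *)
From mathcomp Require Import all_boot all_order all_algebra.
From mathcomp Require Import all_classical all_reals all_analysis.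

Set Implicit Arguments.
Unset Strict Implicit.
Unset Printing Implicit Defensive.

Import Order.TTheory GRing.Theory Num.Theory.
Import numFieldNormedType.Exports.

Local Open Scope classical_set_scope.
Local Open Scope ring_scope.

(* R with the Lebesgue (not merely Borel) sigma-algebra, on which the library
   defines completed_lebesgue_measure. *)
Notation lebesgueType R := (caratheodory_type (@wlength R idfun)^*%mu).

Definition halfopen_period (R : realType) : set (lebesgueType R) :=
  `[- pi, pi[%classic.

Lemma measurable_halfopen_period (R : realType) :
  measurable (@halfopen_period R).
Proof.
apply: sub_caratheodory.
exact: (@measurable_itv R `[- pi, pi[).
Qed.

Lemma inv2pi_ge0 (R : realType) : 0 <= (2 * pi)^-1 :> R.
Proof. by rewrite invr_ge0 mulr_ge0 ?pi_ge0. Qed.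

(* Functions on the circle are functions R -> R of period 2 pi, and subsets of
   the circle are subsets of R invariant under translation by 2 pi; the
   normalized Lebesgue measure reads them on the period [-pi, pi[. *)
Definition circle_measure (R : realType) :
    {measure set (lebesgueType R) -> \bar R} :=
  mscale (NngNum (inv2pi_ge0 R))
    (mrestr (@completed_lebesgue_measure R) (@measurable_halfopen_period R)).

Definition circle_fun (R : realType) (f : R -> R) : Prop :=
  measurable_fun (setT : set (lebesgueType R)) f /\ periodic f (2 * pi).

Definition circle_set (R : realType) (E : set R) : Prop :=
  measurable (E : set (lebesgueType R)) /\
  (forall x, E (x + 2 * pi) <-> E x).

(* The elements of X are genuine functions; order, monotone limits and
   vanishing are understood almost everywhere, so that nX is the norm of the
   associated space of classes. *)
Record banach_lattice (R : realType) (X : set (R -> R)) (nX : (R -> R) -> R) :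
    Prop := {
  bl_fun : forall f, X f -> circle_fun f ;
  bl_zero : X (fun=> 0) ;
  bl_lin : forall (a : R) f g, X f -> X g -> X (fun x => a * f x + g x) ;
  bl_norm_ge0 : forall f, X f -> 0 <= nX f ;
  bl_norm_eq0 : forall f, X f ->
    (nX f = 0 <-> {ae circle_measure R, forall x, f x = 0}) ;
  bl_normZ : forall (a : R) f, X f -> nX (fun x => a * f x) = `|a| * nX f ;
  bl_normD : forall f g, X f -> X g -> nX (fun x => f x + g x) <= nX f + nX g ;
  bl_complete : forall u : nat -> R -> R, (forall k, X (u k)) ->
    (forall e, 0 < e -> exists k0, forall k l, (k0 <= k)%N -> (k0 <= l)%N ->
      nX (fun x => u k x - u l x) < e) ->
    exists2 f, X f & (fun k => nX (fun x => u k x - f x)) @ \oo --> (0 : R) ;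
  bl_ideal : forall f g, circle_fun f -> X g ->
    {ae circle_measure R, forall x, `|f x| <= `|g x|} ->
    X f /\ nX f <= nX g ;
  bl_fatou : forall (u : nat -> R -> R) f, (forall k, X (u k)) ->
    (exists M, forall k, nX (u k) <= M) -> circle_fun f ->
    (forall k, {ae circle_measure R, forall x, 0 <= u k x <= u k.+1 x}) ->
    {ae circle_measure R, forall x, (fun k => u k x) @ \oo --> f x} ->
    X f /\ (fun k => nX (u k)) @ \oo --> nX f ;
  bl_indic : forall E, circle_set E -> (circle_measure R E < +oo)%E ->
    X (\1_E : R -> R) /\
    exists2 c : R, 0 < c & forall f, X f ->
      (\int[circle_measure R]_(x in E) `|f x|%:E <= (c * nX f)%:E)%E
}.

Definition steklov (R : realType) (h : R) (f : R -> R) : R -> R := fun x =>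
  h^-1 * \int[@completed_lebesgue_measure R]_(t in `[x - h / 2, x + h / 2]) f t.

Definition steklov_fwd (R : realType) (h : R) (f : R -> R) : R -> R :=
  fun x => steklov h f (x + h / 2).

(* (I - L)^s *)
Definition one_sub_pow (R : realType) (L : (R -> R) -> (R -> R)) (s : nat) :
    (R -> R) -> (R -> R) :=
  iter s (fun f x => f x - L f x).

Definition assumption_A (R : realType) (X : set (R -> R))
    (nX : (R -> R) -> R) : Prop :=
  (forall f h, X f -> 0 < h -> X (steklov h f)) /\
  exists M, forall f h, X f -> 0 < h -> nX f <= 1 -> nX (steklov h f) <= M.

Definition trig_poly (R : realType) (n : nat) : set (R -> R) :=
  [set T | exists a b : nat -> R, T = (fun x =>
    \sum_(k < n.+1) (a k * cos (k%:R * x) + b k * sin (k%:R * x)))].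

Definition translation_invariant (R : realType) (X : set (R -> R))
    (nX : (R -> R) -> R) : Prop :=
  forall f t, X f -> X (fun x => f (x + t)) /\ nX (fun x => f (x + t)) = nX f.

Definition smooth (R : realType) (f : R -> R) : Prop :=
  forall q x, derivable (derive1n q f) x 1.

(* Piecewise polynomial functions of class C^(s-1), s >= 1. Their s-th
   derivative exists off the knots, so the junk values of derive1n s there do
   not affect its norm. *)
Definition spline (R : realType) (s : nat) (f : R -> R) : Prop :=
  [/\ forall q, (q.+1 < s)%N -> forall x, derivable (derive1n q f) x 1,
      forall q, (q < s)%N -> continuous (derive1n q f) &
      exists (m : nat) (t : nat -> R) (p : nat -> {poly R}),
        [/\ t 0%N = - pi, t m = pi &
            forall j, (j < m)%N -> t j < t j.+1 /\
              forall x, t j <= x < t j.+1 -> f x = (p j).[x]]].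

Definition bernstein (R : realType) (X : set (R -> R)) (nX : (R -> R) -> R)
    (Phi : nat -> set (R -> R)) (B : R) (q : nat) : Prop :=
  forall n phi, Phi n phi -> X (derive1n q phi) /\
    nX (derive1n q phi) <= (B * n%:R) ^+ q * nX phi.

Record approximation_spaces (R : realType) (X : set (R -> R))
    (nX : (R -> R) -> R) (Phi : nat -> set (R -> R)) : Prop := {
  as_sub : forall n, Phi n `<=` X ;
  as_zero : forall n, Phi n (fun=> 0) ;
  as_lin : forall n (a : R) f g, Phi n f -> Phi n g ->
    Phi n (fun x => a * f x + g x) ;
  as_mono : forall m n, (m <= n)%N -> Phi m `<=` Phi n ;
  as_Phi0 : Phi 0%N = [set (fun=> 0)] ;
  as_bernstein : exists2 B : R, 0 < B &
    ((forall n, Phi n `<=` @smooth R) /\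
       forall q, bernstein X nX Phi B q) \/
    (translation_invariant X nX /\
       exists2 s : nat, (0 < s)%N &
         (forall n, Phi n `<=` @spline R s) /\
         forall q, (q <= s)%N -> bernstein X nX Phi B q)
}.

(* The nodes of G_n are x n 1, ..., x n (m n); the entry x n (m n).+1 is
   2 pi + x n 1. *)
Definition sampling_op (R : realType) (m : nat -> nat) (x : nat -> nat -> R)
    (phi : nat -> nat -> R -> R) (n : nat) (f : R -> R) : R -> R := fun y =>
  if n is 0%N then 0 else \sum_(1 <= k < (m n).+1) f (x n k) * phi n k y.

Definition sampling_system (R : realType) (Phi : nat -> set (R -> R))
    (gamma gamma' : R) (m : nat -> nat) (x : nat -> nat -> R)
    (phi : nat -> nat -> R -> R) : Prop :=
  forall n, (0 < n)%N ->
    x n (m n).+1 = 2 * pi + x n 1%N /\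
    forall k, (1 <= k <= m n)%N ->
      [/\ Phi n (phi n k), periodic (phi n k) (2 * pi), - pi <= x n k < pi &
          gamma / n%:R <= x n k.+1 - x n k <= gamma' / n%:R].

(* the image of [a, b[ on the circle *)
Definition arc (R : realType) (a b : R) : set R :=
  [set y | exists j : int, a <= y + j%:~R * (2 * pi) < b].

Definition discrete_norm (R : realType) (nX : (R -> R) -> R)
    (m : nat -> nat) (x : nat -> nat -> R) (n : nat) (f : R -> R) : R :=
  nX (fun y => \sum_(1 <= k < (m n).+1)
    `|f (x n k)| * \1_(arc (x n k) (x n k.+1)) y).

(* Main.v *)
(**
  Write h = gamma / n and w = ||(I - A'_h)^s f||, with A'_h the forward average.
  The heart of the matter is a trigonometric polynomial T of degree n with
  ||f - T|| <= C w (up to an arbitrarily small error), n^(-s) ||T^(s)|| <= C w and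
  ||(I - A_h)^r T|| <= C w.  Then f - G_n f = (f - T) + (T - G_n T) + G_n (T - f), and
  the telescoping of I - (I - A_h)^r bounds the discrete norm of f - T by that of
  (I - A_h)^r (f - T) plus C ||f - T||, because ||A_h g||_(X_n) <= C ||g||_X.

  To find T, write f = (I - L)^s f + P(L) f with L = A'_h^(2m) and P(0) = 0.
  Averaging smooths: h^2 (L g)'' is dominated pointwise by a long average of |g|
  times the central binomial weight C(2m, m) / 4^m, which tends to 0 with m.  For m
  large, Jackson's theorem therefore approximates P(L) (f - T) by polynomials with
  error ||f - T|| / 2, so a polynomial T can be replaced by one with
  ||f - T'|| <= C w + ||f - T|| / 2; iterate from T = 0.  This only yields
  polynomials of degree at most delta n, with delta small, which is what lets
  Bernstein's inequality absorb the Taylor remainder in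
  h ||U'|| <= C ||(I - A'_h) U||; applied s times, this bounds the derivatives of T.

  X need not be translation invariant, so convolutions are not bounded on X a priori.
  Every kernel is dominated by a combination of indicators of dyadic windows, whose
  convolutions are Steklov averages, bounded by Assumption A.
*)
Require Import Defs.
From mathcomp Require Import all_boot all_order all_algebra.
From mathcomp Require Import all_classical all_reals all_analysis.
From mathcomp Require Import measurable_realfun.
From mathcomp Require Import ring lra zify.

Set Implicit Arguments.
Unset Strict Implicit.
Unset Printing Implicit Defensive.

Import Order.TTheory GRing.Theory Num.Theory.
Import numFieldNormedType.Exports.

Local Open Scope classical_set_scope.
Local Open Scope ring_scope.

(** The order in which the constants are fixed is the crux. Bernstein's inequality absorbs the
    Taylor remainder only if h times the degree is small, so delta comes first. This is the wrong
    regime for Jackson's theorem: its error, of order (degree * h)^(-2), gets a large constant, and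
    only the number 2m of averages is left to offset it. The central binomial weight arises as
    follows. Let S be the shift by h/2. Halving gives A'_h = (1 + S)/2 A'_(h/2), and each derivative
    of A'_h is h^(-1) (S^2 - 1). Hence two derivatives of A'_h^(2m) involve (S - 1)^2 (1 + S)^(2m),
    a second difference of binomial coefficients: size C(2m, m) / m, spread over a window of length
    of order m h. The factors m cancel and C(2m, m) / 4^m remains, at most of order m^(-1/2). The
    small error is the price of stopping the iteration after finitely many steps; no constant
    depends on it, and it is sent to 0 at the very end. The condition 2r >= s enters when h^(2r)
    ||T^(2r)|| is reduced to h^s ||T^(s)|| by Bernstein's inequality. *)

(** * Translation invariance of the completed Lebesgue measure *)

Section LebesgueIntervals.
Variable R : realType.
Notation mu := (@completed_lebesgue_measure R).
Notation LT := (lebesgueType R).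

Lemma measurable_lebesgue_itv (i : interval R) : measurable ([set` i] : set LT).
Proof. by apply: sub_caratheodory; exact: measurable_itv. Qed.

Lemma continuous_measurable_lebesgue (f : R -> R) :
  continuous f -> measurable_fun (setT : set LT) f.
Proof.
move=> /continuous_measurable_fun mf _ Y mY; rewrite setTI.
by apply: sub_caratheodory; rewrite -[X in measurable X]setTI; exact: mf.
Qed.

Lemma completed_lebesgue_measure_itvcc (a b : R) :
  a <= b -> mu `[a, b]%classic = (b - a)%:E.
Proof.
move=> ab; rewrite -[LHS]/(@lebesgue_measure R `[a, b]%classic).
rewrite lebesgue_measure_itv /= lte_fin; case: ltP => //.
by move=> ba; have -> : a = b; [lra|rewrite subrr].
Qed.

Lemma completed_lebesgue_measure_set1 (a : R) : mu [set a] = 0%E.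
Proof. exact: (@lebesgue_measure_set1 R a). Qed.

(** A cover of [A] by half-open intervals translates into a cover of the shifted set with the same
    lengths. The set [A] is arbitrary because Caratheodory's criterion tests against arbitrary
    sets. *)
Lemma lebesgue_outer_measure_shift_le (c : R) (A : set R) :
  (mu [set x | A (x + c)%R] <= mu A)%E.
Proof.
rewrite /completed_lebesgue_measure /completed_lebesgue_stieltjes_measure.
rewrite /completed_measure_extension /mu_ext.
apply: ereal_inf_le_tmp => _ [F [mF AF] <-].
exists (fun k => [set x | F k (x + c)]).
  split=> [k|x /AF [k _ Fk]]; last by exists k.
  have [[a b] /= _ <-] := mF k.
  exists (a - c, b - c) => //=.
  by apply/seteqP; split => x /=; rewrite !in_itv /= => /andP[? ?]; apply/andP; split; lra.
apply: eq_eseriesr => k _.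
have [[a b] /= _ <-] := mF k.
rewrite (_ : [set x | `]a, b]%classic (x + c)] = `]a - c, b - c]%classic); last first.
  by apply/seteqP; split => x /=; rewrite !in_itv /= => /andP[? ?]; apply/andP; split; lra.
rewrite !wlength_itv /= !lte_fin ltrD2r.
by case: ifP => // _; rewrite -!EFinB; congr (_%:E); ring.
Qed.

Lemma lebesgue_outer_measure_shift (c : R) (A : set R) :
  mu [set x | A (x + c)%R] = mu A.
Proof.
apply/eqP; rewrite eq_le lebesgue_outer_measure_shift_le /=.
rewrite [X in (X <= _)%E](_ : _ = mu [set x | [set x | A (x + c)%R] (x + (- c))%R]).
  exact: lebesgue_outer_measure_shift_le.
by congr (mu _); apply/seteqP; split => x /=; rewrite subrK.
Qed.

(** Testing the shifted set against [Y] amounts to testing [A] against [Y] shifted back, by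
    invariance of the outer measure. *)
Lemma measurable_lebesgue_shift (c : R) :
  measurable_fun (setT : set LT) ((fun x => x + c) : LT -> LT).
Proof.
move=> _ A mA; rewrite setTI.
have {}mA Y : mu Y = (mu (Y `&` A) + mu (Y `&` ~` A))%E by exact: mA.
suff: (mu : set R -> \bar R).-caratheodory [set x | A (x + c)] by [].
move=> Y.
rewrite -[LHS](lebesgue_outer_measure_shift (- c) Y) mA.
rewrite -(lebesgue_outer_measure_shift c (_ `&` A)).
rewrite -(lebesgue_outer_measure_shift c (_ `&` ~` A)).
by congr (mu _ + mu _)%E; apply/seteqP; split => x /=; rewrite !addrK.
Qed.

(** The measure is its own pushforward under the shift. *)
Lemma ge0_integral_lebesgue_shift (c : R) (f : LT -> \bar R) (D : set LT) :
  measurable D -> measurable_fun D f -> (forall x, D x -> 0 <= f x)%E ->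
  (\int[mu]_(x in D) f x = \int[mu]_(x in [set x | D (x + c)%R]) f (x + c)%R)%E.
Proof.
move=> mD mf f0.
have f0' : {in D, forall y, 0 <= f y}%E by move=> y /set_mem; exact: f0.
apply: etrans (@ge0_integral_pushforward _ _ LT LT R _ (measurable_lebesgue_shift c) mu D f mD mf f0').
apply: eq_measure_integral => [|mT A mA _]; first exact: measurable_lebesgue_shift.
by apply: esym; exact: lebesgue_outer_measure_shift.
Qed.

End LebesgueIntervals.

(** * Locally integrable functions and their primitives *)

Section LocallyIntegrable.
Variable R : realType.
Notation mu := (@completed_lebesgue_measure R).
Notation LT := (lebesgueType R).
Implicit Types (f g : R -> R) (a b c : R).

Definition locint f := measurable_fun (setT : set LT) f /\
  forall a b, mu.-integrable (`[a, b]%classic : set LT) (EFin \o f).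

(** Not oriented: for b < a the interval is empty and the value is 0. *)
Definition itg f a b := \int[mu]_(t in (`[a, b]%classic : set LT)) f t.

Lemma locint_lin k f g : locint f -> locint g -> locint (fun x => k * f x + g x).
Proof.
move=> [mf lf] [mg lg]; split.
  exact: (measurable_funD (measurable_funM (measurable_cst k) mf) mg).
move=> a b; have -> : EFin \o (fun x => k * f x + g x) =
    ((fun x => k%:E * (EFin \o f) x) \+ (EFin \o g))%E by [].
apply: integrableD => //; first exact: measurable_lebesgue_itv.
by apply: integrableZl => //; exact: measurable_lebesgue_itv.
Qed.

Lemma locint_norm f : locint f -> locint (fun x => `|f x|).
Proof.
move=> [mf lf]; split; first exact: measurableT_comp.
by move=> a b; exact: (integrable_norm (lf a b)).
Qed.

Lemma locint_bounded f : measurable_fun (setT : set LT) f ->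
  (forall a b, exists M, forall x, a <= x <= b -> `|f x| <= M) -> locint f.
Proof.
move=> mf bf; split => // a b.
have [ab|ba] := leP a b; last first.
  rewrite set_itv_ge ?bnd_simp -?ltNge//; exact: integrable_set0.
have [M HM] := bf a b.
apply: measurable_bounded_integrable.
- exact: measurable_lebesgue_itv.
- by rewrite -[X in (X < _)%E]/(mu `[a, b]%classic) completed_lebesgue_measure_itvcc// ltry.
- exact: measurable_funS mf.
- exists `|M|; split; first exact: num_real.
  move=> y My x /=; rewrite in_itv /= => /HM; move: My (ler_norm M); lra.
Qed.

Lemma locint_continuous f : continuous f -> locint f.
Proof.
move=> cf; apply: locint_bounded; first exact: continuous_measurable_lebesgue.
move=> a b; have [ab|ba] := leP a b; last by exists 0 => x /andP[? ?]; exfalso; lra.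
have cn : {within `[a, b], continuous (fun x => `|f x|)}.
  apply: continuous_subspaceT => x.
  by apply: continuous_comp; [exact: cf|exact: norm_continuous].
have [c _ Hc] := EVT_max ab cn.
by exists (`|f c|) => x axb; apply: Hc; rewrite in_itv.
Qed.

Lemma itg_lin k f g a b : locint f -> locint g ->
  itg (fun x => k * f x + g x) a b = k * itg f a b + itg g a b.
Proof.
move=> [mf lf] [mg lg]; have mI := @measurable_lebesgue_itv R `[a, b].
rewrite /itg RintegralD//; last first.
  exact: (@integrableZl _ _ _ mu _ mI k (EFin \o f)).
by rewrite RintegralZl.
Qed.

Lemma itg_le f g a b : locint f -> locint g ->
  (forall x, a <= x <= b -> f x <= g x) -> itg f a b <= itg g a b.
Proof.
move=> [mf lf] [mg lg] fg; apply: (le_Rintegral (@measurable_lebesgue_itv R `[a, b]) (lf a b) (lg a b)).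
by move=> x /=; rewrite in_itv; exact: fg.
Qed.

Lemma itg_norm f a b : locint f -> `|itg f a b| <= itg (fun x => `|f x|) a b.
Proof.
move=> [mf lf].
exact: (le_normr_Rintegral (@measurable_lebesgue_itv R `[a, b]) (lf a b)).
Qed.

Lemma itg_cst k a b : a <= b -> itg (fun=> k) a b = k * (b - a).
Proof.
move=> ab; rewrite /itg Rintegral_cst; last exact: measurable_lebesgue_itv.
by congr (_ * _); rewrite -[X in fine X]/(mu `[a, b]%classic) completed_lebesgue_measure_itvcc.
Qed.

Lemma itg_cat f a b c : locint f -> a <= b -> b <= c ->
  itg f a c = itg f a b + itg f b c.
Proof.
move=> [mf lf] ab bc.
have mbc := @measurable_lebesgue_itv R `]b, c].
have mab := @measurable_lebesgue_itv R `[a, b].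
(* The common endpoint is a null set; dropping it makes the two pieces disjoint. *)
have -> : itg f b c = \int[mu]_(t in (`]b, c]%classic : set LT)) f t.
  rewrite /itg /Rintegral (@negligible_integral _ _ _ mu _ [set b]) => //.
  - congr (fine (integral _ _ _)); apply/seteqP; split => x /=; rewrite !in_itv /=.
      by move=> [/andP[bx ->] xb]; rewrite andbT lt_neqAle bx andbT eq_sym; apply/eqP.
    by move=> /andP[bx ->]; rewrite (ltW bx); split => // xb; rewrite xb ltxx in bx.
  - by rewrite -set_itv1; exact: measurable_lebesgue_itv.
  - exact: measurable_lebesgue_itv.
  - exact: completed_lebesgue_measure_set1.
have E : `[a, c]%classic = (`[a, b] `|` `]b, c])%classic :> set LT.
  apply/seteqP; split => x /=; rewrite !in_itv /=.
    by move=> /andP[ax xc]; have [xb|bx] := leP x b; [left|right]; rewrite ?ax ?xb ?bx.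
  by case=> /andP[? ?]; apply/andP; split; lra.
rewrite /itg E Rintegral_setU//; first by rewrite -E.
apply/disj_setPS => x [] /=; rewrite !in_itv /= => /andP[_ xb] /andP[bx _].
by move: (lt_le_trans bx xb); rewrite ltxx.
Qed.

Lemma itg_ge0 f a b : (forall x, a <= x <= b -> 0 <= f x) -> 0 <= itg f a b.
Proof. by move=> f0; apply: Rintegral_ge0 => x /=; rewrite in_itv; exact: f0. Qed.

(** The primitive vanishing at 0, with the sign put in by hand because [itg] is not oriented. *)
Definition prim f x := if 0 <= x then itg f 0 x else - itg f x 0.

Lemma prim_sub f a b : locint f -> a <= b -> prim f b - prim f a = itg f a b.
Proof.
move=> lf ab; rewrite /prim.
have [a0|a0] := leP 0 a; have [b0|b0] := leP 0 b.
- by rewrite (@itg_cat f 0 a b)//; lra.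
- by exfalso; lra.
- by rewrite (@itg_cat f a 0 b) ?(ltW a0)//; lra.
- by rewrite (@itg_cat f a b 0) ?(ltW b0)//; lra.
Qed.

Lemma prim_lin k f g x : locint f -> locint g ->
  prim (fun x => k * f x + g x) x = k * prim f x + prim g x.
Proof. by move=> lf lg; rewrite /prim; case: ifP => _; rewrite itg_lin//; lra. Qed.

Lemma prim_homo f a b : locint f -> (forall x, 0 <= f x) -> a <= b ->
  prim f a <= prim f b.
Proof. by move=> lf f0 ab; rewrite -subr_ge0 prim_sub//; exact: itg_ge0. Qed.

Lemma prim_cst k x : prim (fun=> k) x = k * x.
Proof.
by rewrite /prim; case: leP => x0; rewrite itg_cst//; lra.
Qed.

Lemma prim_norm f a b : locint f -> a <= b ->
  `|prim f b - prim f a| <= prim (fun x => `|f x|) b - prim (fun x => `|f x|) a.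
Proof.
move=> lf ab; rewrite (prim_sub lf ab) (prim_sub (locint_norm lf) ab); exact: itg_norm.
Qed.

Lemma prim_le f g a b : locint f -> locint g -> a <= b ->
  (forall x, a <= x <= b -> f x <= g x) ->
  prim f b - prim f a <= prim g b - prim g a.
Proof. by move=> lf lg ab fg; rewrite !prim_sub//; exact: itg_le. Qed.

(** Absolute continuity of the integral, applied to [f] cut off outside [-K, K], which is integrable
    on the whole line. *)
Lemma itg_abs_continuous f K : locint f -> forall e, 0 < e -> exists2 d, 0 < d &
  forall a b, - K <= a -> a <= b -> b <= K -> b - a < d -> itg (fun x => `|f x|) a b < e.
Proof.
move=> [mf lf] e e0; have mK := @measurable_lebesgue_itv R `[-K, K].
have iK : mu.-integrable setT (EFin \o (f \_ (`[-K, K]%classic : set LT))).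
  by rewrite -restrict_EFin; apply/(integrable_mkcond _ mK).
have [d [d0 H]] := integral_normr_continuous iK e0.
exists d => // a b Ka ab bK bad.
have mab := @measurable_lebesgue_itv R `[a, b].
have := H _ mab; rewrite -[X in (X < _)%E -> _]/(mu `[a, b]%classic).
rewrite completed_lebesgue_measure_itvcc// lte_fin.
move=> /(_ bad); congr (_ < _); apply: eq_Rintegral => x /set_mem /=.
rewrite in_itv /= => /andP[ax xb]; congr `|_|; rewrite patchE ifT//.
by apply/mem_set; rewrite /= in_itv /=; apply/andP; split; lra.
Qed.

Lemma prim_continuous f : locint f -> continuous (prim f).
Proof.
move=> lf x; apply/cvgrPdist_lt => e e0.
have [d d0 H] := @itg_abs_continuous f (`|x| + 1) lf _ e0.
have Hab a b : - (`|x| + 1) <= a -> a <= b -> b <= `|x| + 1 -> b - a < d ->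
    `|prim f b - prim f a| < e.
  by move=> ? ? ? ?; rewrite prim_sub//; apply: le_lt_trans (itg_norm _ _ lf) (H _ _ _ _ _ _).
near=> y.
have xyd : `|x - y| < d by near: y; apply: cvgr_dist_lt.
have xy1 : `|x - y| < 1 by near: y; apply: cvgr_dist_lt.
have nx := ler_norm x; have px := lerNnormlW (lexx `|x|).
move: xyd => /ltr_normlP[? ?]; move: xy1 => /ltr_normlP[? ?].
have [xy|yx] := leP x y; last by apply: Hab; lra.
by rewrite distrC; apply: Hab; lra.
Unshelve. all: by end_near. Qed.

Lemma prim_derive f x : continuous f -> is_derive x (1 : R) (prim f) (f x).
Proof.
move=> cf; have lf := locint_continuous cf.
suff H : (fun h => h^-1 *: (prim f (h + x) - prim f x)) @ 0^' --> f x.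
  have H' : (fun h => h^-1 *: ((prim f \o shift x) (h *: (1:R)) - prim f x)) @ 0^' --> f x.
    by under eq_fun do rewrite /= [X in X + x]mulr1.
  apply: DeriveDef; last exact: cvg_lim H'.
  by apply/cvg_ex; exists (f x).
apply/cvgrPdist_le => e e0.
have : \forall y \near x, `|f x - f y| <= e by move/cvgrPdist_le : (cf x); apply.
move=> /nbhs_ballP[d /= d0 Hd].
(* Stated for any ordered pair near x, to serve both signs of the increment. *)
have key a b : a <= b -> x - d < a -> b < x + d -> `|prim f b - prim f a - f x * (b - a)| <= e * (b - a).
  move=> ab xa bx; rewrite -(itg_cst e ab) -(itg_cst (f x) ab).
  have Eq : prim f b - prim f a - itg (fun=> f x) a b =
      itg (fun t => (-1) * f x + f t) a b.
    rewrite (@itg_lin (-1) (fun=> f x))//; last exact/locint_continuous/cst_continuous.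
    by rewrite prim_sub//; ring.
  have lg : locint (fun t => (-1) * f x + f t).
    by apply: (@locint_lin (-1) (fun=> f x)) => //; exact/locint_continuous/cst_continuous.
  rewrite Eq; apply: le_trans (itg_norm _ _ lg) _; apply: itg_le.
  - exact: locint_norm.
  - exact/locint_continuous/cst_continuous.
  - move=> t /andP[at_ tb]; rewrite mulN1r addrC distrC; apply: Hd.
    by rewrite /ball /= ltr_norml; apply/andP; split; lra.
near=> h.
have h0 : h != 0 by near: h; exact: nbhs_dnbhs_neq.
have hd : `|h| < d.
  near: h; apply: dnbhs0_lt; exact: d0.
have -> : f x - h^-1 *: (prim f (h + x) - prim f x) =
    - (h^-1 * (prim f (h + x) - prim f x - f x * h)).
  by rewrite -[_ *: _]/(_ * _); field.
rewrite normrN normrM normfV ler_pdivrMl ?normr_gt0// [_ * e]mulrC.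
move: hd => /ltr_normlP[hd1 hd2].
have [h0'|h0'] := leP 0 h.
  rewrite (ger0_norm h0'); have := key x (h + x).
  by rewrite addrK; apply; lra.
rewrite (ltr0_norm h0') -normrN; have := key (h + x) x.
rewrite (_ : x - (h + x) = - h); last by ring.
rewrite (_ : - (_ - _) = prim f x - prim f (h + x) - f x * - h); last by ring.
by apply; lra.
Unshelve. all: by end_near. Qed.
End LocallyIntegrable.

(** * Derivatives, oriented integrals and a Taylor estimate *)

Section Calculus.
Variable R : realType.
Implicit Types (f g F G : R -> R) (a b c x t : R).

Definition has_deriv F f := forall x, is_derive x (1 : R) F (f x).

(** The oriented integral: additivity holds for endpoints in any order, and most identities become
    linear arithmetic on values of [prim]. *)
Definition dint f a b := prim f b - prim f a.

Lemma has_deriv_continuous F f : has_deriv F f -> continuous F.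
Proof.
move=> dF x; apply/differentiable_continuous/derivable1_diffP.
by have [] := dF x.
Qed.

Lemma has_deriv_eq F f g : has_deriv F f -> f =1 g -> has_deriv F g.
Proof. by move=> dF fg x; rewrite -fg. Qed.

Lemma has_derivE F f : has_deriv F f -> F^`()%classic = f.
Proof. by move=> dF; apply/funext => x; rewrite derive1E; have [_ ->] := dF x. Qed.

Lemma has_deriv_lin k F G f g : has_deriv F f -> has_deriv G g ->
  has_deriv (fun x => k * F x + G x) (fun x => k * f x + g x).
Proof.
move=> dF dG x; have := dF x; have := dG x => ? ?.
exact: (@is_deriveD _ _ _ (fun x => k * F x) G x 1 (k * f x) (g x)).
Qed.

Lemma has_deriv_cst k : has_deriv (fun=> k) (fun=> 0).
Proof. by move=> x; exact: is_derive_cst. Qed.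

Lemma has_deriv_id : has_deriv (fun x => x) (fun=> 1).
Proof. by move=> x; exact: is_derive_id. Qed.

Lemma has_deriv_comp F f G g : has_deriv F f -> has_deriv G g ->
  has_deriv (fun x => F (G x)) (fun x => f (G x) * g x).
Proof.
move=> dF dG x; have := dF (G x); have := dG x => ? ?.
exact: (is_derive1_comp (f := F) (g := G)).
Qed.

Lemma has_deriv_affine F f k c : has_deriv F f ->
  has_deriv (fun x => F (k * x + c)) (fun x => k * f (k * x + c)).
Proof.
move=> dF; have dG := has_deriv_lin k has_deriv_id (has_deriv_cst c).
by apply: has_deriv_eq (has_deriv_comp dF dG) _ => x /=; rewrite mulr1 addr0 mulrC.
Qed.

Lemma has_deriv_shift F f c : has_deriv F f ->
  has_deriv (fun x => F (x + c)) (fun x => f (x + c)).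
Proof.
move=> dF; have := has_deriv_affine 1 c dF.
under [X in has_deriv X _ -> _]eq_fun do rewrite mul1r.
by move=> H; apply: has_deriv_eq H _ => x; rewrite !mul1r.
Qed.

Lemma has_deriv_prim f : continuous f -> has_deriv (prim f) f.
Proof. by move=> cf x; exact: prim_derive. Qed.

(** [F] and [prim f] have the same derivative, so they differ by a constant. *)
Lemma dint_primitive F f a b : continuous f -> has_deriv F f ->
  dint f a b = F b - F a.
Proof.
move=> cf dF; have dD := has_deriv_lin (- 1) dF (has_deriv_prim cf).
have := @is_derive_0_is_cst _ _ a b (has_deriv_eq dD (fun x => _)).
have E x : - 1 * f x + f x = 0 by ring.
move=> /(_ E); rewrite /dint; lra.
Qed.

Lemma continuous_affine f k c : continuous f -> continuous (fun x => f (k * x + c)).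
Proof.
move=> cf x; apply: (continuous_comp (f := fun x => k * x + c) (g := f)); last exact: cf.
exact: has_deriv_continuous (has_deriv_lin k has_deriv_id (has_deriv_cst c)) x.
Qed.

Lemma continuous_shift f c : continuous f -> continuous (fun x => f (x + c)).
Proof.
move=> cf; have := @continuous_affine f 1 c cf.
by under eq_fun do rewrite mul1r.
Qed.

Lemma continuous_lin k f g : continuous f -> continuous g ->
  continuous (fun x => k * f x + g x).
Proof.
move=> cf cg x; apply: cvgD; last exact: cg.
by apply: cvgM; [exact: cvg_cst|exact: cf].
Qed.

Lemma continuousM f g : continuous f -> continuous g ->
  continuous (fun x => f x * g x).
Proof. by move=> cf cg x; apply: cvgM; [exact: cf|exact: cg]. Qed.

Lemma continuous_abs f : continuous f -> continuous (fun x => `|f x|).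
Proof.
by move=> cf x; apply: continuous_comp; [exact: cf|exact: norm_continuous].
Qed.

Lemma dint_shift f c a b : continuous f ->
  dint (fun x => f (x + c)) a b = dint f (a + c) (b + c).
Proof.
move=> cf; rewrite (@dint_primitive (fun x => prim f (x + c)) (fun x => f (x + c)))//.
  exact: continuous_shift.
exact/has_deriv_shift/has_deriv_prim.
Qed.

Lemma dint_reflect f a b : continuous f ->
  dint (fun x => f (- x)) a b = dint f (- b) (- a).
Proof.
move=> cf.
have cg : continuous (fun x => f (- x)).
  have := @continuous_affine f (- 1) 0 cf.
  by under eq_fun do rewrite mulN1r addr0.
rewrite (@dint_primitive (fun x => - 1 * prim f (- 1 * x + 0) + 0))//; last first.
  apply: has_deriv_eq (has_deriv_lin (- 1)
    (has_deriv_affine (- 1) 0 (has_deriv_prim cf)) (has_deriv_cst 0)) _ => x.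
  by rewrite !mulN1r !addr0 opprK.
by rewrite /dint !mulN1r !addr0 opprK addrC.
Qed.

Lemma dint_cat f a b c : dint f a b + dint f b c = dint f a c.
Proof. by rewrite /dint; lra. Qed.

Lemma dint_lin k f g a b : locint f -> locint g ->
  dint (fun x => k * f x + g x) a b = k * dint f a b + dint g a b.
Proof. by move=> lf lg; rewrite /dint !prim_lin//; lra. Qed.

Lemma dintZ k f a b : locint f -> dint (fun x => k * f x) a b = k * dint f a b.
Proof.
move=> lf; rewrite -[RHS]addr0.
rewrite (_ : (fun x => k * f x) = fun x => k * f x + 0); last by apply/funext => x; rewrite addr0.
rewrite (@dint_lin k f (fun=> 0))//; last exact/locint_continuous/cst_continuous.
by rewrite /dint !prim_cst; ring.
Qed.

Lemma dint_cst k a b : dint (fun=> k) a b = k * (b - a).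
Proof. by rewrite /dint !prim_cst; ring. Qed.

Lemma dint_periodic f p a b : continuous f -> (forall x, f (x + p) = f x) ->
  dint f a (a + p) = dint f b (b + p).
Proof.
move=> cf fp; have := @dint_shift f p a b cf.
under eq_fun do rewrite fp.
rewrite /dint; lra.
Qed.

Lemma dint_ge0 f a b : locint f -> (forall x, 0 <= f x) -> a <= b -> 0 <= dint f a b.
Proof. by move=> lf f0 ab; rewrite subr_ge0; exact: prim_homo. Qed.

Lemma dint_le_itv f a b c d : locint f -> (forall x, 0 <= f x) ->
  c <= a -> b <= d -> dint f a b <= dint f c d.
Proof.
by move=> lf f0 ca bd; have := prim_homo lf f0 ca; have := prim_homo lf f0 bd; rewrite /dint; lra.
Qed.

Lemma dint_sum n (c : nat -> R) (f : nat -> R -> R) a b :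
  (forall i, (i < n)%N -> locint (f i)) ->
  dint (fun x => \sum_(i < n) c i * f i x) a b = \sum_(i < n) c i * dint (f i) a b.
Proof.
elim: n => [|n IH] lf.
  rewrite big_ord0 (_ : (fun=> _) = fun=> 0) ?dint_cst ?mul0r//.
  by apply/funext => x; rewrite big_ord0.
have ls m : (m <= n)%N -> locint (fun x => \sum_(i < m) c i * f i x).
  elim: m => [_|m IHm mn].
    rewrite (_ : (fun=> _) = fun=> 0); first exact/locint_continuous/cst_continuous.
    by apply/funext => x; rewrite big_ord0.
  rewrite (_ : (fun=> _) = fun x => c m * f m x + \sum_(i < m) c i * f i x).
    by apply: locint_lin; [exact/lf/ltnW | exact/IHm/ltnW].
  by apply/funext => x; rewrite big_ord_recr addrC.
rewrite big_ord_recr /= -IH; last by move=> i ni; exact/lf/ltnW.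
rewrite addrC -dint_lin; [|exact: lf|exact: ls].
by congr dint; apply/funext => x; rewrite big_ord_recr addrC.
Qed.

Lemma mvt F f a b : has_deriv F f -> a <= b ->
  exists2 c, a <= c <= b & F b - F a = f c * (b - a).
Proof.
move=> dF ab; have [] := @MVT_segment _ F f _ _ ab.
- by move=> x _; exact: dF.
- exact/continuous_subspaceT/(has_deriv_continuous dF).
- by move=> c; rewrite in_itv; exists c.
Qed.

(* Second order Taylor estimate with remainder an integral over the symmetric
   window, which is what Steklov averages control. *)
Lemma taylor2 F F1 F2 x t : has_deriv F F1 -> has_deriv F1 F2 -> continuous F2 ->
  `|F (x + t) - F x - t * F1 x| <=
    `|t| * dint (fun y => `|F2 y|) (x - `|t|) (x + `|t|).
Proof.
move=> dF dF1 cF2.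
have lF2 := locint_continuous cF2.
have D0 y : 0 <= `|F2 y| by [].
have lN := locint_norm lF2.
have key c : x - `|t| <= c <= x + `|t| ->
    `|F1 c - F1 x| <= dint (fun y => `|F2 y|) (x - `|t|) (x + `|t|).
  move=> /andP[c1 c2]; rewrite -(dint_primitive _ _ cF2 dF1).
  have t0 := normr_ge0 t.
  have [xc|cx] := leP x c.
    by apply: le_trans (prim_norm lF2 xc) _; apply: dint_le_itv => //; lra.
  rewrite /dint distrC; apply: le_trans (prim_norm lF2 (ltW cx)) _.
  by apply: dint_le_itv => //; lra.
have [c Hc E] : exists2 c, x - `|t| <= c <= x + `|t| & F (x + t) - F x = t * F1 c.
  have [t0|t0] := leP 0 t.
    have [|c Hc E] := mvt (a := x) (b := x + t) dF; first lra.
    by exists c; [rewrite (ger0_norm t0); lra|rewrite E; ring].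
  have [|c Hc E] := mvt (a := x + t) (b := x) dF; first lra.
  by exists c; [rewrite (ltr0_norm t0); lra|rewrite -opprB E; ring].
by rewrite E -mulrBr normrM ler_wpM2l// key.
Qed.

End Calculus.

(** * Closure properties of trigonometric polynomials *)

Section TrigPoly.
Variable R : realType.
Implicit Types (F T U : R -> R) (a b c x t : R) (n k : nat).

(** Reduces a property stable under linear combinations to single harmonics, so that later proofs
    never handle coefficient sequences. *)
Lemma trig_poly_ind n (P : (R -> R) -> Prop) :
  P (fun=> 0) ->
  (forall c f g, P f -> P g -> P (fun x => c * f x + g x)) ->
  (forall k, (k <= n)%N -> P (fun x => cos (k%:R * x))) ->
  (forall k, (k <= n)%N -> P (fun x => sin (k%:R * x))) ->
  forall T, trig_poly n T -> P T.
Proof.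
move=> P0 Plin Pc Ps T [a [b ->]].
suff H m : (m <= n.+1)%N ->
    P (fun x => \sum_(k < m) (a k * cos (k%:R * x) + b k * sin (k%:R * x))).
  exact: H.
elim: m => [_|m IH mn].
  by rewrite (_ : (fun=> _) = fun=> 0)//; apply/funext => x; rewrite big_ord0.
rewrite (_ : (fun=> _) = fun x => a m * cos (m%:R * x) +
    (b m * sin (m%:R * x) +
      \sum_(k < m) (a k * cos (k%:R * x) + b k * sin (k%:R * x)))).
  by apply: (Plin); [exact: Pc|apply: (Plin); [exact: Ps|exact/IH/ltnW]].
by apply/funext => x; rewrite big_ord_recr /=; ring.
Qed.

Lemma trig_poly_lin n c T U : trig_poly n T -> trig_poly n U ->
  trig_poly n (fun x => c * T x + U x).
Proof.
move=> [a [b ->]] [a' [b' ->]].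
exists (fun k => c * a k + a' k), (fun k => c * b k + b' k).
apply/funext => x; rewrite mulr_sumr -big_split /=.
by apply: eq_bigr => k _; ring.
Qed.

Lemma trig_poly_cos n k : (k <= n)%N -> trig_poly n (fun x : R => cos (k%:R * x)).
Proof.
move=> kn; exists (fun i => (i == k)%:R), (fun=> 0); apply/funext => x.
rewrite (bigD1 (Ordinal (kn : (k < n.+1)%N)))//= eqxx mul1r mul0r addr0.
rewrite big1 ?addr0// => i /negbTE; rewrite -(inj_eq val_inj) /= => ->.
by rewrite !mul0r addr0.
Qed.

Lemma trig_poly_sin n k : (k <= n)%N -> trig_poly n (fun x : R => sin (k%:R * x)).
Proof.
move=> kn; exists (fun=> 0), (fun i => (i == k)%:R); apply/funext => x.
rewrite (bigD1 (Ordinal (kn : (k < n.+1)%N)))//= eqxx mul1r mul0r add0r.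
rewrite big1 ?addr0// => i /negbTE; rewrite -(inj_eq val_inj) /= => ->.
by rewrite !mul0r addr0.
Qed.

Lemma trig_poly0 n : trig_poly n (fun=> 0 : R).
Proof.
exists (fun=> 0), (fun=> 0); apply/funext => x.
by rewrite big1// => i _; rewrite !mul0r addr0.
Qed.

Lemma trig_polyZ n c T : trig_poly n T -> trig_poly n (fun x => c * T x).
Proof.
move=> hT; rewrite (_ : (fun=> _) = fun x => c * T x + 0).
  exact: trig_poly_lin hT (trig_poly0 n).
by apply/funext => x; rewrite addr0.
Qed.

Lemma trig_polyD n T U : trig_poly n T -> trig_poly n U ->
  trig_poly n (fun x => T x + U x).
Proof.
move=> hT hU; rewrite (_ : (fun=> _) = fun x => 1 * T x + U x).
  exact: trig_poly_lin.
by apply/funext => x; rewrite mul1r.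
Qed.

Lemma trig_polyB n T U : trig_poly n T -> trig_poly n U ->
  trig_poly n (fun x => T x - U x).
Proof.
move=> hT hU; rewrite (_ : (fun=> _) = fun x => - 1 * U x + T x).
  exact: trig_poly_lin.
by apply/funext => x; ring.
Qed.

Lemma trig_poly_cst n c : trig_poly n (fun=> c).
Proof.
rewrite (_ : (fun=> _) = fun x => c * cos (0%:R * x)).
  exact/trig_polyZ/trig_poly_cos.
by apply/funext => x; rewrite mul0r cos0 mulr1.
Qed.

Lemma trig_poly_sum n m (T : nat -> R -> R) :
  (forall i, (i < m)%N -> trig_poly n (T i)) ->
  trig_poly n (fun x => \sum_(i < m) T i x).
Proof.
elim: m => [|m IH] hT.
  rewrite (_ : (fun=> _) = fun=> 0); first exact: trig_poly0.
  by apply/funext => x; rewrite big_ord0.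
rewrite (_ : (fun=> _) = fun x => \sum_(i < m) T i x + T m x).
  by apply: trig_polyD; [apply: IH => i im; exact/hT/ltnW|exact: hT].
by apply/funext => x; rewrite big_ord_recr.
Qed.

Lemma trig_poly_mono n m T : (n <= m)%N -> trig_poly n T -> trig_poly m T.
Proof.
move=> nm; apply: trig_poly_ind.
- exact: trig_poly0.
- by move=> c f g; exact: trig_poly_lin.
- by move=> k kn; apply: trig_poly_cos; exact: leq_trans nm.
- by move=> k kn; apply: trig_poly_sin; exact: leq_trans nm.
Qed.

Lemma trig_poly_shift n c T : trig_poly n T -> trig_poly n (fun x => T (x + c)).
Proof.
apply: (trig_poly_ind (P := fun T => trig_poly n (fun x => T (x + c)))).
- exact: trig_poly0.
- by move=> d f g; exact: trig_poly_lin.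
- move=> k kn; rewrite (_ : (fun=> _) = fun x =>
      cos (k%:R * c) * cos (k%:R * x) + - sin (k%:R * c) * sin (k%:R * x)).
    by apply: trig_poly_lin; [exact: trig_poly_cos|exact/trig_polyZ/trig_poly_sin].
  by apply/funext => x; rewrite mulrDr cosD; ring.
- move=> k kn; rewrite (_ : (fun=> _) = fun x =>
      cos (k%:R * c) * sin (k%:R * x) + sin (k%:R * c) * cos (k%:R * x)).
    by apply: trig_poly_lin; [exact: trig_poly_sin|exact/trig_polyZ/trig_poly_cos].
  by apply/funext => x; rewrite mulrDr sinD; ring.
Qed.

Lemma has_deriv_sin c : has_deriv (fun x => sin (c * x)) (fun x => c * cos (c * x)).
Proof.
have := @has_deriv_affine _ sin cos c 0 (fun x => is_derive_sin x).
under [X in has_deriv X _]eq_fun do rewrite addr0.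
by move/has_deriv_eq; apply => x; rewrite addr0.
Qed.

Lemma has_deriv_cos c : has_deriv (fun x => cos (c * x)) (fun x => - (c * sin (c * x))).
Proof.
have := @has_deriv_affine _ cos (fun x => - sin x) c 0 (fun x => is_derive_cos x).
under [X in has_deriv X _]eq_fun do rewrite addr0.
by move/has_deriv_eq; apply => x; rewrite addr0 mulrN.
Qed.

Lemma trig_poly_has_deriv n T : trig_poly n T ->
  exists2 T', trig_poly n T' & has_deriv T T'.
Proof.
apply: (trig_poly_ind (P := fun T => exists2 T', trig_poly n T' & has_deriv T T')).
- by exists (fun=> 0); [exact: trig_poly0|exact: has_deriv_cst].
- move=> c f g [f' ? ?] [g' ? ?]; exists (fun x => c * f' x + g' x).
    exact: trig_poly_lin.
  exact: has_deriv_lin.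
- move=> k kn; exists (fun x => - (k%:R * sin (k%:R * x))); last exact: has_deriv_cos.
  rewrite (_ : (fun=> _) = fun x => - k%:R * sin (k%:R * x)).
    exact/trig_polyZ/trig_poly_sin.
  by apply/funext => x; rewrite mulNr.
- move=> k kn; exists (fun x => k%:R * cos (k%:R * x)); last exact: has_deriv_sin.
  exact/trig_polyZ/trig_poly_cos.
Qed.

Lemma trig_poly_derive1 n T : trig_poly n T ->
  trig_poly n T^`()%classic /\ has_deriv T T^`()%classic.
Proof. by move=> /trig_poly_has_deriv[T' hT' dT]; rewrite (has_derivE dT). Qed.

Lemma trig_poly_derive1n n T q : trig_poly n T -> trig_poly n (derive1n q T).
Proof.
move=> hT; elim: q => // q IH.
by rewrite derive1nS; exact: (trig_poly_derive1 IH).1.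
Qed.

Lemma trig_poly_continuous n T : trig_poly n T -> continuous T.
Proof. by move=> /trig_poly_has_deriv[T' _ /has_deriv_continuous]. Qed.

Lemma trig_poly_periodic n T : trig_poly n T -> periodic T (2 * pi).
Proof.
apply: (trig_poly_ind (P := fun T => periodic T (2 * pi))) => [x//|c f g fp gp x|k kn x|k kn x].
- by rewrite fp gp.
- have -> : k%:R * (x + 2 * pi) = k%:R * x + pi *+ 2 *+ k.
    by rewrite -(mulr_natl (pi *+ 2) k) -(mulr_natl pi 2) mulrDr.
  by rewrite periodicn//; exact: cosD2pi.
- have -> : k%:R * (x + 2 * pi) = k%:R * x + pi *+ 2 *+ k.
    by rewrite -(mulr_natl (pi *+ 2) k) -(mulr_natl pi 2) mulrDr.
  by rewrite periodicn//; exact: sinD2pi.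
Qed.

Lemma trig_polyM n m T U : trig_poly n T -> trig_poly m U ->
  trig_poly (n + m) (fun x => T x * U x).
Proof.
move=> hT; apply: (trig_poly_ind (P := fun U => trig_poly (n + m) (fun x => T x * U x))).
- rewrite (_ : (fun=> _) = fun=> 0); first exact: trig_poly0.
  by apply/funext => x; rewrite mulr0.
- move=> c f g hf hg; rewrite (_ : (fun=> _) = fun x => c * (T x * f x) + T x * g x).
    exact: trig_poly_lin.
  by apply/funext => x; ring.
- move=> k km; move: T hT.
  apply: (trig_poly_ind (P := fun T => trig_poly (n + m) (fun x => T x * cos (k%:R * x)))).
  + rewrite (_ : (fun=> _) = fun=> 0); first exact: trig_poly0.
    by apply/funext => x; rewrite mul0r.
  + move=> c f g hf hg; rewrite (_ : (fun=> _) =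
        fun x => c * (f x * cos (k%:R * x)) + g x * cos (k%:R * x)).
      exact: trig_poly_lin.
    by apply/funext => x; ring.
  (* The product-to-sum formulas need the frequency |l - k| as a natural number, hence the case
     split here and below. *)
  + move=> l ln; have [kl|lk] := leqP k l.
      rewrite (_ : (fun=> _) = fun x =>
          2^-1 * cos ((l - k)%:R * x) + 2^-1 * cos ((l + k)%:R * x)).
        by apply: trig_poly_lin; [|apply: trig_polyZ]; apply: trig_poly_cos; lia.
      by apply/funext => x; rewrite (natrB _ kl) natrD mulrBl mulrDl cosB cosD; field.
    rewrite (_ : (fun=> _) = fun x =>
        2^-1 * cos ((k - l)%:R * x) + 2^-1 * cos ((l + k)%:R * x)).
      by apply: trig_poly_lin; [|apply: trig_polyZ]; apply: trig_poly_cos; lia.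
    by apply/funext => x; rewrite (natrB _ (ltnW lk)) natrD mulrBl mulrDl cosB cosD; field.
  + move=> l ln; have [kl|lk] := leqP k l.
      rewrite (_ : (fun=> _) = fun x =>
          2^-1 * sin ((l - k)%:R * x) + 2^-1 * sin ((l + k)%:R * x)).
        by apply: trig_poly_lin; [|apply: trig_polyZ]; apply: trig_poly_sin; lia.
      by apply/funext => x; rewrite (natrB _ kl) natrD mulrBl mulrDl sinB sinD; field.
    rewrite (_ : (fun=> _) = fun x =>
        - 2^-1 * sin ((k - l)%:R * x) + 2^-1 * sin ((l + k)%:R * x)).
      by apply: trig_poly_lin; [|apply: trig_polyZ]; apply: trig_poly_sin; lia.
    by apply/funext => x; rewrite (natrB _ (ltnW lk)) natrD mulrBl mulrDl sinB sinD; field.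
- move=> k km; move: T hT.
  apply: (trig_poly_ind (P := fun T => trig_poly (n + m) (fun x => T x * sin (k%:R * x)))).
  + rewrite (_ : (fun=> _) = fun=> 0); first exact: trig_poly0.
    by apply/funext => x; rewrite mul0r.
  + move=> c f g hf hg; rewrite (_ : (fun=> _) =
        fun x => c * (f x * sin (k%:R * x)) + g x * sin (k%:R * x)).
      exact: trig_poly_lin.
    by apply/funext => x; ring.
  + move=> l ln; have [kl|lk] := leqP k l.
      rewrite (_ : (fun=> _) = fun x =>
          - 2^-1 * sin ((l - k)%:R * x) + 2^-1 * sin ((l + k)%:R * x)).
        by apply: trig_poly_lin; [|apply: trig_polyZ]; apply: trig_poly_sin; lia.
      by apply/funext => x; rewrite (natrB _ kl) natrD mulrBl mulrDl sinB sinD; field.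
    rewrite (_ : (fun=> _) = fun x =>
        2^-1 * sin ((k - l)%:R * x) + 2^-1 * sin ((l + k)%:R * x)).
      by apply: trig_poly_lin; [|apply: trig_polyZ]; apply: trig_poly_sin; lia.
    by apply/funext => x; rewrite (natrB _ (ltnW lk)) natrD mulrBl mulrDl sinB sinD; field.
  + move=> l ln; have [kl|lk] := leqP k l.
      rewrite (_ : (fun=> _) = fun x =>
          2^-1 * cos ((l - k)%:R * x) + - 2^-1 * cos ((l + k)%:R * x)).
        by apply: trig_poly_lin; [|apply: trig_polyZ]; apply: trig_poly_cos; lia.
      by apply/funext => x; rewrite (natrB _ kl) natrD mulrBl mulrDl cosB cosD; field.
    rewrite (_ : (fun=> _) = fun x =>
        2^-1 * cos ((k - l)%:R * x) + - 2^-1 * cos ((l + k)%:R * x)).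
      by apply: trig_poly_lin; [|apply: trig_polyZ]; apply: trig_poly_cos; lia.
    by apply/funext => x; rewrite (natrB _ (ltnW lk)) natrD mulrBl mulrDl cosB cosD; field.
Qed.

Lemma trig_poly_window n a b T : trig_poly n T ->
  trig_poly n (fun x => dint T (x + a) (x + b)).
Proof.
(* Continuity is carried through the induction because linearity of [dint] asks for local
   integrability. *)
move=> hT; pose P U := continuous U /\ trig_poly n (fun x => dint U (x + a) (x + b)).
suff: P T by case.
apply: trig_poly_ind hT; rewrite {}/P.
- split; first exact: cst_continuous.
  rewrite (_ : (fun=> _) = fun=> 0); first exact: trig_poly0.
  by apply/funext => x; rewrite dint_cst mul0r.
- move=> c f g [cf hf] [cg hg]; split; first exact: continuous_lin.
  rewrite (_ : (fun=> _) = fun x => c * dint f (x + a) (x + b) + dint g (x + a) (x + b)).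
    exact: trig_poly_lin.
  by apply/funext => x; rewrite dint_lin//; exact: locint_continuous.
- move=> k kn; split; first exact: has_deriv_continuous (has_deriv_cos _).
  (* Frequency 0 is apart, since the primitive of the other harmonics divides by k. *)
  have [->|k0] := eqVneq k 0%N.
    rewrite (_ : (fun=> _) = fun=> b - a); first exact: trig_poly_cst.
    apply/funext => x; rewrite (_ : (fun=> _) = fun=> 1) ?dint_cst; first ring.
    by apply/funext => y; rewrite mul0r cos0.
  have k0' : k%:R != 0 :> R by rewrite pnatr_eq0.
  rewrite (_ : (fun=> _) = fun x => k%:R^-1 * (sin (k%:R * (x + b)) - sin (k%:R * (x + a)))).
    by apply: trig_polyZ; apply: trig_polyB; exact: (trig_poly_shift _ (trig_poly_sin kn)).
  apply/funext => x; rewrite (@dint_primitive _ (fun x => k%:R^-1 * sin (k%:R * x) + 0)).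
  + by ring.
  + exact: has_deriv_continuous (has_deriv_cos _).
  + apply: has_deriv_eq (has_deriv_lin _ (has_deriv_sin _) (has_deriv_cst _)) _ => y.
    by field.
- move=> k kn; split; first exact: has_deriv_continuous (has_deriv_sin _).
  have [->|k0] := eqVneq k 0%N.
    have E : (fun x : R => sin (0%:R * x)) = fun=> 0.
      by apply/funext => y; rewrite mul0r sin0.
    rewrite E (_ : (fun=> _) = fun=> 0); first exact: trig_poly0.
    by apply/funext => x; rewrite dint_cst mul0r.
  have k0' : k%:R != 0 :> R by rewrite pnatr_eq0.
  rewrite (_ : (fun=> _) = fun x => k%:R^-1 * (cos (k%:R * (x + a)) - cos (k%:R * (x + b)))).
    by apply: trig_polyZ; apply: trig_polyB; exact: (trig_poly_shift _ (trig_poly_cos kn)).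
  apply/funext => x; rewrite (@dint_primitive _ (fun x => - k%:R^-1 * cos (k%:R * x) + 0)).
  + by ring.
  + exact: has_deriv_continuous (has_deriv_sin _).
  + apply: has_deriv_eq (has_deriv_lin _ (has_deriv_cos _) (has_deriv_cst _)) _ => y.
    by field.
Qed.

(** The addition formulas separate t from x in each harmonic of t - x; the coefficients are then
    Fourier integrals of [F]. *)
Lemma trig_poly_conv n F T a b : continuous F -> trig_poly n T ->
  trig_poly n (fun x => dint (fun t => F t * T (t - x)) a b).
Proof.
move=> cF hT; pose P U := continuous U /\
  trig_poly n (fun x => dint (fun t => F t * U (t - x)) a b).
suff: P T by case.
have lM U x : continuous U -> locint (fun t => F t * U (t - x)).
  move=> cU; apply/locint_continuous/continuousM => //; exact: continuous_shift.
have lM' U : continuous U -> locint (fun t => F t * U t).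
  by move=> cU; exact/locint_continuous/continuousM.
have cc k : continuous (fun t : R => cos (k%:R * t)).
  exact: has_deriv_continuous (has_deriv_cos _).
have cs k : continuous (fun t : R => sin (k%:R * t)).
  exact: has_deriv_continuous (has_deriv_sin _).
apply: trig_poly_ind hT; rewrite {}/P.
- split; first exact: cst_continuous.
  have E : (fun t : R => F t * 0) = fun=> 0 by apply/funext => t; rewrite mulr0.
  rewrite E (_ : (fun=> _) = fun=> 0); first exact: trig_poly0.
  by apply/funext => x; rewrite dint_cst mul0r.
- move=> c f g [cf hf] [cg hg]; split; first exact: continuous_lin.
  rewrite (_ : (fun=> _) = fun x => c * dint (fun t => F t * f (t - x)) a b +
      dint (fun t => F t * g (t - x)) a b).
    exact: trig_poly_lin.
  apply/funext => x; rewrite -dint_lin; [|exact: lM|exact: lM].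
  by congr dint; apply/funext => t; ring.
- move=> k kn; split => //.
  rewrite (_ : (fun=> _) = fun x => dint (fun t => F t * cos (k%:R * t)) a b * cos (k%:R * x)
      + dint (fun t => F t * sin (k%:R * t)) a b * sin (k%:R * x)).
    by apply: trig_poly_lin; [exact: trig_poly_cos|exact/trig_polyZ/trig_poly_sin].
  apply/funext => x; rewrite [X in X + _]mulrC [X in _ + X]mulrC -(dintZ _ _ _ (lM' _ (cs k))).
  rewrite -dint_lin; [|exact: lM'|apply/locint_continuous/continuousM; [exact: cst_continuous|exact: continuousM]].
  by congr dint; apply/funext => t; rewrite mulrBr cosB; ring.
- move=> k kn; split => //.
  rewrite (_ : (fun=> _) = fun x => dint (fun t => F t * sin (k%:R * t)) a b * cos (k%:R * x)
      + - dint (fun t => F t * cos (k%:R * t)) a b * sin (k%:R * x)).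
    by apply: trig_poly_lin; [exact: trig_poly_cos|exact/trig_polyZ/trig_poly_sin].
  apply/funext => x; rewrite [X in X + _]mulrC mulNr [X in _ - X]mulrC -mulNr -(dintZ _ _ _ (lM' _ (cc k))).
  rewrite -dint_lin; [|exact: lM'|apply/locint_continuous/continuousM; [exact: cst_continuous|exact: continuousM]].
  by congr dint; apply/funext => t; rewrite mulrBr sinB; ring.
Qed.

End TrigPoly.

(** * Dyadic domination of kernels, and the kernel of Bernstein's inequality *)

Section Kernels.
Variable R : realType.
Implicit Types (F T p K : R -> R) (a b c x t u rho : R) (N k l i j m n : nat).

(** The interval is cut into a core and [I] rings of doubling radius. On each piece [K] is replaced
    by its bound, and the ring is then enlarged to the full centred window, the only shape that
    Steklov averages control. *)
Lemma dyadic_bound p K (lam : nat -> R) rho : continuous p -> continuous K ->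
  (forall t, 0 <= p t) -> 0 < rho -> (forall i, 0 <= lam i) ->
  (forall t, `|t| <= rho -> K t <= lam 0%N) ->
  forall I, (forall i t, (i < I)%N -> rho * 2 ^+ i <= `|t| <= rho * 2 ^+ i.+1 ->
    K t <= lam i.+1) ->
  dint (fun t => p t * K t) (- (rho * 2 ^+ I)) (rho * 2 ^+ I) <=
  \sum_(i < I.+1) lam i * dint p (- (rho * 2 ^+ i)) (rho * 2 ^+ i).
Proof.
move=> cp cK p0 rho0 lam0 K0.
have lpK : locint (fun t => p t * K t) by exact/locint_continuous/continuousM.
have lp : locint p by exact: locint_continuous.
have llp c : locint (fun t => c * p t).
  by apply/locint_continuous/continuousM => //; exact: cst_continuous.
have ring c a b : a <= b -> (forall t, a <= t <= b -> K t <= c) ->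
    dint (fun t => p t * K t) a b <= c * dint p a b.
  move=> ab Kc; rewrite -dintZ//; apply: prim_le => // t /Kc Ktc.
  by rewrite mulrC ler_wpM2r.
elim=> [_|I IH HK].
  rewrite big_ord1 /= expr0 mulr1; apply: ring; first lra.
  by move=> t tr; apply: K0; rewrite ler_norml.
rewrite big_ord_recr /=.
have rI : 0 < rho * 2 ^+ I by rewrite mulr_gt0 ?exprn_gt0.
have rS : rho * 2 ^+ I.+1 = 2 * (rho * 2 ^+ I) by rewrite exprS mulrCA.
set r := rho * 2 ^+ I in rI rS *; set r' := rho * 2 ^+ I.+1 in rS *.
rewrite -(dint_cat _ (- r') (- r) r') -(dint_cat _ (- r) r r').
have B1 : dint (fun t => p t * K t) (- r') (- r) <= lam I.+1 * dint p (- r') (- r).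
  apply: ring; first lra.
  move=> t tr; apply: HK => //; rewrite -/r -/r' ler0_norm; lra.
have B2 : dint (fun t => p t * K t) r r' <= lam I.+1 * dint p r r'.
  apply: ring; first lra.
  move=> t tr; apply: HK => //; rewrite -/r -/r' ger0_norm; lra.
have {}IH := IH (fun i t iI => HK i t (ltnW iI)).
(* This is what is added when the two halves of the last ring are completed to the full window. *)
have B3 : 0 <= lam I.+1 * dint p (- r) r.
  by apply: mulr_ge0 => //; apply: dint_ge0 => //; lra.
rewrite -(dint_cat p (- r') (- r) r') -(dint_cat p (- r) r r').
rewrite -/r in IH; clear -B1 B2 B3 IH; lra.
Qed.

Lemma norm_sin_le x : `|sin x| <= `|x|.
Proof.
have H y : 0 <= y -> `|sin y| <= y.
  move=> y0; have [c _] := mvt (fun z => is_derive_sin z) y0.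
  rewrite sin0 !subr0 => ->; rewrite normrM (ger0_norm y0) ler_piMl//.
  exact: cos_max.
have [x0|x0] := leP 0 x; first by rewrite (ger0_norm x0); exact: H.
rewrite (ltr0_norm x0) -normrN -sinN; apply: H; lra.
Qed.

Lemma one_sub_cos_sin x : 1 - cos (2 * x) = 2 * sin x ^+ 2.
Proof.
by rewrite (_ : 2 * x = x + x) ?cosD; [have := cos2Dsin2 x; lra|ring].
Qed.

Lemma cos_ge_half x : `|x| <= 1 -> 2^-1 <= cos x.
Proof.
move=> x1; have := one_sub_cos_sin (x / 2).
rewrite (_ : 2 * (x / 2) = x); last by field.
have : sin (x / 2) ^+ 2 <= (2^-1) ^+ 2.
  rewrite -(real_normK (num_real (sin _))) ler_sqr ?nnegrE//; apply: le_trans (norm_sin_le _) _.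
  by rewrite normrM (ger0_norm (_ : 0 <= 2^-1))//; lra.
rewrite expr2; lra.
Qed.

(** With t = 4y one has 1 - cos t = 8 (sin y cos y)^2. On [0, pi/4] the cosine is at least 1/2,
    hence sin y >= y/2 and sin y cos y >= y/4. *)
Lemma one_sub_cos_ge t : `|t| <= pi -> t ^+ 2 / 32 <= 1 - cos t.
Proof.
move=> tpi; wlog t0 : t tpi / 0 <= t.
  move=> H; have [t0|t0] := leP 0 t; first exact: H.
  by rewrite -sqrrN -cosN; apply: H; [rewrite normrN|lra].
rewrite (ger0_norm t0) in tpi.
pose y := t / 4.
have y0 : 0 <= y by rewrite /y; lra.
have ypi : y <= pi / 4 by rewrite /y; lra.
have pi0 := pi_gt0 R.
have cy c : 0 <= c <= y -> 2^-1 <= cos c.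
  move=> /andP[c0 cy].
  have : cos (pi / 4) <= cos c.
    have c4 : c <= pi / 4 by lra.
    have [d Hd] := mvt (fun z => is_derive_cos z) c4.
    have : 0 <= sin d by apply: sin_ge0_pi; lra.
    nra.
  suff : 2^-1 <= cos (pi / 4 : R) by lra.
  have := one_sub_cos_sin (pi / 4 : R); have := cos2Dsin2 (pi / 4 : R).
  rewrite (_ : 2 * (pi / 4) = pi / 2 :> R); last by field.
  rewrite cos_pihalf => h1 h2.
  have : 0 <= cos (pi / 4 : R) by apply: cos_ge0_pihalf; lra.
  nra.
have sy : y / 2 <= sin y.
  have [c Hc] := mvt (fun z => is_derive_sin z) y0.
  by rewrite sin0 !subr0 => ->; have := cy _ Hc; nra.
rewrite (_ : t = 2 * (2 * y)); last by rewrite /y; field.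
rewrite one_sub_cos_sin.
have -> : sin (2 * y) = 2 * (sin y * cos y).
  by rewrite (_ : 2 * y = y + y) ?sinD; ring.
have cyy := cy y.
have : y / 4 <= sin y * cos y.
  by have := cyy _; rewrite y0 lexx => /(_ isT); nra.
set z := sin y * cos y => hz.
have : (y / 4) ^+ 2 <= z ^+ 2 by rewrite ler_sqr ?nnegrE//; nra.
rewrite !exprMn; nra.
Qed.

(** Multiplying by 2 - 2 cos u takes minus the second difference in k of the sines. Moved onto the
    affine coefficients it vanishes, and only boundary terms are left. *)
Lemma sum_affine_sin a d th u n :
  (2 - 2 * cos u) * \sum_(k < n) (a + d * k%:R) * sin (th + k%:R * u) =
  - (a + d * (n%:R - 1)) * sin (th + n%:R * u)
  + (a + d * n%:R) * sin (th + (n%:R - 1) * u)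
  + (a - d) * sin th - a * sin (th - u).
Proof.
elim: n => [|n IH].
  by rewrite big_ord0 (_ : th + (0%:R - 1) * u = th - u) ?mul0r ?addr0; ring.
rewrite big_ord_recr /= mulrDr IH.
have -> : th + n.+1%:R * u = (th + n%:R * u) + u by rewrite -natr1; ring.
have -> : th + (n%:R - 1) * u = (th + n%:R * u) - u by ring.
have -> : th + (n.+1%:R - 1) * u = th + n%:R * u by rewrite -natr1; ring.
rewrite -natr1 [sin (_ + _ + u)]sinD [sin (_ + _ - u)]sinB; ring.
Qed.

(* Equal to sin (N u) times the Fejer kernel.  Its coefficients are the tent k, 2N - k:
   the first N agree with those of differentiation, hence bernstein_formula. *)
Definition bernstein_kernel N u : R :=
  \sum_(k < N) (0 + 1 * k%:R) * sin (0 + k%:R * u) +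
  \sum_(k < N) (N%:R + (-1) * k%:R) * sin (N%:R * u + k%:R * u).

(** The right side collects the kinks of the tent of coefficients: slope change -2 at frequency N
    and +1 at 2N. The kink at 0 meets sin 0 = 0. *)
Lemma bernstein_kernelE N u :
  (2 - 2 * cos u) * bernstein_kernel N u = 2 * sin (N%:R * u) - sin (2 * (N%:R * u)).
Proof.
rewrite /bernstein_kernel mulrDr !sum_affine_sin.
have -> : 0 + (N%:R - 1) * u = N%:R * u - u by ring.
have -> : N%:R * u + N%:R * u = 2 * (N%:R * u) by ring.
have -> : 0 + N%:R * u = N%:R * u by ring.
rewrite sin0; ring.
Qed.

Lemma bernstein_kernel_le N u : `|bernstein_kernel N u| <= 2 * N%:R ^+ 2.
Proof.
have H k : (k < N)%N -> (k%:R : R) <= N%:R by move=> kN; rewrite ler_nat ltnW.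
have -> : 2 * N%:R ^+ 2 = \sum_(k < N) N%:R + \sum_(k < N) (N%:R : R).
  by rewrite sumr_const card_ord -[_ *+ N]mulr_natl; ring.
apply: le_trans (ler_normD _ _) _; apply: lerD.
  apply: le_trans (ler_norm_sum _ _ _) _; apply: ler_sum => k _.
  rewrite normrM; have := sin_max (0 + k%:R * u); have := H k (ltn_ord k).
  have k0 : 0 <= k%:R :> R by [].
  rewrite !add0r mul1r (ger0_norm k0) => kN s1.
  by apply: le_trans kN; rewrite ler_piMr.
apply: le_trans (ler_norm_sum _ _ _) _; apply: ler_sum => k _.
rewrite normrM; have := sin_max (N%:R * u + k%:R * u); have := H k (ltn_ord k).
have k0 : 0 <= k%:R :> R by [].
move=> kN s1; rewrite ger0_norm; last lra.
by apply: le_trans (_ : N%:R + -1 * k%:R <= _); [rewrite ler_piMr//; lra|lra].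
Qed.

(** The right side of [bernstein_kernelE] is at most 3 in absolute value, and 2 - 2 cos u >= u^2 /
    16. *)
Lemma bernstein_kernel_decay N u : `|u| <= pi -> u ^+ 2 * `|bernstein_kernel N u| <= 48.
Proof.
move=> upi; have := one_sub_cos_ge upi.
have := congr1 Num.norm (bernstein_kernelE N u); rewrite normrM.
have c1 : 0 <= 2 - 2 * cos u by have := cos_le1 u; lra.
rewrite (ger0_norm c1) => E.
have : `|2 * sin (N%:R * u) - sin (2 * (N%:R * u))| <= 3.
  have := sin_max (N%:R * u); have := sin_max (2 * (N%:R * u)).
  rewrite !ler_norml; lra.
rewrite -E; have := normr_ge0 (bernstein_kernel N u).
set B := `|_| => B0 h1 h2.
have : (u ^+ 2 / 32) * B <= (1 - cos u) * B by rewrite ler_wpM2r.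
lra.
Qed.

Lemma bernstein_kernel_continuous N : continuous (bernstein_kernel N).
Proof.
apply: (@trig_poly_continuous _ (N + N)).
apply: trig_polyD.
- apply: (trig_poly_sum (T := fun k u => (0 + 1 * k%:R) * sin (0 + k%:R * u))) => k kN.
  by under eq_fun do rewrite !add0r; apply/trig_polyZ/trig_poly_sin; lia.
- apply: (trig_poly_sum (T := fun k u => (N%:R + -1 * k%:R) * sin (N%:R * u + k%:R * u))) => k kN.
  by under eq_fun do rewrite -mulrDl -natrD; apply/trig_polyZ/trig_poly_sin; lia.
Qed.

End Kernels.

(** * Pointwise Bernstein inequality *)

Section Bernstein.
Variable R : realType.
Implicit Types (F T p K : R -> R) (a b c x t u rho : R) (N k l i j m n : nat).

Lemma dint_odd (f : R -> R) a : continuous f -> (forall x, f (- x) = - f x) ->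
  dint f (- a) a = 0.
Proof.
move=> cf fN; have := dint_reflect (- a) a cf.
rewrite opprK.
have -> : (fun x => f (- x)) = fun x => -1 * f x.
  by apply/funext => x; rewrite fN mulN1r.
by rewrite dintZ; [lra|exact: locint_continuous].
Qed.

Lemma sin_natmul_pi k : sin (k%:R * pi) = 0 :> R.
Proof.
elim: k => [|k IH]; first by rewrite mul0r sin0.
by rewrite -natr1 mulrDl mul1r sinD IH sinpi; ring.
Qed.

Lemma continuous_sin_mul c : continuous (fun u => sin (c * u)).
Proof. exact: has_deriv_continuous (has_deriv_sin c). Qed.

Lemma continuous_cos_mul c : continuous (fun u => cos (c * u)).
Proof. exact: has_deriv_continuous (has_deriv_cos c). Qed.

Lemma dint_cos_nat k : dint (fun u => cos (k%:R * u)) (- pi) pi =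
  if k is 0%N then 2 * pi else 0 :> R.
Proof.
case: k => [|k].
  have -> : (fun u : R => cos (0%:R * u)) = fun=> 1.
    by apply/funext => u; rewrite mul0r cos0.
  by rewrite dint_cst; ring.
have k0 : k.+1%:R != 0 :> R by rewrite pnatr_eq0.
rewrite (@dint_primitive _ (fun x => k.+1%:R^-1 * sin (k.+1%:R * x) + 0)).
- by rewrite mulrN sinN !sin_natmul_pi; ring.
- exact: continuous_cos_mul.
- apply: has_deriv_eq (has_deriv_lin _ (has_deriv_sin _) (has_deriv_cst _)) _ => y.
  by field.
Qed.

Lemma dint_sin_sin k l : dint (fun u => sin (k%:R * u) * sin (l%:R * u)) (- pi) pi =
  if (k == l) && (k != 0)%N then pi else 0 :> R.
Proof.
wlog kl : k l / (k <= l)%N.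
  move=> H; have [/H//|/ltnW lk] := leqP k l.
  have := H l k lk; rewrite eq_sym.
  have -> : (fun u : R => sin (l%:R * u) * sin (k%:R * u)) =
      fun u => sin (k%:R * u) * sin (l%:R * u).
    by apply/funext => u; rewrite mulrC.
  by move=> ->; case: eqVneq => // ->.
have -> : (fun u : R => sin (k%:R * u) * sin (l%:R * u)) =
    fun u => 2^-1 * cos ((l - k)%:R * u) + (- 2^-1 * cos ((l + k)%:R * u)).
  by apply/funext => u; rewrite (natrB _ kl) natrD mulrBl mulrDl cosB cosD; field.
have lc j := locint_continuous (@continuous_cos_mul j%:R).
have lZ j : locint (fun u => - 2^-1 * cos (j%:R * u)).
  by apply/locint_continuous/continuousM; [exact: cst_continuous|exact: continuous_cos_mul].
rewrite [LHS](dint_lin _ _ _ (lc _) (lZ _)).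
rewrite [X in _ + X](dintZ _ _ _ (lc _)) !dint_cos_nat.
have [<-|lk] := eqVneq k l.
  by rewrite subnn; case: k {kl} => [|k] /=; [ring|field].
have [d ->] : exists d, l = (k + d.+1)%N by exists (l - k).-1; lia.
by rewrite addKn addnS addSn; ring.
Qed.

Lemma dint_cos_bernstein k N :
  dint (fun u => cos (k%:R * u) * bernstein_kernel N u) (- pi) pi = 0.
Proof.
apply: dint_odd.
  apply: continuousM; first exact: continuous_cos_mul.
  exact: bernstein_kernel_continuous.
move=> u; rewrite mulrN cosN -mulrN; congr (_ * _).
rewrite /bernstein_kernel opprD -!sumrN; congr (_ + _); apply: eq_bigr => i _.
  by rewrite (_ : 0 + i%:R * - u = - (0 + i%:R * u)) ?sinN; ring.
by rewrite (_ : N%:R * - u + i%:R * - u = - (N%:R * u + i%:R * u)) ?sinN; ring.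
Qed.

(** Orthogonality reads off the coefficient of sin (k u). It comes from the rising ramp when k < N,
    and from the first term of the falling ramp when k = N. *)
Lemma dint_sin_bernstein k N : (k <= N)%N ->
  dint (fun u => sin (k%:R * u) * bernstein_kernel N u) (- pi) pi = pi * k%:R.
Proof.
move=> kN.
have lss l : locint (fun u => sin (k%:R * u) * sin (l%:R * u)).
  by apply/locint_continuous/continuousM; exact: continuous_sin_mul.
have csum n (c : nat -> R) (q : nat -> nat) :
    continuous (fun u => \sum_(l < n) c l * (sin (k%:R * u) * sin ((q l)%:R * u))).
  elim: n => [|n IH].
    have -> : (fun u => \sum_(l < 0) c l * (sin (k%:R * u) * sin ((q l)%:R * u))) = fun=> 0.
      by apply/funext => u; rewrite big_ord0.
    exact: cst_continuous.
  have -> : (fun u => \sum_(l < n.+1) c l * (sin (k%:R * u) * sin ((q l)%:R * u))) =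
      fun u => c n * (sin (k%:R * u) * sin ((q n)%:R * u)) +
        \sum_(l < n) c l * (sin (k%:R * u) * sin ((q l)%:R * u)).
    by apply/funext => u; rewrite big_ord_recr addrC.
  apply: continuous_lin => //.
  by apply: continuousM; exact: continuous_sin_mul.
have -> : (fun u => sin (k%:R * u) * bernstein_kernel N u) = fun u =>
    1 * \sum_(l < N) l%:R * (sin (k%:R * u) * sin (l%:R * u)) +
    \sum_(l < N) (N%:R - l%:R) * (sin (k%:R * u) * sin ((N + l)%:R * u)).
  apply/funext => u; rewrite /bernstein_kernel mulrDr !mulr_sumr.
  congr (_ + _); apply: eq_bigr => l _; first by rewrite !add0r; ring.
  by rewrite natrD [(_ + _) * u]mulrDl; ring.
rewrite [LHS](dint_lin _ _ _ (locint_continuous (csum N (fun l => l%:R) id))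
  (locint_continuous (csum N (fun l => N%:R - l%:R) (addn N)))).
rewrite (@dint_sum _ N (fun l => l%:R) (fun l u => sin (k%:R * u) * sin (l%:R * u)))//.
rewrite (@dint_sum _ N (fun l => N%:R - l%:R)
  (fun l u => sin (k%:R * u) * sin ((N + l)%:R * u)))//.
rewrite mul1r.
under eq_bigr => l _ do rewrite dint_sin_sin.
under [X in _ + X]eq_bigr => l _ do rewrite dint_sin_sin.
have [->|k0] := eqVneq k 0%N.
  by rewrite !big1 => [||l _]; rewrite ?andbF ?mulr0 ?addr0// => l _; rewrite andbF mulr0.
rewrite /=.
move: kN; rewrite leq_eqVlt => /predU1P[kN|kN].
- rewrite big1; last first.
    by move=> l _; rewrite kN gtn_eqF ?mulr0// ltn_ord.
  have N0 : (0 < N)%N by rewrite -kN lt0n.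
  rewrite (bigD1 (Ordinal N0))//= big1; last first.
    move=> l l0; rewrite ltn_eqF ?mulr0// kN -[X in (X < _)%N]addn0 ltn_add2l lt0n.
    by apply: contra l0 => /eqP l0; apply/eqP/val_inj.
  by rewrite addn0 kN eqxx subr0; ring.
- rewrite (bigD1 (Ordinal kN))//= eqxx big1; last first.
    move=> l lk; rewrite [k == l]eq_sym; have := lk; rewrite -(inj_eq val_inj) /= => /negbTE ->.
    by rewrite mulr0.
  rewrite big1; first ring.
  by move=> l _; rewrite ltn_eqF ?mulr0//; lia.
Qed.

(** On a harmonic of frequency k, the addition formula leaves a cosine part, killed by the oddness
    of the kernel, and a sine part, which gives pi k: differentiation is convolution with this
    kernel on degree N. *)
Lemma bernstein_formula N T x : trig_poly N T ->
  pi * T^`()%classic x = dint (fun u => T (x + u) * bernstein_kernel N u) (- pi) pi.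
Proof.
move=> hT; pose P (U : R -> R) := continuous U /\ exists2 U', has_deriv U U' &
  pi * U' x = dint (fun u => U (x + u) * bernstein_kernel N u) (- pi) pi.
suff [_ [U' dU <-]] : P T by rewrite (has_derivE dU).
have cB := @bernstein_kernel_continuous R N.
have csh (U : R -> R) : continuous U -> continuous (fun u => U (x + u)).
  move=> cU; have -> : (fun u => U (x + u)) = fun u => U (u + x).
    by apply/funext => u; rewrite addrC.
  exact: continuous_shift.
have lB (U : R -> R) : continuous U -> locint (fun u => U u * bernstein_kernel N u).
  by move=> cU; exact/locint_continuous/continuousM.
apply: trig_poly_ind hT; rewrite {}/P.
- split; first exact: cst_continuous.
  exists (fun=> 0); first exact: has_deriv_cst.
  have -> : (fun u => 0 * bernstein_kernel N u) = fun=> 0.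
    by apply/funext => u; rewrite mul0r.
  by rewrite dint_cst; ring.
- move=> c f g [cf [f' df Ef]] [cg [g' dg Eg]]; split; first exact: continuous_lin.
  exists (fun x => c * f' x + g' x); first exact: has_deriv_lin.
  rewrite mulrDr mulrCA Ef Eg -dint_lin; [|exact/lB/csh|exact/lB/csh].
  by congr dint; apply/funext => u; ring.
- move=> k kN; split; first exact: continuous_cos_mul.
  exists (fun x => - (k%:R * sin (k%:R * x))); first exact: has_deriv_cos.
  have -> : (fun u => cos (k%:R * (x + u)) * bernstein_kernel N u) = fun u =>
      cos (k%:R * x) * (cos (k%:R * u) * bernstein_kernel N u) +
      (- sin (k%:R * x)) * (sin (k%:R * u) * bernstein_kernel N u).
    by apply/funext => u; rewrite [k%:R * (x + u)]mulrDr cosD; ring.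
  have l1 := lB _ (@continuous_cos_mul k%:R); have l2 := lB _ (@continuous_sin_mul k%:R).
  have l3 c : locint (fun u => c * (sin (k%:R * u) * bernstein_kernel N u)).
    apply/locint_continuous/continuousM; first exact: cst_continuous.
    exact/continuousM/cB/continuous_sin_mul.
  rewrite [RHS](dint_lin _ _ _ l1 (l3 _)) [X in _ + X](dintZ _ _ _ l2).
  by rewrite dint_cos_bernstein dint_sin_bernstein//; ring.
- move=> k kN; split; first exact: continuous_sin_mul.
  exists (fun x => k%:R * cos (k%:R * x)); first exact: has_deriv_sin.
  have -> : (fun u => sin (k%:R * (x + u)) * bernstein_kernel N u) = fun u =>
      sin (k%:R * x) * (cos (k%:R * u) * bernstein_kernel N u) +
      cos (k%:R * x) * (sin (k%:R * u) * bernstein_kernel N u).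
    by apply/funext => u; rewrite [k%:R * (x + u)]mulrDr sinD; ring.
  have l1 := lB _ (@continuous_cos_mul k%:R); have l2 := lB _ (@continuous_sin_mul k%:R).
  have l3 c : locint (fun u => c * (sin (k%:R * u) * bernstein_kernel N u)).
    apply/locint_continuous/continuousM; first exact: cst_continuous.
    exact/continuousM/cB/continuous_sin_mul.
  rewrite [RHS](dint_lin _ _ _ l1 (l3 _)) [X in _ + X](dintZ _ _ _ l2).
  by rewrite dint_cos_bernstein dint_sin_bernstein//; ring.
Qed.

(** With rho = pi / 2^I the last ring ends exactly at pi. The core uses the bound 2 * 4^I. On the
    ring from rho 2^i to rho 2^(i+1) the decay 48 / u^2 is used, where pi^2 >= 4 supplies the factor
    that turns 4^i into 4^(i+1). The factor pi on the left of [bernstein_formula] is dropped as pi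
    >= 1. *)
Lemma bernstein_pointwise I T x : trig_poly (2 ^ I) T ->
  `|T^`()%classic x| <= \sum_(i < I.+1) (48 * 4 ^+ I / 4 ^+ i) *
     dint (fun y => `|T y|) (x - pi / 2 ^+ I * 2 ^+ i) (x + pi / 2 ^+ I * 2 ^+ i).
Proof.
move=> hT; set N := (2 ^ I)%N in hT *.
have pi2 := pi_ge2 R.
have cT := trig_poly_continuous hT.
have cB := @bernstein_kernel_continuous R N.
have csh (U : R -> R) : continuous U -> continuous (fun u => U (x + u)).
  move=> cU; have -> : (fun u => U (x + u)) = fun u => U (u + x).
    by apply/funext => u; rewrite addrC.
  exact: continuous_shift.
have cTx := csh _ cT.
have N2 : N%:R = 2 ^+ I :> R by rewrite natrX.
have N0 : 0 < 2 ^+ I :> R by rewrite exprn_gt0.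
have p4 i : 0 < 4 ^+ i :> R by rewrite exprn_gt0.
have rho0 : 0 < pi / 2 ^+ I :> R by rewrite divr_gt0//; lra.
have lam0 i : 0 <= 48 * 4 ^+ I / 4 ^+ i :> R.
  by rewrite divr_ge0// ?ltW//; have := p4 I; lra.
have E4 i : (2 ^+ i) ^+ 2 = 4 ^+ i :> R.
  by rewrite -exprM mulnC exprM; congr (_ ^+ _); ring.
have h1 t : `|t| <= pi / 2 ^+ I -> `|bernstein_kernel N t| <= 48 * 4 ^+ I / 4 ^+ 0%N.
  move=> _; apply: le_trans (bernstein_kernel_le _ _) _.
  by rewrite N2 E4 expr0 divr1; have := p4 I; lra.
have h2 i t : (i < I)%N -> pi / 2 ^+ I * 2 ^+ i <= `|t| <= pi / 2 ^+ I * 2 ^+ i.+1 ->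
    `|bernstein_kernel N t| <= 48 * 4 ^+ I / 4 ^+ i.+1.
  move=> iI /andP[t1 t2].
  have tpi : `|t| <= pi.
    apply: le_trans t2 _; rewrite -mulrA ler_piMr//; first lra.
    by rewrite ler_pdivrMl// mulr1 ler_eXn2l// ltr1n.
  have := bernstein_kernel_decay N tpi.
  have q0 : 0 <= pi / 2 ^+ I * 2 ^+ i :> R by rewrite mulr_ge0 ?exprn_ge0// ltW.
  have : (pi / 2 ^+ I * 2 ^+ i) ^+ 2 <= t ^+ 2.
    by rewrite -(real_normK (num_real t)) ler_sqr ?nnegrE.
  rewrite !exprMn exprVn !E4; set B := `|bernstein_kernel N t| => hpi hB.
  have B0 : 0 <= B by exact: normr_ge0.
  have hp : 4 / 4 ^+ I * 4 ^+ i <= t ^+ 2.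
    apply: le_trans hpi; rewrite -[X in X <= _]mulrA -[X in _ <= X]mulrA ler_wpM2r//; nra.
  have := ler_wpM2r B0 hp => hh.
  have : 4 / 4 ^+ I * 4 ^+ i * B <= 48 by lra.
  rewrite -(ler_pM2r (p4 I)) ler_pdivlMr//.
  rewrite (_ : 4 / 4 ^+ I * 4 ^+ i * B * 4 ^+ I = B * 4 ^+ i.+1)//.
  by rewrite exprS; field; rewrite lt0r_neq0.
have cp : continuous (fun u => `|T (x + u)|) by exact: continuous_abs.
have cK : continuous (fun u => `|bernstein_kernel N u|) by exact: continuous_abs.
have := dyadic_bound cp cK (fun t => normr_ge0 _) rho0 lam0 h1 h2.
rewrite divfK ?lt0r_neq0// => D.
have lTB : locint (fun u => T (x + u) * bernstein_kernel N u).
  exact/locint_continuous/continuousM.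
have pin : - pi <= pi :> R by lra.
have := prim_norm lTB pin; rewrite -!/(dint _ _ _) -bernstein_formula//.
under [X in _ <= dint X _ _ -> _]eq_fun do rewrite normrM.
move=> hp; have {hp} := le_trans hp D.
rewrite normrM (ger0_norm (_ : 0 <= pi)); last lra.
have -> : \sum_(i < I.+1) 48 * 4 ^+ I / 4 ^+ i *
      dint (fun u => `|T (x + u)|) (- (pi / 2 ^+ I * 2 ^+ i)) (pi / 2 ^+ I * 2 ^+ i) =
    \sum_(i < I.+1) (48 * 4 ^+ I / 4 ^+ i) *
     dint (fun y => `|T y|) (x - pi / 2 ^+ I * 2 ^+ i) (x + pi / 2 ^+ I * 2 ^+ i).
  apply: eq_bigr => i _; congr (_ * _).
  have -> : (fun u => `|T (x + u)|) = fun u => `|T (u + x)|.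
    by apply/funext => u; rewrite addrC.
  rewrite [LHS](@dint_shift _ (fun y => `|T y|) x); last exact: continuous_abs.
  by rewrite ![_ + x]addrC.
apply: le_trans; rewrite ler_peMl//; lra.
Qed.

End Bernstein.

(** * Pointwise Jackson theorem *)

Section Jackson.
Variable R : realType.
Implicit Types (F T p K : R -> R) (a b c x t u rho : R) (N k l i j m n : nat).

(* |sum_(k < m) exp (i k t)|^2, that is (sin (m t / 2) / sin (t / 2))^2 *)
Definition fejer m t : R :=
  (\sum_(k < m) cos (k%:R * t)) ^+ 2 + (\sum_(k < m) sin (k%:R * t)) ^+ 2.

Lemma fejer_ge0 m t : 0 <= fejer m t.
Proof. by rewrite addr_ge0 ?sqr_ge0. Qed.

Lemma fejerN m t : fejer m (- t) = fejer m t.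
Proof.
rewrite /fejer; congr (_ ^+ 2 + _).
  by apply: eq_bigr => k _; rewrite mulrN cosN.
by rewrite -[RHS]sqrrN -sumrN; congr (_ ^+ 2); apply: eq_bigr => k _; rewrite mulrN sinN.
Qed.

Lemma fejer_le m t : fejer m t <= 2 * m%:R ^+ 2.
Proof.
have H (f : nat -> R) : (forall k, `|f k| <= 1) -> (\sum_(k < m) f k) ^+ 2 <= m%:R ^+ 2.
  move=> f1; rewrite -(real_normK (num_real (\sum_(k < m) f k))) ler_sqr ?nnegrE//.
  apply: le_trans (ler_norm_sum _ _ _) _.
  apply: (@le_trans _ _ (\sum_(k < m) 1)); first exact: ler_sum.
  by rewrite sumr_const card_ord.
rewrite (_ : 2 * m%:R ^+ 2 = m%:R ^+ 2 + m%:R ^+ 2); last by ring.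
apply: lerD.
  by apply: (H (fun k => cos (k%:R * t))) => k; exact: cos_max.
by apply: (H (fun k => sin (k%:R * t))) => k; exact: sin_max.
Qed.

(** With z = exp (i t), [E1] and [E2] are the real and imaginary parts of (1 - z) (1 + z + ... +
    z^(m-1)) = 1 - z^m; the claim equates squared moduli. *)
Lemma fejer_closed m t : (2 - 2 * cos t) * fejer m t = 2 - 2 * cos (m%:R * t).
Proof.
have [E1 E2] :
    (\sum_(k < m) cos (k%:R * t)) * (1 - cos t) + (\sum_(k < m) sin (k%:R * t)) * sin t
      = 1 - cos (m%:R * t) /\
    (\sum_(k < m) sin (k%:R * t)) * (1 - cos t) - (\sum_(k < m) cos (k%:R * t)) * sin t
      = - sin (m%:R * t).
  elim: m => [|m [IH1 IH2]].
    by rewrite !big_ord0 !mul0r cos0 sin0; split; ring.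
  rewrite !big_ord_recr /= -natr1 (mulrDl _ 1 t) mul1r cosD sinD.
  by split; lra.
rewrite /fejer; set C := \sum_(k < m) cos _ in E1 E2 *; set S := \sum_(k < m) sin _ in E1 E2 *.
have h1 := cos2Dsin2 t; have h2 := cos2Dsin2 (m%:R * t).
have -> : (2 - 2 * cos t) = (1 - cos t) ^+ 2 + sin t ^+ 2.
  by rewrite -[X in X - _](_ : 1 + 1 = 2)// -{2}h1; ring.
have -> : ((1 - cos t) ^+ 2 + sin t ^+ 2) * (C ^+ 2 + S ^+ 2) =
   (C * (1 - cos t) + S * sin t) ^+ 2 + (S * (1 - cos t) - C * sin t) ^+ 2 by ring.
rewrite E1 E2 sqrrN.
have -> : (1 - cos (m%:R * t)) ^+ 2 + sin (m%:R * t) ^+ 2 =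
   1 - 2 * cos (m%:R * t) + (cos (m%:R * t) ^+ 2 + sin (m%:R * t) ^+ 2) by ring.
by rewrite h2; ring.
Qed.

Lemma fejer_decay m t : `|t| <= pi -> t ^+ 2 * fejer m t <= 64.
Proof.
move=> tpi; have h := one_sub_cos_ge tpi; have := fejer_closed m t.
have := fejer_ge0 m t; have := cos_geN1 (m%:R * t).
set f := fejer m t => c1 f0 E.
have : (t ^+ 2 / 32) * f <= (1 - cos t) * f by rewrite ler_wpM2r.
lra.
Qed.

(** All the angles k t lie in [-1, 1], where the cosine is at least 1/2. This bounds from below the
    mass of the Jackson kernel. *)
Lemma fejer_lower m t : `|t| * m%:R <= 1 -> m%:R ^+ 2 / 4 <= fejer m t.
Proof.
move=> tm.
have : m%:R / 2 <= \sum_(k < m) cos (k%:R * t).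
  have -> : m%:R / 2 = \sum_(k < m) (2^-1 : R).
    by rewrite sumr_const card_ord mulr_natl.
  apply: ler_sum => k _; apply: cos_ge_half.
  rewrite normrM mulrC normr_nat; apply: le_trans tm.
  by rewrite ler_wpM2l// ler_nat ltnW.
move=> h; have : (m%:R / 2) ^+ 2 <= (\sum_(k < m) cos (k%:R * t)) ^+ 2.
  rewrite ler_sqr// nnegrE.
    by rewrite divr_ge0.
  by apply: le_trans h; rewrite divr_ge0.
have -> : (m%:R / 2) ^+ 2 = m%:R ^+ 2 / 4 :> R by field.
by move=> hC; rewrite /fejer; apply: le_trans hC _; rewrite lerDl sqr_ge0.
Qed.

Lemma trig_poly_fejer m : trig_poly (2 * m.-1) (fejer m).
Proof.
have hC : trig_poly m.-1 (fun t : R => \sum_(k < m) cos (k%:R * t)).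
  apply: (trig_poly_sum (T := fun k t => cos (k%:R * t))) => k km.
  by apply: trig_poly_cos; lia.
have hS : trig_poly m.-1 (fun t : R => \sum_(k < m) sin (k%:R * t)).
  apply: (trig_poly_sum (T := fun k t => sin (k%:R * t))) => k km.
  by apply: trig_poly_sin; lia.
rewrite mul2n -addnn; apply: trig_polyD.
  exact: (trig_polyM hC hC).
exact: (trig_polyM hS hS).
Qed.

(** [F] is convolved with the normalized square of the Fejer kernel. That kernel is even, so the
    first-order Taylor term integrates to 0, and the second-order remainder grows slowly enough for
    the fourth-power decay of the kernel on dyadic rings. *)
Lemma jackson_pointwise I F F1 F2 : has_deriv F F1 -> has_deriv F1 F2 ->
  continuous F2 -> periodic F (2 * pi) ->
  exists2 T, trig_poly (4 * (2 ^ I - 1)) T & forall x, `|F x - T x| <=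
    \sum_(i < I.+1) 2 ^+ 20 / (2 ^+ I * 4 ^+ i) *
      dint (fun y => `|F2 y|) (x - pi / 2 ^+ I * 2 ^+ i) (x + pi / 2 ^+ I * 2 ^+ i).
Proof.
move=> dF dF1 cF2 Fper.
set m := (2 ^ I)%N.
have m2 : m%:R = 2 ^+ I :> R by rewrite natrX.
have m0 : 0 < m%:R :> R by rewrite m2 exprn_gt0.
have pi2 := pi_ge2 R; have pi4 : pi <= 4 :> R by have := pihalf_lt2 R; lra.
have cF := has_deriv_continuous dF.
pose J t := fejer m t ^+ 2.
have hJ : trig_poly (4 * (2 ^ I - 1)) J.
  rewrite (_ : 4 * (2 ^ I - 1) = 2 * m.-1 + 2 * m.-1)%N; last by rewrite /m; lia.
  exact: (trig_polyM (trig_poly_fejer m) (trig_poly_fejer m)).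
have cJ := trig_poly_continuous hJ.
have JN t : J (- t) = J t by rewrite /J fejerN.
have J0 t : 0 <= J t by exact: sqr_ge0.
pose c := dint J (- pi) pi.
(* On the interval |t| <= 1/m, of length 2/m, the kernel is at least (m^2 / 4)^2. *)
have c_lower : m%:R ^+ 3 / 8 <= c.
  have mi : m%:R^-1 <= 1 :> R.
    by rewrite invf_le1// m2 exprn_ege1// ler1n.
  have mi0 : 0 < m%:R^-1 :> R by rewrite invr_gt0.
  apply: (@le_trans _ _ (dint J (- m%:R^-1) m%:R^-1)); last first.
    by apply: (dint_le_itv (locint_continuous cJ) J0); lra.
  apply: (@le_trans _ _ (dint (fun=> (m%:R ^+ 2 / 4) ^+ 2) (- m%:R^-1) m%:R^-1)).
    rewrite dint_cst le_eqVlt; apply/orP; left; apply/eqP.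
    by field; rewrite lt0r_neq0.
  apply: prim_le; [exact/locint_continuous/cst_continuous|exact: locint_continuous|lra|].
  move=> t /andP[t1 t2].
  have tm : `|t| * m%:R <= 1.
    by rewrite -ler_pdivlMr// mul1r ler_norml t1 t2.
  have := fejer_lower tm => fl.
  by rewrite /J ler_sqr// nnegrE ?fejer_ge0// divr_ge0// exprn_ge0// ltW.
have c0 : 0 < c by apply: lt_le_trans c_lower; rewrite divr_gt0// exprn_gt0.
pose W x s := dint (fun y => `|F2 y|) (x - s) (x + s).
exists (fun x => c^-1 * dint (fun t => F t * J (t - x)) (- pi) pi).
  exact/trig_polyZ/trig_poly_conv.
move=> x.
have cabs := continuous_abs cF2.
have csh (U : R -> R) : continuous U -> continuous (fun u => U (x + u)).
  move=> cU; have -> : (fun u => U (x + u)) = fun u => U (u + x).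
    by apply/funext => u; rewrite addrC.
  exact: continuous_shift.
have Jper : periodic J (2 * pi) by exact: trig_poly_periodic hJ.
(* Periodicity recentres the convolution at x, where [taylor2] applies. *)
have conv : dint (fun t => F t * J (t - x)) (- pi) pi =
    dint (fun t => F (x + t) * J t) (- pi) pi.
  have cg : continuous (fun t => F t * J (t - x)).
    by apply: continuousM => //; exact: continuous_shift.
  have gper t : F (t + 2 * pi) * J (t + 2 * pi - x) = F t * J (t - x).
    by rewrite Fper -[in RHS](Jper (t - x)); congr (_ * J _); ring.
  have := dint_periodic (- pi) (- pi + x) cg gper.
  rewrite (_ : - pi + 2 * pi = pi); last by ring.
  rewrite (_ : - pi + x + 2 * pi = pi + x); last by ring.
  move=> ->; rewrite -(dint_shift x (- pi) pi cg).
  by congr dint; apply/funext => t; rewrite addrK addrC.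
have cDJ : continuous (fun t => (F (x + t) - F x - t * F1 x) * J t).
  apply: continuousM => //.
  have -> : (fun t => F (x + t) - F x - t * F1 x) =
      fun t => - F1 x * t + (1 * F (x + t) + - F x) by apply/funext => t; ring.
  apply: continuous_lin; first exact: has_deriv_continuous (@has_deriv_id R).
  apply: continuous_lin; first exact: csh.
  exact: cst_continuous.
have ctJ : continuous (fun t => t * J t).
  by apply: continuousM => //; exact: has_deriv_continuous (@has_deriv_id R).
have tJ0 : dint (fun t => t * J t) (- pi) pi = 0.
  by apply: dint_odd => // t; rewrite JN mulNr.
have cFJ : continuous (fun t => F (x + t) * J t) by apply: continuousM => //; exact: csh.
have E : dint (fun t => F (x + t) * J t) (- pi) pi - c * F x =
    dint (fun t => (F (x + t) - F x - t * F1 x) * J t) (- pi) pi.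
  have -> : (fun t => (F (x + t) - F x - t * F1 x) * J t) = fun t =>
      - F1 x * (t * J t) + (- F x * J t + F (x + t) * J t) by apply/funext => t; ring.
  have l1 := locint_continuous ctJ; have l2 := locint_continuous cJ.
  have l3 := locint_continuous cFJ.
  rewrite [RHS](dint_lin _ _ _ l1 (locint_lin _ l2 l3)) tJ0.
  by rewrite [X in _ = _ + X](dint_lin _ _ _ l2 l3) -/c; ring.
have -> : F x - c^-1 * dint (fun t => F t * J (t - x)) (- pi) pi =
    - (c^-1 * dint (fun t => (F (x + t) - F x - t * F1 x) * J t) (- pi) pi).
  by rewrite -E conv; field; rewrite lt0r_neq0.
rewrite normrN normrM (gtr0_norm (_ : 0 < c^-1)) ?invr_gt0//.
rewrite mulrC ler_pdivrMr//.
pose p t := `|t| * W x `|t|.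
have cp : continuous p.
  apply: continuousM; first exact: norm_continuous.
  have cP := has_deriv_continuous (has_deriv_prim cabs).
  have cW : continuous (W x).
    have -> : W x = fun s => - 1 * prim (fun y => `|F2 y|) (- 1 * s + x) +
        prim (fun y => `|F2 y|) (x + s).
      by apply/funext => s; rewrite /W /dint (_ : - 1 * s + x = x - s); ring.
    by apply: continuous_lin; [exact: continuous_affine|exact: csh].
  by move=> t; apply: continuous_comp; [exact: norm_continuous|exact: cW].
have labs := locint_continuous cabs.
have abs0 y : 0 <= `|F2 y| by exact: normr_ge0.
have W0 s : 0 <= s -> 0 <= W x s.
  by move=> s0; apply: (dint_ge0 labs abs0); lra.
have p0 t : 0 <= p t by rewrite /p mulr_ge0// W0.
have step1 : `|dint (fun t => (F (x + t) - F x - t * F1 x) * J t) (- pi) pi| <=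
    dint (fun t => p t * J t) (- pi) pi.
  have pin : - pi <= pi :> R by lra.
  apply: le_trans (prim_norm (locint_continuous cDJ) pin) _.
  apply: (prim_le (locint_norm (locint_continuous cDJ)) _ pin).
  - exact/locint_continuous/continuousM.
  - move=> t _; rewrite normrM (ger0_norm (J0 t)) ler_wpM2r//.
    exact: taylor2.
apply: le_trans step1 _.
have E4 i : (2 ^+ i) ^+ 2 = 4 ^+ i :> R.
  by rewrite -exprM mulnC exprM; congr (_ ^+ _); ring.
have p4 i : 0 < 4 ^+ i :> R by rewrite exprn_gt0.
have p2 i : 0 < 2 ^+ i :> R by rewrite exprn_gt0.
pose lam i : R := (64 * 4 ^+ I / 4 ^+ i) ^+ 2.
have lam0 i : 0 <= lam i by exact: sqr_ge0.
have rho0 : 0 < pi / 2 ^+ I :> R by rewrite divr_gt0//; lra.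
have h1 t : `|t| <= pi / 2 ^+ I -> J t <= lam 0%N.
  move=> _; rewrite /J /lam expr0 divr1 ler_sqr ?nnegrE ?fejer_ge0//.
  apply: le_trans (fejer_le _ _) _; rewrite m2 E4; have := p4 I; lra.
have h2 i t : (i < I)%N -> pi / 2 ^+ I * 2 ^+ i <= `|t| <= pi / 2 ^+ I * 2 ^+ i.+1 ->
    J t <= lam i.+1.
  move=> iI /andP[t1 t2].
  have tpi : `|t| <= pi.
    apply: le_trans t2 _; rewrite -mulrA ler_piMr//; first lra.
    by rewrite ler_pdivrMl// mulr1 ler_eXn2l// ltr1n.
  have := fejer_decay m tpi.
  have q0 : 0 <= pi / 2 ^+ I * 2 ^+ i :> R by rewrite mulr_ge0 ?exprn_ge0// ltW.
  have : (pi / 2 ^+ I * 2 ^+ i) ^+ 2 <= t ^+ 2.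
    by rewrite -(real_normK (num_real t)) ler_sqr ?nnegrE.
  rewrite !exprMn exprVn !E4 /J /lam ler_sqr ?nnegrE ?fejer_ge0//.
  have := fejer_ge0 m t; set B := fejer m t => B0 hpi hB.
  have hp : 4 / 4 ^+ I * 4 ^+ i <= t ^+ 2.
    by apply: le_trans hpi; rewrite -[X in X <= _]mulrA -[X in _ <= X]mulrA ler_wpM2r//; nra.
  have := ler_wpM2r B0 hp => hh.
  rewrite ler_pdivlMr//; have := ler_wpM2r (ltW (p4 I)) (le_trans hh hB).
  rewrite (_ : 4 / 4 ^+ I * 4 ^+ i * B * 4 ^+ I = B * 4 ^+ i.+1)//.
  by rewrite exprS; field; rewrite lt0r_neq0.
have := dyadic_bound cp cJ p0 rho0 lam0 h1 h2.
rewrite divfK ?lt0r_neq0// => /le_trans; apply.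
rewrite mulr_suml; apply: ler_sum => i _.
set r := pi / 2 ^+ I * 2 ^+ i.
have r0 : 0 < r by rewrite mulr_gt0.
have pr : dint p (- r) r <= r * W x r * (2 * r).
  apply: le_trans (prim_le (g := fun=> r * W x r) (locint_continuous cp) _ _ _) _.
  - exact/locint_continuous/cst_continuous.
  - lra.
  - move=> t /andP[t1 t2]; have tr : `|t| <= r by rewrite ler_norml t1 t2.
    rewrite /p; apply: ler_pM => //; first exact: W0.
    by apply: (dint_le_itv labs abs0); lra.
  - by rewrite -/(dint _ _ _) dint_cst le_eqVlt; apply/orP; left; apply/eqP; ring.
apply: le_trans (ler_wpM2l (lam0 i) pr) _.
rewrite -/(W x r) [X in _ <= X]mulrAC.
have -> : lam i * (r * W x r * (2 * r)) = (lam i * (2 * r ^+ 2)) * W x r by ring.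
apply: ler_wpM2r; first exact/W0/ltW.
(* The normalization c is replaced by its lower bound. The constant is 64^2 * 2 * pi^2 * 8, with
   pi^2 <= 16. *)
apply: le_trans (_ : 2 ^+ 20 / (2 ^+ I * 4 ^+ i) * (m%:R ^+ 3 / 8) <= _); last first.
  by apply: ler_wpM2l => //; rewrite divr_ge0 ?exprn_ge0// mulr_ge0 ?ltW.
rewrite m2 /lam /r !exprMn !exprVn !E4.
have q i' : 4 ^+ i' = 2 ^+ i' * 2 ^+ i' :> R by rewrite -E4 expr2.
rewrite !q.
set u := 2 ^+ I; set v := 2 ^+ i.
have u0 : 0 < u by exact: p2.
have v0 : 0 < v by exact: p2.
have -> : 64 ^+ 2 * (u * u) ^+ 2 / (v * v) ^+ 2 * (2 * (pi ^+ 2 / (u * u) * (v * v))) =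
    (u ^+ 2 / v ^+ 2) * (2 ^+ 13 * pi ^+ 2).
  by field; rewrite !lt0r_neq0.
have -> : 2 ^+ 20 / (u * (v * v)) * (u ^+ 3 / 8) = (u ^+ 2 / v ^+ 2) * 2 ^+ 17.
  by field; rewrite !lt0r_neq0.
apply: ler_wpM2l; first by rewrite divr_ge0 ?sqr_ge0.
have : pi ^+ 2 <= 4 ^+ 2 :> R by rewrite ler_sqr ?nnegrE//; lra.
rewrite (_ : 2 ^+ 17 = 2 ^+ 13 * 4 ^+ 2 :> R); last by ring.
by move=> h; rewrite ler_wpM2l.
Qed.

End Jackson.

(** * From integrability on the circle to local integrability on the line *)

Section CircleIntegrable.
Variable R : realType.
Notation mu := (@completed_lebesgue_measure R).
Notation LT := (lebesgueType R).

(** The integral over one period is carried to every other period by translation invariance, and a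
    bounded interval meets finitely many of them. *)
Lemma circle_integrable_locint (f : R -> R) : circle_fun f ->
  (\int[circle_measure R]_(x in setT) `|f x|%:E < +oo)%E -> locint f.
Proof.
move=> [mf fper] fint.
have pi2 := pi_ge2 R.
have mn D : measurable_fun (D : set LT) (fun x => `|f x|%:E).
  by apply: measurable_funTS; apply/measurable_EFinP; exact: measurableT_comp.
have n0 (x : LT) : (0 <= `|f x|%:E)%E by rewrite lee_fin.
pose D0 : set LT := @halfopen_period R.
have mD0 : measurable D0 := @measurable_halfopen_period R.
(* Removes the restriction to the period and the positive factor 1 / (2 pi), which would leave an
   infinite integral infinite. *)
have base : (\int[mu]_(x in D0) `|f x|%:E < +oo)%E.
  have E : (\int[mrestr mu mD0]_(x in D0) `|f x|%:E = \int[mu]_(x in D0) `|f x|%:E)%E.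
    apply: eq_measure_integral => A mA AD.
    rewrite /= /mrestr; congr (mu _); exact: setIidl.
  rewrite -E; apply: (@le_lt_trans _ _ (\int[mrestr mu mD0]_(x in setT) `|f x|%:E)%E).
    by apply: ge0_subset_integral.
  move: fint; rewrite ge0_integral_mscale//.
  rewrite -[X in (X * _)%E]/((2 * pi)^-1%:E).
  have k0 : (0 < (2 * pi)^-1 :> R) by rewrite invr_gt0; lra.
  have : (0 <= \int[mrestr mu mD0]_(x in setT) `|f x|%:E)%E by exact: integral_ge0.
  case: (\int[mrestr mu mD0]_(x in setT) `|f x|%:E)%E => [y||]//=.
    by move=> _ _; rewrite ltry.
  by move=> _; rewrite mulry gtr0_sg// mul1e.
have finU (A B : set LT) : measurable A -> measurable B ->
    (\int[mu]_(x in A) `|f x|%:E < +oo)%E -> (\int[mu]_(x in B) `|f x|%:E < +oo)%E ->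
    (\int[mu]_(x in A `|` B) `|f x|%:E < +oo)%E.
  move=> mA mB fA fB.
  have mBA : measurable (B `\` A) by exact: measurableD.
  have -> : A `|` B = A `|` (B `\` A) by rewrite setUDr setDv setD0.
  rewrite ge0_integral_setU//; last by apply/disj_setPS => x [Ax [_ /(_ Ax)]].
  apply: lte_add_pinfty => //; apply: le_lt_trans fB.
  by apply: ge0_subset_integral.
have per z k : f (z + 2 * pi * k%:R) = f z.
  elim: k => [|k IH]; first by rewrite mulr0 addr0.
  by rewrite -[k.+1%:R]natr1 mulrDr mulr1 addrA fper.
have step (k : int) : (\int[mu]_(x in [set x : R | D0 (x + 2 * pi * k%:~R)%R]) `|f x|%:E < +oo)%E.
  have perz z : f (z + 2 * pi * k%:~R) = f z.
    case: k => k; first exact: per.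
    by rewrite -(per (z + 2 * pi * (Negz k)%:~R) k.+1); congr f; rewrite NegzE mulrNz -pmulrn; ring.
  have := ge0_integral_lebesgue_shift (2 * pi * k%:~R) mD0 (mn D0) (fun x _ => n0 x).
  under [X in _ = X -> _]eq_integral do rewrite perz.
  by move=> <-.
pose D (J : nat) : set LT := `[- pi - 2 * pi * J%:R, pi + 2 * pi * J%:R[%classic.
have mD J : measurable (D J) by exact: measurable_lebesgue_itv.
have intD J : (\int[mu]_(x in D J) `|f x|%:E < +oo)%E.
  elim: J => [|J IH]; first by rewrite /D mulr0 subr0 addr0.
  (* [L] and [S] are the two periods that extend [D J] to the left and to the right. *)
  pose L : set LT := [set x : R | D0 (x + 2 * pi * (J.+1)%:~R)%R].
  pose S : set LT := [set x : R | D0 (x + 2 * pi * (- (J.+1)%:Z)%:~R)%R].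
  have mL : measurable L.
    by rewrite -[L]setTI; exact: measurable_lebesgue_shift.
  have mS : measurable S.
    by rewrite -[S]setTI; exact: measurable_lebesgue_shift.
  have E : D J.+1 = (D J `|` L) `|` S.
    apply/seteqP; rewrite /D /L /S /D0 /halfopen_period; split => x /=; rewrite !in_itv /=.
      rewrite -[J.+1%:R]natr1 mulrNz => /andP[x1 x2].
      have [xa|xa] := ltP x (- pi - 2 * pi * J%:R).
        by left; right; rewrite -pmulrn -[J.+1%:R]natr1; apply/andP; split; lra.
      have [xb|xb] := ltP x (pi + 2 * pi * J%:R); first by left; left.
      by right; rewrite -pmulrn -[J.+1%:R]natr1; apply/andP; split; lra.
    have J0 : 0 <= J%:R :> R by [].
    have J1 : 0 <= pi * J%:R :> R := mulr_ge0 (pi_ge0 R) (ler0n R J).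
    by rewrite mulrNz -!pmulrn -[J.+1%:R]natr1 => -[[]|] /andP[? ?]; apply/andP; split; lra.
  by rewrite E; apply: (finU) => //; [exact: measurableU|apply: finU => //; exact: step|exact: step].
split=> // a b; apply/integrableP; split.
  by apply: measurable_funTS; exact/measurable_EFinP.
have [J HJ] : exists J : nat, `|a| + `|b| <= 2 * pi * J%:R.
  have r0 : 0 <= `|a| + `|b| by rewrite addr_ge0.
  exists (Num.truncn (`|a| + `|b|)).+1.
  have := truncnS_gt (`|a| + `|b|); set q := _%:R => h.
  have : 0 <= q by exact: ler0n.
  by nra.
apply: le_lt_trans (intD J).
have sub (x : R) : a <= x <= b -> - pi - 2 * pi * J%:R <= x < pi + 2 * pi * J%:R.
  move=> /andP[ax xb]; have := ler_norm b; have := lerNnormlW (lexx `|a|).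
  have := normr_ge0 a; have := normr_ge0 b.
  by move=> ? ? ? ?; apply/andP; split; lra.
have mab := @measurable_lebesgue_itv R `[a, b].
exact: ge0_subset_integral.
Qed.

End CircleIntegrable.

(** * The Banach lattice and its Steklov averages *)

Section Lattice.
Variables (R : realType) (X : set (R -> R)) (nX : (R -> R) -> R).
Hypotheses (hX : banach_lattice X nX) (hA : assumption_A X nX).
Implicit Types (f g F T U : R -> R) (a b c h x t : R) (n k : nat).

Lemma memXZ c f : X f -> X (fun x => c * f x).
Proof.
move=> Xf; have := bl_lin hX c Xf (bl_zero hX).
by rewrite (_ : (fun x => c * f x + 0) = fun x => c * f x)//; apply/funext => x; rewrite addr0.
Qed.

Lemma memXD f g : X f -> X g -> X (fun x => f x + g x).
Proof.
move=> Xf Xg; have := bl_lin hX 1 Xf Xg.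
by rewrite (_ : (fun x => 1 * f x + g x) = fun x => f x + g x)//; apply/funext => x; rewrite mul1r.
Qed.

Lemma memXB f g : X f -> X g -> X (fun x => f x - g x).
Proof.
move=> Xf Xg; have := bl_lin hX (- 1) Xg Xf.
by rewrite (_ : (fun x => - 1 * g x + f x) = fun x => f x - g x)//; apply/funext => x; ring.
Qed.

Lemma normXB f g : X f -> X g -> nX (fun x => f x - g x) <= nX f + nX g.
Proof.
move=> Xf Xg; have := bl_normD hX Xf (memXZ (- 1) Xg).
rewrite (bl_normZ hX _ Xg) normrN1 mul1r.
by rewrite (_ : (fun x => f x + - 1 * g x) = fun x => f x - g x)//; apply/funext => x; ring.
Qed.

Lemma normX_distC f g : X f -> X g -> nX (fun x => f x - g x) = nX (fun x => g x - f x).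
Proof.
move=> Xf Xg; rewrite -[RHS]mul1r -normrN1 -(bl_normZ hX (- 1) (memXB Xg Xf)).
by congr nX; apply/funext => x; ring.
Qed.

Lemma normX_triangle f g (k : R -> R) : X f -> X g -> X k ->
  nX (fun x => f x - k x) <= nX (fun x => f x - g x) + nX (fun x => g x - k x).
Proof.
move=> Xf Xg Xk; have := bl_normD hX (memXB Xf Xg) (memXB Xg Xk).
by rewrite (_ : (fun x => f x - g x + (g x - k x)) = fun x => f x - k x)//; apply/funext => x; ring.
Qed.

Lemma normX0 : nX (fun=> 0) = 0.
Proof.
by have := bl_normZ hX 0 (bl_zero hX); rewrite normr0 !mul0r.
Qed.

Lemma memX_le f g : circle_fun f -> X g -> (forall x, `|f x| <= `|g x|) ->
  X f /\ nX f <= nX g.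
Proof. by move=> cf Xg fg; apply: (bl_ideal hX) => //; exact: aeW. Qed.

Lemma circle_fun_abs f : circle_fun f -> circle_fun (fun x => `|f x|).
Proof.
by move=> [mf fp]; split; [exact: measurableT_comp|move=> x; rewrite fp].
Qed.

Lemma memX_abs f : X f -> X (fun x => `|f x|) /\ nX (fun x => `|f x|) <= nX f.
Proof.
move=> Xf; apply: (memX_le (circle_fun_abs (bl_fun hX Xf)) Xf) => x.
by rewrite normr_id.
Qed.

Lemma memX_sum n (c : nat -> R) (u : nat -> R -> R) :
  (forall i, (i < n)%N -> X (u i)) -> (forall i, 0 <= c i) ->
  X (fun x => \sum_(i < n) c i * u i x) /\
  nX (fun x => \sum_(i < n) c i * u i x) <= \sum_(i < n) c i * nX (u i).
Proof.
move=> + c0; elim: n => [|n IH] Xu.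
  rewrite (_ : (fun=> _) = fun=> 0); last by apply/funext => x; rewrite big_ord0.
  by rewrite big_ord0 normX0; split => //; exact: bl_zero hX.
have [XS NS] := IH (fun i ni => Xu i (ltnW ni)).
have Xn := memXZ (c n) (Xu n (ltnSn n)).
rewrite (_ : (fun=> _) = fun x => (\sum_(i < n) c i * u i x) + c n * u n x); last first.
  by apply/funext => x; rewrite big_ord_recr.
split; first exact: memXD.
rewrite big_ord_recr /=; apply: le_trans (bl_normD hX XS Xn) _.
by rewrite (bl_normZ hX _ (Xu n (ltnSn n))) ger0_norm// lerD2r.
Qed.

Lemma memX_le_sum n F (c : nat -> R) (u : nat -> R -> R) : circle_fun F ->
  (forall i, (i < n)%N -> X (u i)) -> (forall i, 0 <= c i) ->
  (forall x, `|F x| <= \sum_(i < n) c i * u i x) ->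
  X F /\ nX F <= \sum_(i < n) c i * nX (u i).
Proof.
move=> cF Xu c0 HF; have [XS NS] := memX_sum Xu c0.
have [|XF NF] := memX_le cF XS; last by split => //; exact: le_trans NF NS.
by move=> x; apply: le_trans (HF x) (ler_norm _).
Qed.

Lemma circle_set_setT : @circle_set R setT.
Proof. by split=> //; exact: measurableT. Qed.

Lemma circle_measureT : (circle_measure R setT < +oo)%E.
Proof.
rewrite /circle_measure /= /mscale /= /mrestr setTI /halfopen_period.
have -> : completed_lebesgue_measure (`[- pi, pi[%classic : set R) = (2 * pi)%:E.
  rewrite -[LHS]/(@lebesgue_measure R `[- pi, pi[%classic) lebesgue_measure_itv /= lte_fin.
  rewrite ifT; last by have := pi_gt0 R; lra.
  by rewrite -EFinB; congr (_%:E); ring.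
by rewrite -EFinM ltry.
Qed.

Lemma memX_cst c : X (fun=> c).
Proof.
have [X1 _] := bl_indic hX circle_set_setT circle_measureT.
rewrite (_ : (fun=> c) = fun x => c * \1_setT x); first exact: memXZ.
by apply/funext => x; rewrite indicE in_setT mulr1.
Qed.

(** The axiom on indicators, for the whole circle, makes [f] integrable over a period; the averages
    below are therefore genuine integrals. *)
Lemma memX_locint f : X f -> locint f.
Proof.
move=> Xf; have [_ [c c0 H]] := bl_indic hX circle_set_setT circle_measureT.
apply: circle_integrable_locint; first exact: bl_fun hX _ Xf.
by apply: le_lt_trans (H f Xf) _; rewrite ltry.
Qed.

Lemma circle_fun_continuous F : continuous F -> periodic F (2 * pi) -> circle_fun F.
Proof. by move=> cF pF; split => //; exact: continuous_measurable_lebesgue. Qed.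

Lemma trig_poly_circle_fun n T : trig_poly n T -> circle_fun T.
Proof.
move=> hT; apply: circle_fun_continuous; first exact: trig_poly_continuous hT.
exact: trig_poly_periodic hT.
Qed.

Lemma memX_trig_poly n T : trig_poly n T -> X T.
Proof.
apply: trig_poly_ind.
- exact: bl_zero hX.
- by move=> c f g Xf Xg; exact: bl_lin hX _ _ _ Xf Xg.
- move=> k kn; apply: (memX_le (trig_poly_circle_fun (trig_poly_cos R kn)) (memX_cst 1) _).1.
  by move=> x; rewrite normr1 cos_max.
- move=> k kn; apply: (memX_le (trig_poly_circle_fun (trig_poly_sin R kn)) (memX_cst 1) _).1.
  by move=> x; rewrite normr1 sin_max.
Qed.

Lemma steklovE f h x : locint f -> 0 < h ->
  steklov h f x = h^-1 * dint f (x - h / 2) (x + h / 2).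
Proof. by move=> lf h0; rewrite /dint (prim_sub lf) //; lra. Qed.

Lemma steklov_fwdE f h x : locint f -> 0 < h ->
  steklov_fwd h f x = h^-1 * dint f x (x + h).
Proof.
move=> lf h0; rewrite /steklov_fwd (steklovE _ lf h0).
by rewrite addrK -addrA -splitr.
Qed.

Lemma steklov_linear h c f g : locint f -> locint g -> 0 < h ->
  steklov h (fun x => c * f x + g x) = fun x => c * steklov h f x + steklov h g x.
Proof.
move=> lf lg h0; apply/funext => x.
rewrite (steklovE _ lf h0) (steklovE _ lg h0) (steklovE _ (locint_lin c lf lg) h0).
by rewrite (dint_lin _ _ _ lf lg); ring.
Qed.

Lemma steklov_fwd_linear h c f g : locint f -> locint g -> 0 < h ->
  steklov_fwd h (fun x => c * f x + g x) =
  fun x => c * steklov_fwd h f x + steklov_fwd h g x.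
Proof. by move=> lf lg h0; apply/funext => x; rewrite /steklov_fwd steklov_linear. Qed.

Lemma memX_steklov h f : X f -> 0 < h -> X (steklov h f).
Proof. by case: hA => H _; exact: H. Qed.

(** Assumption A concerns the unit ball. Dividing [f] by any t > nX f, and not by nX f itself, also
    covers functions of norm 0; then t tends to nX f. *)
Lemma steklov_bounded : exists2 M, 0 < M &
  forall f h, X f -> 0 < h -> nX (steklov h f) <= M * nX f.
Proof.
case: hA => _ [M0 HM]; exists (`|M0| + 1); first by have := normr_ge0 M0; lra.
move=> f h Xf h0; set M := `|M0| + 1.
have key t : nX f < t -> nX (steklov h f) <= M * t.
  move=> ft; have t0 : 0 < t := le_lt_trans (bl_norm_ge0 hX Xf) ft.
  have Xtf := memXZ t^-1 Xf.
  have := HM _ _ Xtf h0.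
  rewrite (bl_normZ hX _ Xf) gtr0_norm ?invr_gt0// ler_pdivrMl// mulr1.
  move=> /(_ (ltW ft)).
  have -> : steklov h (fun x => t^-1 * f x) = fun x => t^-1 * steklov h f x.
    have -> : (fun x => t^-1 * f x) = fun x => t^-1 * f x + 0.
      by apply/funext => x; rewrite addr0.
    have l0 : locint (fun=> 0 : R) by exact/locint_continuous/cst_continuous.
    rewrite (steklov_linear _ (memX_locint Xf) l0 h0).
    by apply/funext => x; rewrite [X in _ + X]steklovE// dint_cst mul0r mulr0 addr0.
  rewrite (bl_normZ hX _ (memX_steklov Xf h0)) gtr0_norm ?invr_gt0// ler_pdivrMl//.
  move=> /le_trans; apply; rewrite mulrC ler_wpM2r ?ltW//.
  by have := ler_norm M0; rewrite /M; lra.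
apply/ler_addgt0Pr => e e0.
have M0' : 0 < M by have := normr_ge0 M0; rewrite /M; lra.
have := key (nX f + e / M); rewrite mulrDr mulrCA divff ?lt0r_neq0// mulr1; apply.
by rewrite ltrDl divr_gt0.
Qed.

End Lattice.

(** * Bernstein, Jackson and Taylor estimates in the norm of X *)

Section SteklovEstimates.
Variables (R : realType) (X : set (R -> R)) (nX : (R -> R) -> R).
Hypotheses (hX : banach_lattice X nX) (hA : assumption_A X nX).
Variable M : R.
Hypotheses (M_gt0 : 0 < M)
  (HM : forall f h, X f -> 0 < h -> nX (steklov h f) <= M * nX f).
Implicit Types (f g F T U : R -> R) (a b c h x t : R) (n k : nat).

(** An integral over a window of radius a is 2a times a Steklov average, whence the weights. This
    plays the part of Young's inequality for convolutions. *)
Lemma memX_window_sum n F g (c a : nat -> R) : circle_fun F -> X g ->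
  (forall i, 0 <= c i) -> (forall i, 0 < a i) ->
  (forall x, `|F x| <= \sum_(i < n) c i * dint (fun y => `|g y|) (x - a i) (x + a i)) ->
  X F /\ nX F <= (\sum_(i < n) c i * (2 * a i)) * (M * nX g).
Proof.
move=> cF Xg c0 a0 HF.
have [Xag Nag] := memX_abs hX Xg.
have lag := memX_locint hX Xag.
have a20 i : 0 < 2 * a i by have := a0 i; lra.
have ca0 i : 0 <= c i * (2 * a i) by rewrite mulr_ge0// ltW.
have [|XF NF] := memX_le_sum (n := n) (u := fun i => steklov (2 * a i) (fun y => `|g y|))
    hX cF (fun i _ => memX_steklov hA Xag (a20 i)) ca0.
  move=> x; apply: le_trans (HF x) _; apply: ler_sum => i _.
  rewrite (steklovE _ lag (a20 i)) [2 * a i / 2]mulrAC divff ?mul1r ?pnatr_eq0//.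
  by rewrite -mulrA [X in _ <= c i * X]mulrA divff ?mul1r// lt0r_neq0.
split => //; apply: le_trans NF _; rewrite mulr_suml; apply: ler_sum => i _.
apply: ler_wpM2l => //; apply: le_trans (HM Xag (a20 i)) _.
by rewrite ler_wpM2l// ltW.
Qed.

Lemma memX_window F g c a : circle_fun F -> X g -> 0 <= c -> 0 < a ->
  (forall x, `|F x| <= c * dint (fun y => `|g y|) (x - a) (x + a)) ->
  X F /\ nX F <= c * (2 * a) * (M * nX g).
Proof.
move=> cF Xg c0 a0 HF.
have [|XF NF] := @memX_window_sum 1 F g (fun=> c) (fun=> a) cF Xg (fun=> c0) (fun=> a0).
  by move=> x; rewrite big_ord1.
by rewrite big_ord1 in NF.
Qed.

Lemma continuous_steklov_fwd f h : locint f -> 0 < h -> continuous (steklov_fwd h f).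
Proof.
move=> lf h0; have cP := prim_continuous lf.
have -> : steklov_fwd h f = fun x => h^-1 * (prim f (x + h)) + (- h^-1 * prim f x + 0).
  apply/funext => x; rewrite (steklov_fwdE _ lf h0) /dint; ring.
apply: continuous_lin; first exact: continuous_shift.
by apply: continuous_lin => //; exact: cst_continuous.
Qed.

(** A translate of the centred average may have a different norm. Instead [x, x + h] is enlarged to
    the centred window [x - h, x + h], at the cost of a factor 2. *)
Lemma memX_steklov_fwd f h : X f -> 0 < h ->
  X (steklov_fwd h f) /\ nX (steklov_fwd h f) <= 2 * M * nX f.
Proof.
move=> Xf h0; have lf := memX_locint hX Xf.
have cF : circle_fun (steklov_fwd h f).
  apply: circle_fun_continuous; first exact: continuous_steklov_fwd.
  move=> x; rewrite /steklov_fwd addrAC.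
  by have [_ ->] := bl_fun hX (memX_steklov hA Xf h0).
have hi0 : 0 <= h^-1 by rewrite invr_ge0 ltW.
have lN := locint_norm lf.
have [|XF NF] := memX_window cF Xf hi0 h0.
  move=> x; rewrite (steklov_fwdE _ lf h0) normrM ger0_norm//.
  have xh : x <= x + h by lra.
  apply: ler_wpM2l => //; apply: le_trans (prim_norm lf xh) _.
  by apply: (dint_le_itv lN) => [y||]; [exact: normr_ge0|lra|lra].
split => //; apply: le_trans NF _.
by rewrite [h^-1 * _]mulrCA mulVf ?lt0r_neq0// mulr1 mulrA.
Qed.

Lemma sum_half_le n : \sum_(i < n) (2 ^+ i)^-1 <= 2 :> R.
Proof.
suff : \sum_(i < n) (2 ^+ i)^-1 = 2 - 2 / 2 ^+ n :> R.
  by move=> ->; rewrite lerBlDr lerDl divr_ge0// exprn_ge0.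
elim: n => [|n IH]; first by rewrite big_ord0 expr0; field.
rewrite big_ord_recr /= IH exprS; field.
by rewrite expf_neq0.
Qed.

(** The pointwise bound is used at the next power of two, 2^I <= 2n. The weighted windows sum to 96
    pi 2^I times a geometric sum, at most 96 * 4 * 2n * 2 = 1536 n. *)
Lemma bernstein_norm n T : trig_poly n T ->
  X T^`()%classic /\ nX T^`()%classic <= 1536 * M * n%:R * nX T.
Proof.
move=> hT; have [hT' dT] := trig_poly_derive1 hT.
have XT := memX_trig_poly hX hT.
split; first exact: memX_trig_poly hX _ _ hT'.
have NT := bl_norm_ge0 hX XT.
(* No power of two is at most 2 * 0. In degree 0 the kernel is an empty sum, so the derivative
   vanishes. *)
have [n0|n0] := posnP n.
  have -> : T^`()%classic = fun=> 0.
    apply/funext => x; apply: (mulfI (lt0r_neq0 (pi_gt0 R))).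
    rewrite (bernstein_formula x hT) n0 mulr0.
    have -> : (fun u => T (x + u) * bernstein_kernel 0 u) = fun=> 0.
      by apply/funext => u; rewrite /bernstein_kernel !big_ord0 addr0 mulr0.
    by rewrite dint_cst mul0r.
  by rewrite (normX0 hX) n0 !mulr0 mul0r.
have [I nI In] : exists2 I, (n <= 2 ^ I)%N & (2 ^ I <= 2 * n)%N.
  exists (up_log 2 n); first exact: up_logP.
  have [n1|n1] := leqP n 1.
    by rewrite (_ : n = 1%N) ?up_log1//; lia.
  have := up_log_gtn (isT : (1 < 2)%N) n1 => h.
  have I0 : (0 < up_log 2 n)%N by rewrite up_log_gt0.
  by rewrite -(prednK I0) expnS leq_mul2l ltnW.
have := bernstein_pointwise _ (trig_poly_mono nI hT) => Hp.
have p4 i : 0 < 4 ^+ i :> R by rewrite exprn_gt0.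
have p2 i : 0 < 2 ^+ i :> R by rewrite exprn_gt0.
have c0 i : 0 <= 48 * 4 ^+ I / 4 ^+ i :> R.
  by rewrite divr_ge0 ?mulr_ge0// ltW.
have a0 i : 0 < pi / 2 ^+ I * 2 ^+ i :> R.
  by rewrite mulr_gt0// divr_gt0// pi_gt0.
have [_ ] := memX_window_sum (trig_poly_circle_fun hT') XT c0 a0 Hp.
move=> /le_trans; apply.
have E4 i : 4 ^+ i = 2 ^+ i * 2 ^+ i :> R.
  by rewrite -exprMn; congr (_ ^+ _); ring.
have -> : \sum_(i < I.+1) 48 * 4 ^+ I / 4 ^+ i * (2 * (pi / 2 ^+ I * 2 ^+ i)) =
    96 * pi * 2 ^+ I * \sum_(i < I.+1) (2 ^+ i)^-1 :> R.
  rewrite mulr_sumr; apply: eq_bigr => i _; rewrite !E4.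
  by field; rewrite !lt0r_neq0.
have pi4 : pi <= 4 :> R by have := pihalf_lt2 R; lra.
have pi0 := pi_gt0 R.
have sl := sum_half_le I.+1.
have In' : 2 ^+ I <= 2 * n%:R :> R by rewrite -natrX -natrM ler_nat.
rewrite (_ : 1536 * M * n%:R * nX T = 1536 * n%:R * (M * nX T)); last by ring.
apply: ler_wpM2r; first by rewrite mulr_ge0// ltW.
have s0 : 0 <= \sum_(i < I.+1) (2 ^+ i)^-1 :> R.
  by apply: sumr_ge0 => i _; rewrite invr_ge0 ltW.
have h1 : 96 * pi * 2 ^+ I <= 768 * n%:R :> R.
  have := ler_pM (ltW pi0) (ltW (p2 I)) pi4 In'.
  by rewrite -[96 * pi * _]mulrA; set z := pi * _ => hz; lra.
have h0 : 0 <= 96 * pi * 2 ^+ I :> R by rewrite mulr_ge0 ?ltW//; lra.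
by apply: le_trans (ler_pM h0 s0 h1 sl) _; lra.
Qed.

(** The weighted windows sum to 2^21 pi / 4^I times a geometric sum, and 2 pi <= 8 gives 2^24 /
    4^I. *)
Lemma jackson_norm I F F1 F2 : has_deriv F F1 -> has_deriv F1 F2 ->
  continuous F2 -> periodic F (2 * pi) -> X F2 ->
  exists2 T, trig_poly (4 * (2 ^ I - 1)) T &
    nX (fun x => F x - T x) <= 2 ^+ 24 * M / 4 ^+ I * nX F2.
Proof.
move=> dF dF1 cF2 pF XF2.
have [T hT Hp] := jackson_pointwise I dF dF1 cF2 pF.
exists T => //.
have p4 i : 0 < 4 ^+ i :> R by rewrite exprn_gt0.
have p2 i : 0 < 2 ^+ i :> R by rewrite exprn_gt0.
have c0 i : 0 <= 2 ^+ 20 / (2 ^+ I * 4 ^+ i) :> R.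
  by rewrite divr_ge0 ?exprn_ge0// mulr_ge0// ltW.
have a0 i : 0 < pi / 2 ^+ I * 2 ^+ i :> R.
  by rewrite mulr_gt0// divr_gt0// pi_gt0.
have cFT : circle_fun (fun x => F x - T x).
  have -> : (fun x => F x - T x) = fun x => - 1 * T x + F x by apply/funext => x; ring.
  apply: circle_fun_continuous.
    apply: continuous_lin; first exact: trig_poly_continuous hT.
    exact: has_deriv_continuous dF.
  by move=> x; rewrite pF (trig_poly_periodic hT).
have [_ ] := memX_window_sum cFT XF2 c0 a0 Hp.
move=> /le_trans; apply.
have E4 i : 4 ^+ i = 2 ^+ i * 2 ^+ i :> R.
  by rewrite -exprMn; congr (_ ^+ _); ring.
have -> : \sum_(i < I.+1) 2 ^+ 20 / (2 ^+ I * 4 ^+ i) * (2 * (pi / 2 ^+ I * 2 ^+ i)) =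
    2 ^+ 21 / 4 ^+ I * (pi * \sum_(i < I.+1) (2 ^+ i)^-1) :> R.
  rewrite mulrA mulr_sumr; apply: eq_bigr => i _; rewrite !E4.
  rewrite [2 ^+ 21]exprS; set K := 2 ^+ 20; field.
  by rewrite !lt0r_neq0.
have pi4 : pi <= 4 :> R by have := pihalf_lt2 R; lra.
have pi0 := pi_gt0 R.
have sl := sum_half_le I.+1.
have s0 : 0 <= \sum_(i < I.+1) (2 ^+ i)^-1 :> R.
  by apply: sumr_ge0 => i _; rewrite invr_ge0 ltW.
have h : pi * \sum_(i < I.+1) (2 ^+ i)^-1 <= 2 ^+ 3 :> R.
  by apply: le_trans (ler_pM (ltW pi0) s0 pi4 sl) _; lra.
have NF := bl_norm_ge0 hX XF2.
have -> : 2 ^+ 24 * M / 4 ^+ I * nX F2 = (2 ^+ 21 / 4 ^+ I * 2 ^+ 3) * (M * nX F2).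
  by rewrite (exprD 2 21 3); ring.
apply: ler_wpM2r; first by rewrite mulr_ge0// ltW.
by rewrite ler_wpM2l// divr_ge0// ?exprn_ge0// ltW.
Qed.

Lemma has_deriv_sqr : has_deriv (fun x => x * x) (fun x => 2 * x).
Proof.
move=> x; have h : is_derive x (1 : R) (fun x => x) 1 by exact: is_derive_id.
have -> : 2 * x = x *: (1 : R) + x *: (1 : R) by rewrite /GRing.scale /= mulr1; ring.
exact: (is_deriveM h h).
Qed.

(** Taylor's estimate integrated over the window. The first-order coefficient (b^2 - a^2) / 2
    vanishes for centred windows and is h^2 / 2 for forward ones; hence the different orders in the
    next two lemmas. *)
Lemma taylor2_average U U1 U2 h a b x : has_deriv U U1 -> has_deriv U1 U2 ->
  continuous U2 -> a <= b -> - h <= a -> b <= h ->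
  `|dint U (x + a) (x + b) - (b - a) * U x - (b ^+ 2 - a ^+ 2) / 2 * U1 x| <=
    h * (b - a) * dint (fun y => `|U2 y|) (x - h) (x + h).
Proof.
move=> dU dU1 cU2 ab ah bh.
have cU := has_deriv_continuous dU.
have cid := has_deriv_continuous (@has_deriv_id R).
pose g t := - U1 x * t + (1 * U (t + x) + - U x).
have cg : continuous g.
  apply: continuous_lin => //; apply: continuous_lin; first exact: continuous_shift.
  exact: cst_continuous.
have dG := has_deriv_lin (- U1 x / 2) has_deriv_sqr
  (has_deriv_lin 1 (has_deriv_shift x (has_deriv_prim cU))
    (has_deriv_lin (- U x) (@has_deriv_id R) (@has_deriv_cst R 0))).
have E : dint U (x + a) (x + b) - (b - a) * U x - (b ^+ 2 - a ^+ 2) / 2 * U1 x = dint g a b.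
  rewrite (dint_primitive a b cg (has_deriv_eq dG _)).
    by rewrite /dint [x + a]addrC [x + b]addrC; field.
  by move=> t; rewrite /g; field.
rewrite E; have lU2 := locint_norm (locint_continuous cU2).
set D := dint _ (x - h) (x + h).
have D0 : 0 <= D by apply: (dint_ge0 lU2) => [y|]; [exact: normr_ge0|lra].
apply: le_trans (prim_norm (locint_continuous cg) ab) _.
have lc : locint (fun=> h * D) by exact/locint_continuous/cst_continuous.
apply: le_trans (prim_le (locint_norm (locint_continuous cg)) lc ab _) _; last first.
  by rewrite -/(dint _ _ _) dint_cst le_eqVlt; apply/orP; left; apply/eqP; ring.
move=> t /andP[at_ tb]; have th : `|t| <= h by rewrite ler_norml; lra.
have -> : g t = U (x + t) - U x - t * U1 x by rewrite /g [x + t]addrC; ring.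
apply: le_trans (taylor2 x t dU dU1 cU2) _; apply: ler_pM => //.
  apply: (dint_ge0 lU2) => [y|]; first exact: normr_ge0.
  by have := normr_ge0 t; lra.
by apply: (dint_le_itv lU2) => [y||]; [exact: normr_ge0|lra|lra].
Qed.

Lemma steklov_taylor h U U1 U2 : 0 < h -> X U -> has_deriv U U1 -> has_deriv U1 U2 ->
  continuous U2 -> X U2 ->
  nX (fun x => U x - steklov h U x) <= 2 * M * h ^+ 2 * nX U2.
Proof.
move=> h0 XU dU dU1 cU2 XU2.
have lU := memX_locint hX XU.
have cF : circle_fun (fun x => U x - steklov h U x).
  exact: bl_fun hX _ (memXB hX XU (memX_steklov hA XU h0)).
have [|_] := memX_window cF XU2 (ltW h0) h0.
  move=> x; have ab : - (h / 2) <= h / 2 by lra.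
  have := taylor2_average x dU dU1 cU2 ab (h := h); rewrite (steklovE _ lU h0).
  set D := dint U _ _; set D2 := dint _ _ _ => Hh.
  have -> : U x - h^-1 * D = - h^-1 * (D - (h / 2 - - (h / 2)) * U x -
      ((h / 2) ^+ 2 - (- (h / 2)) ^+ 2) / 2 * U1 x).
    by field; rewrite lt0r_neq0.
  have hi0 : 0 < h^-1 by rewrite invr_gt0.
  rewrite normrM normrN (gtr0_norm hi0) ler_pdivrMl//.
  apply: le_trans (Hh _ _) _; [lra|lra|].
  by rewrite le_eqVlt; apply/orP; left; apply/eqP; field.
by move=> /le_trans; apply; rewrite le_eqVlt; apply/orP; left; apply/eqP; ring.
Qed.

(** To first order, U minus its forward average is -(h/2) U'; the function [E] is the second-order
    remainder. Reading this backwards bounds U' by the difference. *)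
Lemma steklov_fwd_taylor h U U1 U2 : 0 < h -> X U -> has_deriv U U1 -> has_deriv U1 U2 ->
  continuous U2 -> X U1 -> X U2 ->
  h * nX U1 <= 2 * nX (fun x => U x - steklov_fwd h U x) + 4 * M * h ^+ 2 * nX U2.
Proof.
move=> h0 XU dU dU1 cU2 XU1 XU2.
have lU := memX_locint hX XU.
have [XAU _] := memX_steklov_fwd XU h0.
have XD := memXB hX XU XAU.
pose E x := h / 2 * U1 x + (U x - steklov_fwd h U x).
have XE : X E by exact: bl_lin hX _ _ _ XU1 XD.
have [|_ NE] := memX_window (bl_fun hX XE) XU2 (ltW h0) h0.
  move=> x; have ab : 0 <= h by exact: ltW.
  have := taylor2_average x dU dU1 cU2 ab (h := h); rewrite /E (steklov_fwdE _ lU h0) addr0.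
  set D := dint U _ _; set D2 := dint _ _ _ => Hh.
  have -> : h / 2 * U1 x + (U x - h^-1 * D) = - h^-1 * (D - (h - 0) * U x -
      (h ^+ 2 - 0 ^+ 2) / 2 * U1 x).
    by field; rewrite lt0r_neq0.
  have hi0 : 0 < h^-1 by rewrite invr_gt0.
  rewrite normrM normrN (gtr0_norm hi0) ler_pdivrMl//.
  apply: le_trans (Hh _ _) _; [lra|lra|].
  by rewrite le_eqVlt; apply/orP; left; apply/eqP; ring.
have := normXB hX XE XD.
have -> : (fun x => E x - (U x - steklov_fwd h U x)) = fun x => h / 2 * U1 x.
  by apply/funext => x; rewrite /E addrK.
rewrite (bl_normZ hX _ XU1) gtr0_norm ?divr_gt0//.
move: NE; set n1 := nX E; set n2 := nX U1; set n3 := nX _; set n4 := nX _.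
lra.
Qed.

End SteklovEstimates.

(** * Polynomials in an operator, and bounds on binomial coefficients *)

Section OperatorPolynomials.
Variable R : realType.
Implicit Types (L : (R -> R) -> R -> R) (p q : {poly R}) (f g : R -> R).

(** The function p(L) f. It makes sense for any map [L]; linearity enters only when polynomials are
    composed or combinations of functions are taken. *)
Definition opoly L p f : R -> R := fun x => \sum_(i < size p) p`_i * iter i L f x.

Lemma opoly_widen L n p f x : (size p <= n)%N ->
  opoly L p f x = \sum_(i < n) p`_i * iter i L f x.
Proof.
move=> pn; rewrite /opoly (big_ord_widen _ (fun i => p`_i * iter i L f x) pn).
rewrite big_mkcond; apply: eq_bigr => i _; case: ltnP => // pi.
by rewrite nth_default// mul0r.
Qed.

Lemma opolyD L p q f : opoly L (p + q) f = fun x => opoly L p f x + opoly L q f x.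
Proof.
apply/funext => x; pose n := maxn (size p) (size q).
rewrite (@opoly_widen L n _ _ _ (size_polyD p q)).
rewrite (@opoly_widen L n _ _ _ (leq_maxl _ _)).
rewrite (@opoly_widen L n _ _ _ (leq_maxr _ _)) -big_split.
by apply: eq_bigr => i _; rewrite coefD mulrDl.
Qed.

Lemma opolyZ L (c : R) p f : opoly L (c *: p) f = fun x => c * opoly L p f x.
Proof.
apply/funext => x; rewrite (@opoly_widen L (size p)) ?size_scale_leq//.
by rewrite mulr_sumr; apply: eq_bigr => i _; rewrite coefZ mulrA.
Qed.

Lemma opolyC L (c : R) f : opoly L c%:P f = fun x => c * f x.
Proof.
apply/funext => x; rewrite (@opoly_widen L 1) ?size_polyC_leq1//.
by rewrite big_ord1 coefC.
Qed.

Lemma opoly1 L f : opoly L 1 f = f.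
Proof. by rewrite opolyC; apply/funext => x; rewrite mul1r. Qed.

Lemma opolyN L p f : opoly L (- p) f = fun x => - opoly L p f x.
Proof. by rewrite -scaleN1r opolyZ; apply/funext => x; rewrite mulN1r. Qed.

Lemma opolyB L p q f : opoly L (p - q) f = fun x => opoly L p f x - opoly L q f x.
Proof. by rewrite opolyD opolyN. Qed.

Lemma opolyMX L p f : opoly L (p * 'X) f = opoly L p (L f).
Proof.
apply/funext => x; rewrite (@opoly_widen L (size p).+1).
  rewrite big_ord_recl coefMX eqxx mul0r add0r.
  by apply: eq_bigr => i _; rewrite coefMX /= -iterS iterSr.
by apply: leq_trans (size_polyMleq _ _) _; rewrite size_polyX addn2.
Qed.

Lemma opolyX L f : opoly L 'X f = L f.
Proof. by rewrite -['X]mul1r opolyMX opoly1. Qed.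

Lemma opolyXn L n f : opoly L 'X^n f = iter n L f.
Proof.
elim: n f => [|n IH] f; first by rewrite expr0 opoly1.
by rewrite exprSr opolyMX IH iterSr.
Qed.

Section Linear.
Variables (Y : set (R -> R)) (L : (R -> R) -> R -> R).
Hypotheses (Y0 : Y (fun=> 0))
  (Ylin : forall c f g, Y f -> Y g -> Y (fun x => c * f x + g x))
  (YL : forall f, Y f -> Y (L f))
  (Llin : forall c f g, Y f -> Y g ->
     L (fun x => c * f x + g x) = fun x => c * L f x + L g x).

Lemma iter_mem n f : Y f -> Y (iter n L f).
Proof. by move=> Yf; elim: n => //= n; exact: YL. Qed.

Lemma opoly_mem p f : Y f -> Y (opoly L p f).
Proof.
elim/poly_ind: p f => [|p c IH] f Yf.
  rewrite (_ : opoly L 0 f = fun=> 0)//.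
  by apply/funext => x; rewrite /opoly size_poly0 big_ord0.
rewrite addrC opolyD opolyC opolyMX; apply: Ylin => //; exact/IH/YL.
Qed.

Lemma opoly_lin p c f g : Y f -> Y g ->
  opoly L p (fun x => c * f x + g x) = fun x => c * opoly L p f x + opoly L p g x.
Proof.
elim/poly_ind: p f g => [|p d IH] f g Yf Yg.
  by apply/funext => x; rewrite /opoly size_poly0 !big_ord0 mulr0 addr0.
rewrite !opolyD !opolyC !opolyMX Llin// IH; [|exact: YL|exact: YL].
by apply/funext => x; ring.
Qed.

Lemma opoly_L p f : Y f -> opoly L p (L f) = L (opoly L p f).
Proof.
elim/poly_ind: p f => [|p c IH] f Yf.
  have L0 : L (fun=> 0) = fun=> 0.
    have := Llin (- 1) Y0 Y0.
    rewrite (_ : (fun x => -1 * 0 + 0) = fun=> 0); last by apply/funext => x; ring.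
    by move=> ->; apply/funext => x; ring.
  rewrite (_ : opoly L 0 f = fun=> 0) ?L0; apply/funext => x.
    by rewrite /opoly size_poly0 big_ord0.
  by rewrite /opoly size_poly0 big_ord0.
rewrite addrC !opolyD !opolyC !opolyMX IH; last exact: YL.
by rewrite Llin//; apply: opoly_mem; exact: YL.
Qed.

(** [L] is linear on the invariant set [Y] and there commutes with its polynomials. The set [Y] is a
    parameter because averages are linear on integrable functions, whereas shifts are linear on all
    functions. *)
Lemma opolyM p q f : Y f -> opoly L (p * q) f = opoly L p (opoly L q f).
Proof.
elim/poly_ind: p q f => [|p c IH] q f Yf.
  by rewrite mul0r; apply/funext => x; rewrite /opoly size_poly0 !big_ord0.
rewrite mulrDl mulrAC !opolyD !opolyMX IH; last exact: YL.
by rewrite (opoly_L _ Yf) mul_polyC opolyZ opolyC.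
Qed.

Lemma one_sub_powE s f : Y f -> one_sub_pow L s f = opoly L ((1 - 'X) ^+ s) f.
Proof.
move=> Yf; rewrite /one_sub_pow; elim: s => [|s IH] /=; first by rewrite expr0 opoly1.
rewrite IH exprS opolyM// [in RHS]opolyB opoly1.
by apply/funext => x; rewrite opolyX.
Qed.

End Linear.

Lemma coef_XD1_exp n i : ((1 + 'X) ^+ n : {poly R})`_i = 'C(n, i)%:R.
Proof.
elim: n i => [|n IH] i; first by rewrite expr0 coef1 bin0n.
rewrite exprSr mulrDr mulr1 coefD IH coefMX; case: i => [|i] /=; first by rewrite !bin0 addr0.
by rewrite IH binS natrD.
Qed.

Lemma coef_second_diff_binomial_le m k :
  `|(('X - 1) ^+ 2 * (1 + 'X) ^+ (2 * m) : {poly R})`_k| <=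
    2 * 'C(2 * m, m)%:R / m.+1%:R.
Proof.
(* The polynomial is a square d * d, so by Cauchy-Schwarz its coefficients are at most
   the sum of the squares of those of d.  Since d is antisymmetric, that sum is minus the
   middle coefficient of d * d. *)
pose d : {poly R} := ('X - 1) * (1 + 'X) ^+ m.
pose c : {poly R} := ('X - 1) ^+ 2 * (1 + 'X) ^+ (2 * m).
have cE : c = d * d by rewrite /c /d mulnC exprM; ring.
have dE i : d`_i = (if i is j.+1 then 'C(m, j)%:R else 0) - 'C(m, i)%:R.
  by rewrite /d mulrBl mul1r coefB coef_XD1_exp mulrC coefMX; case: i => [|i] //=;
    rewrite coef_XD1_exp.
have dbig i : (m.+1 < i)%N -> d`_i = 0.
  by case: i => // i im; rewrite dE !bin_small ?subrr//; lia.
have danti i : (i <= m.+1)%N -> d`_(m.+1 - i) = - d`_i.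
  case: i => [|i] im.
    by rewrite subn0 !dE bin0 (bin_small (ltnSn m)) binn; ring.
  rewrite !dE subSS opprB; move: im; rewrite ltnS leq_eqVlt => /predU1P[->|im].
    by rewrite subnn bin0 (bin_small (ltnSn m)) binn; ring.
  have [j E] : exists j, (m - i = j.+1)%N by exists (m - i).-1; lia.
  rewrite E; congr (_%:R - _%:R); last by rewrite -E bin_sub//; lia.
  by rewrite (_ : j = (m - i.+1)%N) ?bin_sub//; lia.
pose D : R := \sum_(i < m.+2) d`_i ^+ 2.
have partial n : \sum_(i < n) d`_i ^+ 2 <= D.
  have [nm|mn] := leqP n m.+2.
    rewrite /D (big_ord_widen _ (fun i => d`_i ^+ 2) nm) big_mkcond.
    by apply: ler_sum => i _; case: ifP => // _; exact: sqr_ge0.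
  rewrite /D (big_ord_widen _ (fun i => d`_i ^+ 2) (ltnW mn)) [X in _ <= X]big_mkcond.
  apply: ler_sum => i _; case: ltnP => // mi.
  by rewrite dbig ?expr0n//; lia.
have cD : c`_m.+1 = - D.
  rewrite cE coefM /D -sumrN; apply: eq_bigr => i _.
  by rewrite danti; [ring|rewrite -ltnS].
(* This coefficient is C(2m, m-1) - 2 C(2m, m) + C(2m, m+1), and both neighbours equal C(2m, m) m /
   (m+1). *)
have cv : c`_m.+1 = - (2 * 'C(2 * m, m)%:R / m.+1%:R).
  have -> : c = (1 + 'X) ^+ (2 * m) * 'X * 'X - ((1 + 'X) ^+ (2 * m) * 'X) *+ 2
      + (1 + 'X) ^+ (2 * m) by rewrite /c; ring.
  rewrite coefD coefB coefMn !coefMX /= !coef_XD1_exp.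
  have m1 : m.+1%:R != 0 :> R by rewrite pnatr_eq0.
  have E1 : 'C(2 * m, m.+1)%:R = 'C(2 * m, m)%:R * m%:R / m.+1%:R :> R.
    apply: (mulIf m1); rewrite divfK// -!natrM; congr (_%:R).
    by have := mul_bin_left (2 * m) m; rewrite (_ : 2 * m - m = m)%N; lia.
  case: m E1 m1 {d c cE dE dbig danti D partial cD} => [|m] E1 m1.
    by rewrite E1 bin0 /=; field.
  have E2 : 'C(2 * m.+1, m) = 'C(2 * m.+1, m.+2).
    by rewrite -[RHS]bin_sub; [congr binomial|]; lia.
  rewrite /= E2 E1.
  have n0 : m.+1%:R + 1 != 0 :> R by rewrite natr1 pnatr_eq0.
  rewrite -mulr_natl -[m.+2%:R]natr1; move: (m.+1%:R) ('C(_, _)%:R) n0 => n b n0.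
  by field.
rewrite -/c; have -> : 2 * 'C(2 * m, m)%:R / m.+1%:R = D by rewrite -[LHS]opprK -cv cD opprK.
rewrite cE coefM; apply: le_trans (ler_norm_sum _ _ _) _.
have h : \sum_(j < k.+1) `|d`_j * d`_(k - j)| <=
    \sum_(j < k.+1) (d`_j ^+ 2 / 2 + d`_(k - j) ^+ 2 / 2).
  apply: ler_sum => j _; rewrite normrM -(real_normK (num_real d`_j)).
  rewrite -(real_normK (num_real d`_(k - j))).
  have := sqr_ge0 (`|d`_j| - `|d`_(k - j)|); set a := `|_|; set b := `|_|.
  by rewrite !expr2; lra.
apply: le_trans h _; rewrite big_split /= -!mulr_suml.
have := partial k.+1.
have -> : \sum_(j < k.+1) d`_(k - j) ^+ 2 = \sum_(j < k.+1) d`_j ^+ 2.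
  rewrite (reindex_inj rev_ord_inj) /=; apply: eq_bigr => j _; congr (d`_ _ ^+ 2).
  by rewrite subSS subKn// -ltnS.
set s := \sum_(j < _) _; lra.
Qed.

(** A bound of Wallis type. With n = m + 1 the weight is multiplied by (2n - 1) / (2n) at each step,
    and (2n - 1)(2n + 1) <= (2n)^2. *)
Lemma central_binomial_sqr m :
  ('C(2 * m, m)%:R / 4 ^+ m) ^+ 2 * (2 * m.+1%:R - 1) <= 1 :> R.
Proof.
elim: m => [|m IH]; first by rewrite muln0 bin0 expr0; lra.
have E : m.+1%:R * 'C(2 * m.+1, m.+1)%:R = 2 * (2 * m.+1%:R - 1) * 'C(2 * m, m)%:R :> R.
  have -> : 2 * m.+1%:R - 1 = (2 * m).+1%:R :> R by rewrite -!natr1 natrM; ring.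
  rewrite -!natrM; congr (_%:R); apply/eqP; rewrite -(eqn_pmul2l (ltn0Sn m)); apply/eqP.
  have h1 := mul_bin_diag (2 * m.+1) m; have h3 := mul_bin_diag (2 * m).+1 m.
  have h2 : 'C((2 * m).+1, m.+1) = 'C((2 * m).+1, m).
    by rewrite -[RHS]bin_sub; [congr binomial|]; lia.
  rewrite h2 /= in h3; rewrite (_ : (2 * m.+1).-1 = (2 * m).+1) in h1; last by lia.
  by rewrite -h1 [(2 * m.+1)%N]mulnC -!mulnA; congr (_ * _)%N; rewrite mulnCA -h3; ring.
have m0 : 1 <= m.+1%:R :> R by rewrite ler1n.
have p4 : 0 < 4 ^+ m :> R by rewrite exprn_gt0.
move: IH; rewrite [4 ^+ m.+1]exprS -[m.+2%:R]natr1; move: E m0.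
move: ('C(2 * m.+1, m.+1)%:R) ('C(2 * m, m)%:R) (m.+1%:R) => B b n E n0 IH.
have n1 : n != 0 by rewrite lt0r_neq0//; lra.
have -> : B / (4 * 4 ^+ m) = (2 * n - 1) / (2 * n) * (b / 4 ^+ m).
  apply: (mulfI n1); rewrite mulrA E; field.
  by rewrite n1 lt0r_neq0.
move: IH; set z := b / 4 ^+ m => IH.
rewrite exprMn -mulrA.
have -> : ((2 * n - 1) / (2 * n)) ^+ 2 * (z ^+ 2 * (2 * (n + 1) - 1)) =
  (z ^+ 2 * (2 * n - 1)) * (((2 * n - 1) * (2 * n + 1)) / (2 * n) ^+ 2).
  by field.
have h1 : (2 * n - 1) * (2 * n + 1) / (2 * n) ^+ 2 <= 1.
  rewrite ler_pdivrMr ?exprn_gt0//; last lra.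
  by rewrite mul1r !expr2; lra.
have h2 : 0 <= (2 * n - 1) * (2 * n + 1) / (2 * n) ^+ 2.
  by rewrite divr_ge0 ?sqr_ge0// mulr_ge0//; lra.
have h3 : 0 <= z ^+ 2 * (2 * n - 1) by rewrite mulr_ge0 ?sqr_ge0//; lra.
by apply: le_trans (ler_pM h3 h2 IH h1) _; rewrite mulr1.
Qed.

End OperatorPolynomials.

(** * Iterated forward averages and half-step shifts *)

Section SteklovIterates.
Variable R : realType.
Implicit Types (f g k : R -> R) (p q : {poly R}) (a b h x eta : R).

Definition shiftf eta f : R -> R := fun x => f (x + eta).

Lemma iter_shiftf eta f i x : iter i (shiftf eta) f x = f (x + i%:R * eta).
Proof.
elim: i x => [|i IH] x; first by rewrite mul0r addr0.
by rewrite /= /shiftf IH -[i.+1%:R]natr1; congr f; ring.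
Qed.

Lemma opoly_shiftM eta p q f :
  opoly (shiftf eta) (p * q) f = opoly (shiftf eta) p (opoly (shiftf eta) q f).
Proof. by apply: (@opolyM _ setT). Qed.

Lemma opoly_shiftZ eta p c f :
  opoly (shiftf eta) p (fun x => c * f x) = fun x => c * opoly (shiftf eta) p f x.
Proof.
apply/funext => x; rewrite /opoly mulr_sumr; apply: eq_bigr => i _.
by rewrite !iter_shiftf mulrCA.
Qed.

Lemma continuous_opoly_shift eta p f : continuous f -> continuous (opoly (shiftf eta) p f).
Proof.
move=> cf; apply: (@opoly_mem R [set g | continuous g] (shiftf eta)) => //=.
- exact: cst_continuous.
- by move=> c g1 g2; exact: continuous_lin.
- by move=> g cg; exact: continuous_shift.
Qed.

Lemma iter_fwd_locint h n f : locint f -> 0 < h -> locint (iter n (steklov_fwd h) f).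
Proof.
move=> lf h0; elim: n => [|n IH] /=; first exact: lf.
exact/locint_continuous/continuous_steklov_fwd.
Qed.

Lemma iter_fwd_continuous h n f : locint f -> 0 < h -> continuous (iter n.+1 (steklov_fwd h) f).
Proof. by move=> lf h0; apply: continuous_steklov_fwd => //; exact: iter_fwd_locint. Qed.

(** An average over [x, x + h] is the mean of the averages over the two halves. Iterated, this
    factor 1 + ['X] produces the binomial coefficients. *)
Lemma fwd_split h f : locint f -> 0 < h ->
  steklov_fwd h f =
  fun x => 2^-1 * opoly (shiftf (h / 2)) (1 + 'X) (steklov_fwd (h / 2) f) x.
Proof.
move=> lf h0; apply/funext => x; have h20 : 0 < h / 2 by lra.
rewrite opolyD opoly1 opolyX /shiftf.
rewrite (steklov_fwdE _ lf h0) !(steklov_fwdE _ lf h20) (_ : x + h / 2 + h / 2 = x + h); last by field.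
by rewrite -(dint_cat f x (x + h / 2) (x + h)); field; rewrite lt0r_neq0.
Qed.

Lemma fwd_shift h eta f : continuous f -> 0 < h ->
  steklov_fwd h (shiftf eta f) = shiftf eta (steklov_fwd h f).
Proof.
move=> cf h0; apply/funext => x; have lf := locint_continuous cf.
have ls := locint_continuous (@continuous_shift _ f eta cf).
rewrite /shiftf (steklov_fwdE _ ls h0) (steklov_fwdE _ lf h0) (dint_shift _ _ _ cf).
by congr (_ * dint f _ _); ring.
Qed.

Lemma fwd_opoly_shift h eta q f : continuous f -> 0 < h ->
  steklov_fwd h (opoly (shiftf eta) q f) = opoly (shiftf eta) q (steklov_fwd h f).
Proof.
move=> + h0; elim/poly_ind: q f => [|q c IH] f cf.
  rewrite (_ : opoly _ 0 f = fun=> 0); last first.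
    by apply/funext => x; rewrite /opoly size_poly0 big_ord0.
  apply/funext => x; rewrite steklov_fwdE//; last exact/locint_continuous/cst_continuous.
  by rewrite dint_cst /opoly size_poly0 big_ord0 mul0r mulr0.
have cs : continuous (shiftf eta f) by exact: continuous_shift.
rewrite addrC !opolyD !opolyC !opolyMX steklov_fwd_linear//.
- by rewrite IH// fwd_shift.
- exact: locint_continuous.
- exact/locint_continuous/continuous_opoly_shift.
Qed.

Lemma iter_fwd_split h n f : locint f -> 0 < h ->
  iter n (steklov_fwd h) f =
  fun x => (2 ^+ n)^-1 * opoly (shiftf (h / 2)) ((1 + 'X) ^+ n) (iter n (steklov_fwd (h / 2)) f) x.
Proof.
move=> lf h0; have h20 : 0 < h / 2 by lra.
case: n => [|n].
  by rewrite !expr0 opoly1 invr1; apply/funext => x; rewrite mul1r.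
elim: n => [|n IH]; first by rewrite !expr1 /= fwd_split.
rewrite iterS IH.
have cg := @iter_fwd_continuous _ n f lf h20.
set g := iter n.+1 (steklov_fwd (h / 2)) f in cg *.
have lg := locint_continuous cg.
have cog := @continuous_opoly_shift (h / 2) ((1 + 'X) ^+ n.+1) g cg.
set og := opoly _ _ g in cog *.
have l0 : locint (fun=> 0 : R) by exact/locint_continuous/cst_continuous.
have -> : (fun x => (2 ^+ n.+1)^-1 * og x) = fun x => (2 ^+ n.+1)^-1 * og x + 0.
  by apply/funext => x; rewrite addr0.
rewrite (steklov_fwd_linear _ (locint_continuous cog) l0 h0).
apply/funext => x; rewrite [X in _ + X]steklov_fwdE// dint_cst mul0r mulr0 addr0.
rewrite /og fwd_opoly_shift// (fwd_split lg h0) opoly_shiftZ -opoly_shiftM.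
rewrite -exprSr -/(iter n.+2 (steklov_fwd (h / 2)) f) mulrA.
by rewrite [in RHS]exprSr invfM.
Qed.

Lemma has_deriv_fwd h g : continuous g -> 0 < h ->
  has_deriv (steklov_fwd h g) (fun x => h^-1 * (g (x + h) - g x)).
Proof.
move=> cg h0.
have dP := has_deriv_prim cg.
have dF := has_deriv_lin h^-1 (has_deriv_shift h dP)
  (has_deriv_lin (- h^-1) dP (@has_deriv_cst R 0)).
have -> : steklov_fwd h g = fun x => h^-1 * prim g (x + h) + (- h^-1 * prim g x + 0).
  apply/funext => x; rewrite steklov_fwdE//; last exact: locint_continuous.
  by rewrite /dint; ring.
by apply: has_deriv_eq dF _ => x; ring.
Qed.

(** No exchange of integrals is needed: for K = |k| with primitive G, the integral of the average is
    1/eta times the integral of G over [b, b + eta] minus that over [a, a + eta]. As G increases,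
    this is at most G (b + eta) - G a. *)
Lemma dint_fwd_le eta k a b : locint k -> 0 < eta -> a <= b ->
  dint (fun y => `|steklov_fwd eta k y|) a b <= dint (fun y => `|k y|) a (b + eta).
Proof.
move=> lk eta0 ab; have lK := locint_norm lk.
set K := fun y => `|k y| in lK *.
have K0 y : 0 <= K y by exact: normr_ge0.
have cG := prim_continuous lK.
have ei : 0 < eta^-1 by rewrite invr_gt0.
have cF := continuous_steklov_fwd lk eta0.
have cFK := continuous_steklov_fwd lK eta0.
apply: le_trans (prim_le (locint_norm (locint_continuous cF)) (locint_continuous cFK) ab _) _.
  move=> y _; have ye : y <= y + eta by lra.
  rewrite (steklov_fwdE _ lk eta0) (steklov_fwdE _ lK eta0) normrM gtr0_norm//.
  by apply: ler_wpM2l; [exact: ltW|exact: prim_norm].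
rewrite -/(dint _ a b).
have -> : steklov_fwd eta K = fun y => eta^-1 * prim K (y + eta) + (- eta^-1 * prim K y).
  by apply/funext => y; rewrite steklov_fwdE// /dint; ring.
have lG := locint_continuous cG.
have lGs := locint_continuous (@continuous_shift _ _ eta cG).
have lGn : locint (fun y => - eta^-1 * prim K y).
  by apply/locint_continuous/continuousM => //; exact: cst_continuous.
rewrite (dint_lin _ _ _ lGs lGn) (dintZ _ _ _ lG) (dint_shift _ _ _ cG).
have E : dint (prim K) (a + eta) (b + eta) - dint (prim K) a b =
    dint (prim K) b (b + eta) - dint (prim K) a (a + eta) by rewrite /dint; ring.
have -> : eta^-1 * dint (prim K) (a + eta) (b + eta) + - eta^-1 * dint (prim K) a b =
   eta^-1 * (dint (prim K) b (b + eta) - dint (prim K) a (a + eta)) by rewrite -E; ring.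
rewrite ler_pdivrMl// /dint -/(dint (prim K) b (b + eta)).
have lc c : locint (fun=> c : R) by exact/locint_continuous/cst_continuous.
have be : b <= b + eta by rewrite lerDl ltW.
have ae : a <= a + eta by rewrite lerDl ltW.
have U : dint (prim K) b (b + eta) <= prim K (b + eta) * eta.
  apply: le_trans (prim_le lG (lc (prim K (b + eta))) be _) _.
    by move=> y /andP[_ yb]; exact: prim_homo.
  by rewrite -/(dint _ _ _) dint_cst le_eqVlt; apply/orP; left; apply/eqP; ring.
have V : prim K a * eta <= dint (prim K) a (a + eta).
  apply: le_trans (prim_le (lc (prim K a)) lG ae _).
    by rewrite -/(dint (fun=> prim K a) _ _) dint_cst le_eqVlt; apply/orP; left; apply/eqP; ring.
  by move=> y /andP[ay _]; exact: prim_homo.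
rewrite /dint in U V; rewrite /dint; lra.
Qed.

Lemma dint_iter_fwd_le eta n g a b : locint g -> 0 < eta -> a <= b ->
  dint (fun y => `|iter n (steklov_fwd eta) g y|) a b <=
  dint (fun y => `|g y|) a (b + n%:R * eta).
Proof.
move=> lg eta0; elim: n b => [|n IH] b ab; first by rewrite mul0r addr0.
have lk := iter_fwd_locint n lg eta0.
apply: le_trans (dint_fwd_le lk eta0 ab) _.
have ab' : a <= b + eta by lra.
apply: le_trans (IH _ ab') _; rewrite -[n.+1%:R]natr1.
by rewrite (_ : b + (n%:R + 1) * eta = b + eta + n%:R * eta)//; ring.
Qed.

(** The shifted averages live on adjacent intervals of length eta, which tile [x, x + n eta]; a
    uniform bound on the coefficients thus costs a single integral. *)
Lemma opoly_shift_average_le eta q n C k x : locint k -> 0 < eta ->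
  (size q <= n)%N -> 0 <= C -> (forall i, `|q`_i| <= C) ->
  `|opoly (shiftf eta) q (steklov_fwd eta k) x| <=
    C * eta^-1 * dint (fun y => `|k y|) x (x + n%:R * eta).
Proof.
move=> lk eta0 qn C0 HC; rewrite (opoly_widen _ _ _ qn).
have ei : 0 <= eta^-1 by rewrite invr_ge0 ltW.
apply: le_trans (ler_norm_sum _ _ _) _.
have -> : C * eta^-1 * dint (fun y => `|k y|) x (x + n%:R * eta) =
  \sum_(i < n) C * (eta^-1 * dint (fun y => `|k y|) (x + i%:R * eta) (x + i%:R * eta + eta)).
  elim: n {qn} => [|n IH]; first by rewrite big_ord0 mul0r addr0 /dint subrr mulr0.
  rewrite big_ord_recr /= -IH -[n.+1%:R]natr1.
  rewrite -(dint_cat _ x (x + n%:R * eta)).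
  by rewrite (_ : x + (n%:R + 1) * eta = x + n%:R * eta + eta); ring.
apply: ler_sum => i _; rewrite normrM iter_shiftf; apply: ler_pM => //.
rewrite (steklov_fwdE _ lk eta0) normrM ger0_norm// ler_wpM2l//.
by apply: prim_norm => //; lra.
Qed.

End SteklovIterates.

(** * Second derivative of iterated averages *)

Section Smoothing.
Variables (R : realType) (X : set (R -> R)) (nX : (R -> R) -> R).
Hypotheses (hX : banach_lattice X nX) (hA : assumption_A X nX).
Variable M : R.
Hypotheses (M_gt0 : 0 < M)
  (HM : forall f h, X f -> 0 < h -> nX (steklov h f) <= M * nX f).

Lemma iter_fwd_mem n h f : X f -> 0 < h -> X (iter n (steklov_fwd h) f).
Proof.
move=> Xf h0; elim: n => [|n IH] /=; first exact: Xf.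
by have [] := memX_steklov_fwd hX hA M_gt0 HM IH h0.
Qed.

(** Two of the 2m averages are spent on the derivatives, giving h^(-2) (S^2 - 1)^2 with S the shift
    by h/2. The remaining 2m - 2, at least one of which makes [G] continuous, split into half-steps
    and give (1 + S)^(2m-2) / 4^(m-1). Since (S^2 - 1)^2 = (S - 1)^2 (1 + S)^2, the product is the
    polynomial of [coef_second_diff_binomial_le]. *)
Lemma iter_fwd_smooth h m g : X g -> 0 < h -> (1 < m)%N ->
  exists F1, exists F2, [/\ has_deriv (iter (2 * m) (steklov_fwd h) g) F1,
    has_deriv F1 F2, continuous F2, X F2 &
    nX F2 <= 64 * M * ('C(2 * m, m)%:R / 4 ^+ m) / h ^+ 2 * nX g].
Proof.
move=> Xg h0 m1; have lg := memX_locint hX Xg.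
have [p mE] : exists p, m = p.+2 by exists (m - 2)%N; lia.
have h20 : 0 < h / 2 by lra.
set eta := h / 2 in h20.
have E2p : (2 * p.+1 = (2 * p).+2)%N by lia.
pose G := iter (2 * p.+1) (steklov_fwd h) g.
have cG : continuous G by rewrite /G E2p; exact: iter_fwd_continuous.
have EF : iter (2 * m) (steklov_fwd h) g = steklov_fwd h (steklov_fwd h G).
  by rewrite mE (_ : 2 * p.+2 = (2 * p.+1).+2)%N//; lia.
pose K' x := h^-1 * (G (x + h) - G x).
have dK : has_deriv (steklov_fwd h G) K' by exact: has_deriv_fwd.
have cK := has_deriv_continuous dK.
have dF := has_deriv_fwd cK h0.
pose F2 x := h^-1 * (K' (x + h) - K' x).
have cK' : continuous K'.
  have -> : K' = fun x => h^-1 * G (x + h) + (- h^-1 * G x + 0).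
    by apply/funext => x; rewrite /K'; ring.
  apply: continuous_lin; first exact: continuous_shift.
  by apply: continuous_lin => //; exact: cst_continuous.
have cF2 : continuous F2.
  have -> : F2 = fun x => h^-1 * K' (x + h) + (- h^-1 * K' x + 0).
    by apply/funext => x; rewrite /F2; ring.
  apply: continuous_lin; first exact: continuous_shift.
  by apply: continuous_lin => //; exact: cst_continuous.
exists (fun x => h^-1 * (steklov_fwd h G (x + h) - steklov_fwd h G x)), F2.
have dF1 : has_deriv (fun x => h^-1 * (steklov_fwd h G (x + h) - steklov_fwd h G x)) F2.
  have d1 := has_deriv_lin h^-1 (has_deriv_shift h dK)
    (has_deriv_lin (- h^-1) dK (@has_deriv_cst R 0)).
  have -> : (fun x => h^-1 * (steklov_fwd h G (x + h) - steklov_fwd h G x)) = fun x =>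
      h^-1 * steklov_fwd h G (x + h) + (- h^-1 * steklov_fwd h G x + 0).
    by apply/funext => x; ring.
  by apply: has_deriv_eq d1 _ => x; rewrite /F2; ring.
have [_ Gper] : circle_fun G := bl_fun hX (iter_fwd_mem (2 * p.+1) Xg h0).
have F2per : periodic F2 (2 * pi).
  have K'per : periodic K' (2 * pi).
    by move=> x; rewrite /K' Gper addrAC Gper.
  by move=> x; rewrite /F2 K'per addrAC K'per.
pose c : {poly R} := ('X - 1) ^+ 2 * (1 + 'X) ^+ (2 * m).
pose C : R := 2 * 'C(2 * m, m)%:R / m.+1%:R.
have C0 : 0 <= C by rewrite divr_ge0// mulr_ge0.
have F2E x : F2 x = (h ^+ 2)^-1 * ((2 ^+ (2 * p.+1))^-1 *
    opoly (shiftf eta) c (iter (2 * p.+1) (steklov_fwd eta) g) x).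
  have -> : c = ('X^2 - 1) ^+ 2 * (1 + 'X) ^+ (2 * p.+1).
    rewrite /c mE (_ : 2 * p.+2 = 2 * p.+1 + 2)%N; last by lia.
    by rewrite exprD; ring.
  have -> : (2 ^+ (2 * p.+1))^-1 * opoly (shiftf eta) (('X^2 - 1) ^+ 2 * (1 + 'X) ^+ (2 * p.+1))
      (iter (2 * p.+1) (steklov_fwd eta) g) x = opoly (shiftf eta) (('X^2 - 1) ^+ 2) G x.
    rewrite opoly_shiftM /G (iter_fwd_split _ lg h0).
    by rewrite [in RHS](opoly_shiftZ eta _ (2 ^- (2 * p.+1))).
  have -> : ('X^2 - 1) ^+ 2 = 'X^4 - 2 *: 'X^2 + 1 :> {poly R}.
    by rewrite scaler_nat; ring.
  rewrite opolyD opolyB opolyZ opoly1 !opolyXn !iter_shiftf /F2 /K'.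
  have -> : x + 4%:R * eta = x + h + h by rewrite /eta; field.
  have -> : x + 2%:R * eta = x + h by rewrite /eta; field.
  by field; rewrite lt0r_neq0.
have sc : (size c <= 2 * m + 3)%N.
  have sX1 : size ('X - 1 : {poly R}) = 2%N by rewrite -polyC1 size_XsubC.
  have sX2 : size (1 + 'X : {poly R}) = 2%N by rewrite addrC -polyC1 size_XaddC.
  apply: leq_trans (size_polyMleq _ _) _.
  have h1 := size_poly_exp_leq ('X - 1 : {poly R}) 2.
  have h2 := size_poly_exp_leq (1 + 'X : {poly R}) (2 * m).
  rewrite sX1 in h1; rewrite sX2 in h2.
  by move: h1 h2; set s1 := size _; set s2 := size _; lia.
have lK0 := iter_fwd_locint (2 * p).+1 lg h20.
have p4 i : 0 < 4 ^+ i :> R by rewrite exprn_gt0.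
have E24 i : 2 ^+ (2 * i) = 4 ^+ i :> R by rewrite exprM; congr (_ ^+ _); ring.
have hh : 0 < h ^+ 2 by rewrite exprn_gt0.
have m0 : 0 < m%:R :> R by rewrite ltr0n; lia.
pose cc := (h ^+ 2)^-1 * ((4 ^+ p.+1)^-1 * (C * eta^-1)).
have cc0 : 0 <= cc.
  by rewrite !mulr_ge0// ?invr_ge0 ltW.
have a0 : 0 < 2 * m%:R * h by rewrite !mulr_gt0.
have lag := locint_norm lg.
have bound x : `|F2 x| <= cc * dint (fun y => `|g y|) (x - 2 * m%:R * h) (x + 2 * m%:R * h).
  set D := dint _ _ _.
  have -> : cc * D = (h ^+ 2)^-1 * ((4 ^+ p.+1)^-1 * (C * eta^-1 * D)) by rewrite /cc; ring.
  have hi : 0 < (h ^+ 2)^-1 by rewrite invr_gt0.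
  have pi4 : 0 < (4 ^+ p.+1)^-1 :> R by rewrite invr_gt0.
  rewrite F2E E24 !normrM (gtr0_norm hi) (gtr0_norm pi4).
  apply: ler_wpM2l; first exact: ltW.
  apply: ler_wpM2l; first exact: ltW.
  (* One half-step average makes the shifts tile an interval. The other 2p + 1 only lengthen it, to
     (2m + 3 + 2p + 1) h/2 = 2 m h in all. *)
  rewrite E2p iterS.
  apply: le_trans (opoly_shift_average_le x lK0 h20 sc C0 (coef_second_diff_binomial_le R m)) _.
  apply: ler_wpM2l; first by rewrite mulr_ge0// invr_ge0 ltW.
  rewrite {}/D.
  have xb : x <= x + (2 * m + 3)%:R * eta by rewrite lerDl mulr_ge0// ltW.
  apply: le_trans (dint_iter_fwd_le (2 * p).+1 lg h20 xb) _.
  apply: (dint_le_itv lag) => [y||]; [exact: normr_ge0|by rewrite lerBlDr lerDl ltW|].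
  rewrite -addrA -mulrDl -natrD (_ : 2 * m + 3 + (2 * p).+1 = 4 * m)%N; last by lia.
  by rewrite natrM /eta le_eqVlt; apply/orP; left; apply/eqP; field.
have [XF2 NF2] := memX_window hX hA M_gt0 HM (circle_fun_continuous cF2 F2per) Xg cc0 a0 bound.
split => //; first by rewrite EF.
apply: le_trans NF2 _.
have Ng := bl_norm_ge0 hX Xg.
rewrite (_ : 64 * M * _ / _ * _ = 64 * ('C(2 * m, m)%:R / 4 ^+ m) / h ^+ 2 * (M * nX g)); last by ring.
apply: ler_wpM2r; first by rewrite mulr_ge0// ltW.
(* 64 = 4 * 2 * 2 * 4: from 4^(m-1), from [C], from eta = h/2, and from the window length 4 m h. *)
have -> : cc * (2 * (2 * m%:R * h)) =
    64 * ('C(2 * m, m)%:R / 4 ^+ m) / h ^+ 2 * (m%:R / m.+1%:R).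
  rewrite /cc /C /eta mE [4 ^+ p.+2]exprS -!natr1.
  have n0 : 0 <= p%:R :> R by [].
  field.
  by rewrite !lt0r_neq0//; lra.
rewrite ler_piMr//; last by rewrite ler_pdivrMr// mul1r ler_nat.
by rewrite !mulr_ge0// ?invr_ge0// ltW.
Qed.

End Smoothing.

(** * Bounded operators on X and approximation of iterated averages *)

Section TrigApproximation.
Variables (R : realType) (X : set (R -> R)) (nX : (R -> R) -> R).
Hypotheses (hX : banach_lattice X nX) (hA : assumption_A X nX).
Variable M : R.
Hypotheses (M_gt0 : 0 < M)
  (HM : forall f h, X f -> 0 < h -> nX (steklov h f) <= M * nX f).
Implicit Types (f g T U : R -> R) (h e : R) (p q : {poly R}).

Definition bounded_op (L : (R -> R) -> R -> R) (B : R) :=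
  [/\ forall f, X f -> X (L f),
      forall c f g, X f -> X g -> L (fun x => c * f x + g x) = fun x => c * L f x + L g x &
      forall f, X f -> nX (L f) <= B * nX f].

Lemma steklov_bounded_op h : 0 < h -> bounded_op (steklov h) M.
Proof.
move=> h0; split=> [f Xf|c f g Xf Xg|f Xf].
- exact: memX_steklov hA _ _ Xf h0.
- exact: steklov_linear (memX_locint hX Xf) (memX_locint hX Xg) h0.
- exact: HM.
Qed.

Lemma steklov_fwd_bounded_op h : 0 < h -> bounded_op (steklov_fwd h) (2 * M).
Proof.
move=> h0; split=> [f Xf|c f g Xf Xg|f Xf].
- by have [] := memX_steklov_fwd hX hA M_gt0 HM Xf h0.
- exact: steklov_fwd_linear (memX_locint hX Xf) (memX_locint hX Xg) h0.
- by have [] := memX_steklov_fwd hX hA M_gt0 HM Xf h0.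
Qed.

Lemma bounded_op_opoly L B p f : bounded_op L B -> X f -> X (opoly L p f).
Proof. by move=> [XL Llin _]; exact: (opoly_mem (bl_zero hX) (bl_lin hX) XL). Qed.

Lemma bounded_op_opolyM L B p q f : bounded_op L B -> X f ->
  opoly L (p * q) f = opoly L p (opoly L q f).
Proof. by move=> [XL Llin _]; exact: (opolyM (bl_zero hX) (bl_lin hX) XL Llin). Qed.

Lemma bounded_op_one_sub_pow L B s f : bounded_op L B -> X f ->
  one_sub_pow L s f = opoly L ((1 - 'X) ^+ s) f.
Proof. by move=> [XL Llin _]; exact: (one_sub_powE (bl_zero hX) (bl_lin hX) XL Llin). Qed.

Lemma bounded_op_iter L B n : 0 <= B -> bounded_op L B -> bounded_op (iter n L) (B ^+ n).
Proof.
move=> B0 [XL Llin BL].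
have XI k f : X f -> X (iter k L f) by move=> Xf; exact: (iter_mem XL).
split=> [f Xf|c f g Xf Xg|f Xf]; first exact: XI.
- by elim: n => //= n ->; rewrite Llin//; exact: XI.
- elim: n => [|n IH] /=; first by rewrite expr0 mul1r.
  apply: le_trans (BL _ (XI _ _ Xf)) _.
  by rewrite exprS -mulrA ler_wpM2l.
Qed.

(** The constant precedes [L], so it is uniform over the averages of all steps h. *)
Lemma opoly_norm_le p B : 0 <= B -> exists2 C, 0 < C &
  forall L, bounded_op L B -> forall f, X f -> nX (opoly L p f) <= C * nX f.
Proof.
move=> B0; elim/poly_ind: p => [|p c [C C0 IH]].
  exists 1 => // L bL f Xf; rewrite mul1r.
  rewrite (_ : opoly L 0 f = fun=> 0); last first.
    by apply/funext => x; rewrite /opoly size_poly0 big_ord0.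
  by rewrite (normX0 hX) (bl_norm_ge0 hX).
exists (C * B + `|c| + 1).
  by have := normr_ge0 c; have := mulr_ge0 (ltW C0) B0; lra.
move=> L bL f Xf; have [XL Llin BL] := bL.
rewrite opolyD opolyMX opolyC.
have X1 := bounded_op_opoly p bL (XL _ Xf).
have X2 := memXZ hX c Xf.
have Nf := bl_norm_ge0 hX Xf.
apply: le_trans (bl_normD hX X1 X2) _; rewrite (bl_normZ hX _ Xf).
have h1 := IH L bL _ (XL _ Xf); have h2 := ler_wpM2l (ltW C0) (BL _ Xf).
move: Nf h1 h2; set n1 := nX (opoly _ _ _); set n2 := nX (L f); set n3 := nX f => *.
lra.
Qed.

Definition approximable n F e := exists2 T, trig_poly n T & nX (fun x => F x - T x) <= e.

(** The alternative [c i = 0] lets the identity term of an operator polynomial pass: it is not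
    smoothed, but its coefficient will be zero. *)
Lemma approximable_sum n m (c : nat -> R) (F : nat -> R -> R) (e : R) :
  (forall i, (i < m)%N -> X (F i) /\ (c i = 0 \/ approximable n (F i) e)) -> 0 <= e ->
  approximable n (fun x => \sum_(i < m) c i * F i x) ((\sum_(i < m) `|c i|) * e).
Proof.
move=> + e0; elim: m => [|m IH] HF.
  exists (fun=> 0); first exact: trig_poly0.
  rewrite big_ord0 mul0r (_ : (fun=> _) = fun=> 0) ?(normX0 hX)//.
  by apply/funext => x; rewrite big_ord0 subr0.
have [i im|T hT ET] := IH; first exact/HF/ltnW.
have XS : X (fun x => \sum_(i < m) c i * F i x).
  elim: m {IH HF T hT ET} (fun i im => (HF i (ltnW im)).1) => [|m IHm] XF.
    by rewrite (_ : (fun=> _) = fun=> 0); [exact: bl_zero hX|apply/funext => x; rewrite big_ord0].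
  rewrite (_ : (fun=> _) = fun x => c m * F m x + \sum_(i < m) c i * F i x).
    by apply: (bl_lin hX); [exact: XF|apply: IHm => i im; exact/XF/ltnW].
  by apply/funext => x; rewrite big_ord_recr addrC.
have XT := memX_trig_poly hX hT.
have [XFm [cm|[Tm hTm ETm]]] := HF m (ltnSn m).
  exists T => //; rewrite big_ord_recr /= cm normr0 addr0; apply: le_trans ET.
  rewrite le_eqVlt; apply/orP; left; apply/eqP; congr nX; apply/funext => x.
  by rewrite big_ord_recr /= cm mul0r addr0.
have XTm := memX_trig_poly hX hTm.
exists (fun x => c m * Tm x + T x); first exact: trig_poly_lin.
rewrite big_ord_recr /= mulrDl.
have XD := memXB hX XFm XTm.
have := bl_normD hX (memXB hX XS XT) (memXZ hX (c m) XD).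
rewrite (bl_normZ hX _ XD).
have -> : (fun x => \sum_(i < m) c i * F i x - T x + c m * (F m x - Tm x)) =
    fun x => \sum_(i < m.+1) c i * F i x - (c m * Tm x + T x).
  by apply/funext => x; rewrite big_ord_recr /=; ring.
move=> /le_trans; apply; apply: lerD => //.
by rewrite ler_wpM2l.
Qed.

(** Jackson's theorem after smoothing; the constant is 2^24 M * 64 M. *)
Lemma approximable_iter_fwd I h m g : X g -> 0 < h -> (1 < m)%N ->
  approximable (4 * (2 ^ I - 1)) (iter (2 * m) (steklov_fwd h) g)
    (2 ^+ 30 * M ^+ 2 * ('C(2 * m, m)%:R / 4 ^+ m) / (2 ^+ I * h) ^+ 2 * nX g).
Proof.
move=> Xg h0 m1.
have [F1 [F2 [d1 d2 cF2 XF2 NF2]]] := iter_fwd_smooth hX hA M_gt0 HM Xg h0 m1.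
have XF := iter_fwd_mem hX hA M_gt0 HM (2 * m) Xg h0.
have [_ Fper] := bl_fun hX XF.
have [T hT ET] := jackson_norm hX hA M_gt0 HM I d1 d2 cF2 Fper XF2.
exists T => //; apply: le_trans ET _.
have p4 i : 0 < 4 ^+ i :> R by rewrite exprn_gt0.
have c0 : 0 <= 2 ^+ 24 * M / 4 ^+ I.
  by rewrite divr_ge0 ?(ltW (p4 _))// mulr_ge0 ?exprn_ge0// ltW.
apply: le_trans (ler_wpM2l c0 NF2) _.
rewrite le_eqVlt; apply/orP; left; apply/eqP.
have E4 : (2 ^+ I) ^+ 2 = 4 ^+ I :> R.
  by rewrite -exprM mulnC exprM; congr (_ ^+ _); ring.
rewrite exprMn E4 (exprD 2 24 6); set b := 'C(_, _)%:R / _.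
have -> : 2 ^+ 6 = 64 :> R by ring.
set K := 2 ^+ 24; field.
by rewrite !lt0r_neq0.
Qed.

Lemma trig_poly_steklov_fwd n h T : trig_poly n T -> 0 < h -> trig_poly n (steklov_fwd h T).
Proof.
move=> hT h0; have lT := locint_continuous (trig_poly_continuous hT).
have -> : steklov_fwd h T = fun x => h^-1 * dint T (x + 0) (x + h).
  by apply/funext => x; rewrite steklov_fwdE// addr0.
exact/trig_polyZ/trig_poly_window.
Qed.

Lemma trig_poly_steklov n h T : trig_poly n T -> 0 < h -> trig_poly n (steklov h T).
Proof.
move=> hT h0; have lT := locint_continuous (trig_poly_continuous hT).
have -> : steklov h T = fun x => h^-1 * dint T (x + - (h / 2)) (x + h / 2).
  by apply/funext => x; rewrite steklovE.
exact/trig_polyZ/trig_poly_window.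
Qed.

End TrigApproximation.

(** * Approximation by the iterated contraction, and inverse estimates *)

Section BestApproximation.
Variables (R : realType) (X : set (R -> R)) (nX : (R -> R) -> R).
Hypotheses (hX : banach_lattice X nX) (hA : assumption_A X nX).
Variable M : R.
Hypotheses (M_gt0 : 0 < M)
  (HM : forall f h, X f -> 0 < h -> nX (steklov h f) <= M * nX f).
Implicit Types (f g T U : R -> R) (h e kappa : R) (p q : {poly R}) (s : nat).

Lemma one_sub_pow_iter L B J s f : bounded_op X nX L B -> X f ->
  one_sub_pow (iter J L) s f = opoly L ((1 - 'X^J) ^+ s) f.
Proof.
move=> bL Xf; elim: s => [|s IH]; first by rewrite expr0 opoly1.
rewrite /one_sub_pow iterS -/(one_sub_pow (iter J L) s f) IH exprS.
by rewrite (bounded_op_opolyM hX _ _ bL Xf) opolyB opoly1 opolyXn.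
Qed.

(** All k >= m are covered because the i-th power of the smoothing operator consists of 2 i m
    averages. *)
Lemma central_binomial_small (D : R) : exists2 m, (1 < m)%N &
  forall k, (m <= k)%N -> D * ('C(2 * k, k)%:R / 4 ^+ k) <= 2^-1.
Proof.
pose a := 2 * `|D|.
exists (Num.truncn (a ^+ 2)).+2 => // k mk.
have hk : a ^+ 2 <= 2 * k.+1%:R - 1.
  apply: ltW; apply: lt_le_trans (truncnS_gt _) _.
  rewrite -[k.+1%:R]natr1.
  have : (Num.truncn (a ^+ 2)).+1%:R <= k%:R :> R by rewrite ler_nat; lia.
  have : 0 <= k%:R :> R by [].
  by lra.
have hb := central_binomial_sqr R k.
set b := _ / 4 ^+ k in hb *.
have b0 : 0 <= b by rewrite divr_ge0// exprn_ge0.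
have : (a * b) ^+ 2 <= 1.
  by rewrite exprMn mulrC; apply: le_trans hb; rewrite ler_wpM2l ?sqr_ge0.
rewrite -[X in _ <= X -> _](expr1n _ 2) ler_sqr ?nnegrE//; last by rewrite !mulr_ge0.
move=> h; have : D * b <= `|D| * b by rewrite ler_wpM2r// ler_norm.
by move: h; rewrite /a; lra.
Qed.

(** The number J = 2m of averages depends on s and kappa only, so C is uniform in h and I. With [Q]
    the geometric sum, (I - L^J)^s = Q(L)^s (I - L)^s, which bounds that part of f by w. The rest,
    p0(L^J) f, is split into p0(L^J) T, again a polynomial, and p0(L^J) (f - T), which is
    approximated. *)
Lemma approx_step s kappa : 0 < kappa -> exists2 C, 0 < C &
  forall h I f T, 0 < h -> kappa <= 2 ^+ I * h -> X f -> trig_poly (4 * (2 ^ I - 1)) T ->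
  exists2 T', trig_poly (4 * (2 ^ I - 1)) T' &
    nX (fun x => f x - T' x) <=
      C * nX (one_sub_pow (steklov_fwd h) s f) + 2^-1 * nX (fun x => f x - T x).
Proof.
move=> kappa0.
pose p0 : {poly R} := 1 - (1 - 'X) ^+ s.
pose S0 := \sum_(i < size p0) `|p0`_i|.
have S00 : 0 <= S0 by exact: sumr_ge0.
have [K KE] : exists K, K = 2 ^+ 30 * M ^+ 2 by exists (2 ^+ 30 * M ^+ 2).
have K0 : 0 <= K by rewrite KE mulr_ge0 ?sqr_ge0// exprn_ge0.
have [m m1 Hm] := central_binomial_small (S0 * (K / kappa ^+ 2)).
pose J := (2 * m)%N.
pose Q : {poly R} := \sum_(i < J) 'X^i.
have M20 : 0 <= 2 * M by rewrite mulr_ge0// ltW.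
have [C C0 HC] := opoly_norm_le hX (Q ^+ s) M20.
exists C => // h I f T h0 hI Xf hT.
set N := (4 * (2 ^ I - 1))%N in hT *.
pose L := steklov_fwd h : (R -> R) -> R -> R.
have bL : bounded_op X nX L (2 * M) := steklov_fwd_bounded_op hX hA M_gt0 HM h0.
have bL' := bounded_op_iter J M20 bL.
set L' := iter J L in bL'.
have XT := memX_trig_poly hX hT.
pose g x := f x - T x.
have Xg : X g := memXB hX Xf XT.
have Ng := bl_norm_ge0 hX Xg.
have YT : trig_poly N (opoly L' p0 T).
  have YL U : trig_poly N U -> trig_poly N (L U).
    by move=> hU; exact: trig_poly_steklov_fwd.
  apply: (opoly_mem (Y := trig_poly N)) => //.
  - exact: trig_poly0.
  - by move=> c u v; exact: trig_poly_lin.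
  - by move=> U hU; exact: (iter_mem YL).
have [T1 hT1 ET1] : approximable nX N (opoly L' p0 g) (2^-1 * nX g).
  (* The tolerance per term divides by [S0], which is 0 exactly when [p0] is, as for s = 0. *)
  have [S0z|S0n] := eqVneq S0 0.
    have -> : opoly L' p0 g = fun=> 0.
      apply/funext => x; rewrite /opoly big1// => i _.
      have /eqP := S0z; rewrite psumr_eq0// => /allP/(_ i (mem_index_enum _)).
      by rewrite normr_eq0 => /eqP ->; rewrite mul0r.
    exists (fun=> 0); first exact: trig_poly0.
    rewrite (_ : (fun=> _) = fun=> 0); last by apply/funext => x; rewrite subr0.
    by rewrite (normX0 hX) mulr_ge0.
  have Spos : 0 < S0 by rewrite lt_neqAle eq_sym S0n.
  have e1 : 0 <= S0^-1 * (2^-1 * nX g) by rewrite !mulr_ge0// invr_ge0.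
  have Happ i : (i < size p0)%N -> X (iter i L' g) /\
      (p0`_i = 0 \/ approximable nX N (iter i L' g) (S0^-1 * (2^-1 * nX g))).
    move=> _; split; first by case: bL' => XL' _ _; exact: (iter_mem XL').
    (* [p0] has no constant term, so the unsmoothed term i = 0 is absent. *)
    case: i => [|i].
      left; rewrite /p0 coefB coef1 /= -horner_coef0 horner_exp !hornerE.
      by rewrite subr0 expr1n subrr.
    right; have EJ : (i.+1 * J = 2 * (i.+1 * m))%N by rewrite /J mulnCA.
    rewrite /L' -iterM EJ.
    have m1' : (1 < i.+1 * m)%N by rewrite (leq_trans m1)// leq_pmull.
    have [T2 hT2 ET2] := approximable_iter_fwd hX hA M_gt0 HM I Xg h0 m1'.
    exists T2 => //; apply: le_trans ET2 _; rewrite -KE.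
    rewrite [X in _ <= X]mulrA; apply: ler_wpM2r => //.
    rewrite ler_pdivlMl//.
    have hm : (m <= i.+1 * m)%N by rewrite leq_pmull.
    have := Hm _ hm; set b := 'C(_, _)%:R / _ => hb.
    have b0 : 0 <= b by rewrite divr_ge0// exprn_ge0.
    apply: le_trans hb; set z := 2 ^+ I * h in hI *.
    have z0 : 0 < z := lt_le_trans kappa0 hI.
    rewrite [X in _ <= X](_ : _ = S0 * K * b * (kappa ^+ 2)^-1); last by ring.
    rewrite [X in X <= _](_ : _ = S0 * K * b * (z ^+ 2)^-1); last by ring.
    apply: ler_wpM2l; first by rewrite !mulr_ge0.
    by rewrite lef_pV2 ?posrE ?exprn_gt0// ler_sqr ?nnegrE// ltW.
  have [T1 hT1 ET1] := approximable_sum (c := fun i => p0`_i) hX Happ e1.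
  by exists T1 => //; apply: le_trans ET1 _; rewrite mulrA divff// mul1r.
exists (fun x => T1 x + opoly L' p0 T x); first exact: trig_polyD.
have Xw := bounded_op_opoly hX ((1 - 'X) ^+ s) bL Xf.
have fE : f = fun x => opoly L' ((1 - 'X) ^+ s) f x + (opoly L' p0 g x + opoly L' p0 T x).
  have [XL' L'lin _] := bL'.
  have Ep : opoly L' p0 f = fun x => opoly L' p0 g x + opoly L' p0 T x.
    have -> : f = fun x => 1 * g x + T x by apply/funext => x; rewrite /g; ring.
    rewrite (opoly_lin XL' L'lin _ _ Xg XT).
    by apply/funext => x; rewrite mul1r.
  have E0 : (1 - 'X) ^+ s + p0 = 1 by rewrite /p0 addrC subrK.
  transitivity (opoly L' ((1 - 'X) ^+ s + p0) f); first by rewrite E0 opoly1.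
  by rewrite opolyD Ep.
have E1 : opoly L' ((1 - 'X) ^+ s) f = opoly L (Q ^+ s) (one_sub_pow L s f).
  rewrite -(bounded_op_one_sub_pow hX s bL' Xf) (one_sub_pow_iter J s bL Xf).
  rewrite (bounded_op_one_sub_pow hX s bL Xf) -(bounded_op_opolyM hX _ _ bL Xf).
  congr (opoly L _ f); rewrite -exprMn; congr (_ ^+ _).
  by rewrite -[LHS]opprB subrX1 -mulNr opprB mulrC.
have XO : X (one_sub_pow L s f) by rewrite (bounded_op_one_sub_pow hX s bL Xf).
have XQ := bounded_op_opoly hX (Q ^+ s) bL XO.
have Xp := bounded_op_opoly hX p0 bL' Xg.
have XT1 := memX_trig_poly hX hT1.
have -> : (fun x => f x - (T1 x + opoly L' p0 T x)) = fun x =>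
    opoly L (Q ^+ s) (one_sub_pow L s f) x + (opoly L' p0 g x - T1 x).
  by apply/funext => x; rewrite {1}fE E1; ring.
apply: le_trans (bl_normD hX XQ (memXB hX Xp XT1)) _.
by apply: lerD => //; exact: HC.
Qed.

(** 2 C w is the fixed point of a -> C w + a / 2. After k steps from T = 0 the excess over it is at
    most nX f / 2^k, and k is chosen to bring this below e. *)
Lemma best_approx s kappa : 0 < kappa -> exists2 C, 0 < C &
  forall h I f e, 0 < h -> kappa <= 2 ^+ I * h -> X f -> 0 < e ->
  exists2 T, trig_poly (4 * (2 ^ I - 1)) T &
    nX (fun x => f x - T x) <= C * nX (one_sub_pow (steklov_fwd h) s f) + e.
Proof.
move=> kappa0; have [C C0 HC] := approx_step s kappa0.
exists (2 * C); first by rewrite mulr_gt0.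
move=> h I f e h0 hI Xf e0.
have Nf := bl_norm_ge0 hX Xf.
set w := nX (one_sub_pow _ s f).
have iter_k k : exists2 T, trig_poly (4 * (2 ^ I - 1)) T &
    nX (fun x => f x - T x) <= 2 * C * w + nX f / 2 ^+ k.
  elim: k => [|k [T hT ET]].
    exists (fun=> 0); first exact: trig_poly0.
    rewrite expr0 divr1 (_ : (fun x => f x - 0) = f); last by apply/funext => x; rewrite subr0.
    rewrite lerDr mulr_ge0 ?mulr_ge0 ?(ltW C0)//; apply: bl_norm_ge0 hX _ _.
    rewrite (bounded_op_one_sub_pow hX s (steklov_fwd_bounded_op hX hA M_gt0 HM h0) Xf).
    exact: (bounded_op_opoly hX _ (steklov_fwd_bounded_op hX hA M_gt0 HM h0) Xf).
  have [T' hT' ET'] := HC h I f T h0 hI Xf hT.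
  exists T' => //; apply: le_trans ET' _; rewrite -/w.
  rewrite exprS invfM; move: ET; set a := nX _; set b := nX f.
  by set v := (2 ^+ k)^-1 => ET; lra.
have [k Hk] : exists k, nX f / 2 ^+ k <= e.
  exists (Num.truncn (nX f / e)).+1.
  rewrite ler_pdivrMr ?exprn_gt0// mulrC -ler_pdivrMr//.
  apply: ltW; apply: lt_le_trans (truncnS_gt _) _.
  by rewrite -natrX ler_nat ltnW// ltn_expl.
have [T hT ET] := iter_k k; exists T => //.
by apply: le_trans ET _; rewrite lerD2l.
Qed.

Lemma has_deriv_trig_fwd h T T' : continuous T' -> has_deriv T T' -> 0 < h ->
  has_deriv (steklov_fwd h T) (steklov_fwd h T').
Proof.
move=> cT' dT h0; have cT := has_deriv_continuous dT.
apply: has_deriv_eq (has_deriv_fwd cT h0) _ => x.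
rewrite steklov_fwdE//; last exact: locint_continuous.
by rewrite (dint_primitive _ _ cT' dT).
Qed.

Lemma has_deriv_trig_steklov h T T' : continuous T' -> has_deriv T T' -> 0 < h ->
  has_deriv (steklov h T) (steklov h T').
Proof.
move=> cT' dT h0; have d := has_deriv_shift (- (h / 2)) (has_deriv_trig_fwd cT' dT h0).
have E f x : steklov_fwd h f (x - h / 2) = steklov h f x by rewrite /steklov_fwd subrK.
have -> : steklov h T = fun x => steklov_fwd h T (x - h / 2) by apply/funext => x; rewrite E.
by apply: has_deriv_eq d _ => x; rewrite E.
Qed.

(** Lets an estimate for a single difference be iterated, by applying it alternately to derivatives
    and to differences. *)
Lemma derive1_one_sub_pow n s (L : (R -> R) -> R -> R) T :
  (forall U, trig_poly n U -> trig_poly n (L U)) ->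
  (forall U U', trig_poly n U -> continuous U' -> has_deriv U U' -> has_deriv (L U) (L U')) ->
  trig_poly n T ->
  trig_poly n (one_sub_pow L s T) /\
  (one_sub_pow L s T)^`()%classic = one_sub_pow L s T^`()%classic.
Proof.
move=> tL dL hT; elim: s => [|s [hW EW]]; first by split.
rewrite /one_sub_pow !iterS -!/(one_sub_pow L s _).
set W := one_sub_pow L s T in hW EW *.
split; first by apply: trig_polyB => //; exact: tL.
have [hW' dW] := trig_poly_derive1 hW.
have dLW := dL _ _ hW (trig_poly_continuous hW') dW.
have := has_deriv_lin (- 1) dLW dW; rewrite -EW => /has_derivE.
have -> : (fun x => -1 * L W x + W x) = fun x => W x - L W x by apply/funext => x; ring.
by move=> ->; apply/funext => x; ring.
Qed.

(** Bernstein's inequality for U' bounds the Taylor remainder by 4 * 1536 M^2 h n times the left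
    side. With 12288 = 2 * 4 * 1536 this is at most one half and is absorbed, so the factor 2
    becomes 4. *)
Lemma inverse_estimate_fwd n h U : trig_poly n U -> 0 < h ->
  12288 * M ^+ 2 * (h * n%:R) <= 1 ->
  h * nX U^`()%classic <= 4 * nX (fun x => U x - steklov_fwd h U x).
Proof.
move=> hU h0 hn.
have [hU' dU] := trig_poly_derive1 hU; have [hU'' dU'] := trig_poly_derive1 hU'.
have XU := memX_trig_poly hX hU; have XU' := memX_trig_poly hX hU'.
have XU'' := memX_trig_poly hX hU''.
have := steklov_fwd_taylor hX hA M_gt0 HM h0 XU dU dU' (trig_poly_continuous hU'') XU' XU''.
have [_ NB] := bernstein_norm hX hA M_gt0 HM hU'.
have c0 : 0 <= 4 * M * h ^+ 2 by rewrite !mulr_ge0 ?sqr_ge0// ltW.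
have := ler_wpM2l c0 NB.
have N1 := bl_norm_ge0 hX XU'.
have := ler_wpM2r (mulr_ge0 (ltW h0) N1) hn.
set n1 := nX _; set n2 := nX (U^`()^`())%classic; set n3 := nX (fun x => _).
have -> : 4 * M * h ^+ 2 * (1536 * M * n%:R * n1) =
  2^-1 * (12288 * M ^+ 2 * (h * n%:R) * (h * n1)) by field.
lra.
Qed.

Lemma inverse_estimate_fwd_pow n h s T : trig_poly n T -> 0 < h ->
  12288 * M ^+ 2 * (h * n%:R) <= 1 ->
  h ^+ s * nX (derive1n s T) <= 4 ^+ s * nX (one_sub_pow (steklov_fwd h) s T).
Proof.
move=> hT h0 hn.
have tL U : trig_poly n U -> trig_poly n (steklov_fwd h U).
  by move=> hU; exact: trig_poly_steklov_fwd.
have dL U U' : trig_poly n U -> continuous U' -> has_deriv U U' ->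
    has_deriv (steklov_fwd h U) (steklov_fwd h U').
  by move=> _ cU' dU; exact: has_deriv_trig_fwd.
elim: s T hT => [|s IH] T hT; first by rewrite !expr0 !mul1r.
have [hT' _] := trig_poly_derive1 hT.
have [hW EW] := derive1_one_sub_pow s tL dL hT.
rewrite derive1Sn exprS -mulrA.
apply: le_trans (ler_wpM2l (ltW h0) (IH _ hT')) _.
rewrite -EW mulrCA exprSr -mulrA; apply: ler_wpM2l; first by rewrite exprn_ge0.
exact: (inverse_estimate_fwd hW h0 hn).
Qed.

Lemma steklov_pow_le n h r T : trig_poly n T -> 0 < h ->
  nX (one_sub_pow (steklov h) r T) <= (2 * M * h ^+ 2) ^+ r * nX (derive1n (2 * r) T).
Proof.
move=> hT h0.
have tL U : trig_poly n U -> trig_poly n (steklov h U).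
  by move=> hU; exact: trig_poly_steklov.
have dL U U' : trig_poly n U -> continuous U' -> has_deriv U U' ->
    has_deriv (steklov h U) (steklov h U').
  by move=> _ cU' dU; exact: has_deriv_trig_steklov.
elim: r T hT => [|r IH] T hT; first by rewrite expr0 mul1r muln0.
have [hT' _] := trig_poly_derive1 hT; have [hT'' _] := trig_poly_derive1 hT'.
have [hW EW] := derive1_one_sub_pow r tL dL hT.
have [hW' dW] := trig_poly_derive1 hW; have [hW'' dW'] := trig_poly_derive1 hW'.
have [_ EW'] := derive1_one_sub_pow r tL dL hT'.
have := steklov_taylor hX hA M_gt0 HM h0 (memX_trig_poly hX hW) dW dW'
  (trig_poly_continuous hW'') (memX_trig_poly hX hW'').
rewrite /one_sub_pow iterS -/(one_sub_pow (steklov h) r T) => /le_trans; apply.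
rewrite EW EW' (_ : (2 * r.+1)%N = (2 * r).+2); last by lia.
rewrite !derive1Sn [_ ^+ r.+1]exprS -[X in _ <= X]mulrA; apply: ler_wpM2l; last exact: IH.
by rewrite !mulr_ge0 ?sqr_ge0// ltW.
Qed.

Lemma bernstein_norm_pow n (q : nat) T : trig_poly n T ->
  nX (derive1n q T) <= (1536 * M * n%:R) ^+ q * nX T.
Proof.
move=> hT; elim: q => [|q IH]; first by rewrite expr0 mul1r.
have hq := trig_poly_derive1n q hT.
have [_ ] := bernstein_norm hX hA M_gt0 HM hq.
rewrite derive1nS => /le_trans; apply.
have c0 : 0 <= 1536 * M * n%:R by exact: mulr_ge0 (mulr_ge0 (ler0n _ _) (ltW M_gt0)) (ler0n _ _).
by have := ler_wpM2l c0 IH; rewrite mulrA -[_ * _ ^+ q]exprS.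
Qed.

End BestApproximation.

(** * One polynomial for the function, its derivative and its differences *)

Section SimultaneousApproximation.
Variables (R : realType) (X : set (R -> R)) (nX : (R -> R) -> R).
Hypotheses (hX : banach_lattice X nX) (hA : assumption_A X nX).
Variable M : R.
Hypotheses (M_gt0 : 0 < M)
  (HM : forall f h, X f -> 0 < h -> nX (steklov h f) <= M * nX f).

(** Take the least I with t < 8 * 2^I. If I > 0, minimality gives 4 * 2^I <= t, which covers the
    degree; if I = 0 the degree is 0, hence the maximum with 0. *)
Lemma dyadic_degree (t : R) : exists I,
  ((4 * (2 ^ I - 1))%:R <= Num.max t 0) /\ t < 8 * 2 ^+ I.
Proof.
have ex : exists I, t < 8 * 2 ^+ I.
  exists (Num.truncn `|t|).+1; apply: le_lt_trans (ler_norm t) _.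
  have := truncnS_gt `|t|; have : (Num.truncn `|t|).+1%:R < 2 ^+ (Num.truncn `|t|).+1 :> R.
    by rewrite -natrX ltr_nat ltn_expl.
  set a := _%:R; set b := 2 ^+ _ => h1 h2.
  have : 0 <= a by exact: ler0n.
  lra.
case: (ex_minnP ex) => I HI Imin; exists I; split => //.
case: I HI Imin => [|I] HI Imin.
  by rewrite expn0 subnn muln0 le_max lexx orbT.
have : 8 * 2 ^+ I <= t.
  by rewrite leNgt; apply/negP => /Imin; rewrite ltnn.
rewrite le_max => h; apply/orP; left; apply: le_trans h.
rewrite -natrX -(natrM _ 8) ler_nat expnS; lia.
Qed.

(** delta is fixed by the inverse estimate through c1 * gamma * delta <= 1. It then determines
    kappa, and [best_approx] copes with any positive kappa. *)
Lemma trig_approximation (gamma : R) (s r : nat) : 0 < gamma -> (s <= 2 * r)%N ->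
  exists2 C, 0 < C & forall n f e, (0 < n)%N -> X f -> 0 < e ->
    let h := gamma / n%:R in
    let w := nX (one_sub_pow (steklov_fwd h) s f) in
    exists T, [/\ trig_poly n T, nX (fun x => f x - T x) <= C * (w + e),
      n%:R ^- s * nX (derive1n s T) <= C * (w + e) &
      nX (one_sub_pow (steklov h) r T) <= C * (w + e)].
Proof.
move=> g0 sr.
have [c1 c1E] : exists c1, c1 = 12288 * M ^+ 2 by exists (12288 * M ^+ 2).
have c10 : 0 < c1 by rewrite c1E; apply: mulr_gt0; [rewrite ltr0n|rewrite exprn_gt0].
have [delta [d0 d1 dc]] : exists delta, [/\ 0 < delta, delta <= 1 & c1 * (gamma * delta) <= 1].
  have q0 : 0 < (c1 * gamma)^-1 by rewrite invr_gt0 mulr_gt0.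
  exists (Num.min 1 (c1 * gamma)^-1); split.
  - by rewrite lt_min ltr01 q0.
  - by rewrite ge_min lexx.
  - rewrite mulrA -ler_pdivlMl ?mulr_gt0// mulr1.
    by rewrite ge_min lexx orbT.
(* [dyadic_degree] will give delta n < 8 * 2^I; multiplied by gamma / n, this bounds 2^I h from
   below by kappa. *)
have kappa0 : 0 < delta * gamma / 8 by rewrite divr_gt0// mulr_gt0.
have [C1 C10 HC1] := best_approx hX hA M_gt0 HM s kappa0.
have M20 : 0 <= 2 * M by rewrite mulr_ge0// ltW.
have [C2 C20 HC2] := opoly_norm_le hX ((1 - 'X) ^+ s) M20.
pose C3 := 4 ^+ s * (1 + C2 * (C1 + 1)).
have C30 : 0 < C3.
  by rewrite mulr_gt0 ?exprn_gt0// addr_gt0// mulr_gt0// addr_gt0.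
have [B [BE B0]] : exists B, B = 1536 * M /\ 0 <= B.
  by exists (1536 * M); split; [reflexivity|exact: mulr_ge0 (ler0n _ _) (ltW M_gt0)].
pose C4 := (2 * M) ^+ r * (B * gamma) ^+ (2 * r - s) * C3.
have C40 : 0 <= C4.
  exact: mulr_ge0 (mulr_ge0 (exprn_ge0 _ M20) (exprn_ge0 _ (mulr_ge0 B0 (ltW g0)))) (ltW C30).
pose C5 := (gamma ^+ s)^-1 * C3.
have gs0 : 0 < gamma ^+ s by rewrite exprn_gt0.
have C50 : 0 <= C5 by rewrite mulr_ge0 ?(ltW C30)// invr_ge0 ltW.
exists (C1 + 1 + C4 + C5); first by clear -C10 C40 C50; lra.
move=> n f e n0 Xf e0 h w.
have nR : 0 < n%:R :> R by rewrite ltr0n.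
have h0 : 0 < h by rewrite divr_gt0.
have bL := steklov_fwd_bounded_op hX hA M_gt0 HM h0.
have w0 : 0 <= w.
  apply: bl_norm_ge0 hX _ _; rewrite (bounded_op_one_sub_pow hX s bL Xf).
  exact: (bounded_op_opoly hX _ bL Xf).
have [I [NI I8]] := dyadic_degree (delta * n%:R).
set N := (4 * (2 ^ I - 1))%N in NI.
have {}NI : N%:R <= delta * n%:R :> R.
  by apply: le_trans NI _; rewrite ge_max lexx mulr_ge0// ltW.
have Nn : (N <= n)%N.
  by rewrite -(ler_nat R); apply: le_trans NI _; rewrite ler_piMl// ltW.
have hI : delta * gamma / 8 <= 2 ^+ I * h.
  rewrite /h mulrA ler_pdivlMr// mulrAC ler_pdivrMr//.
  rewrite (_ : delta * gamma * n%:R = gamma * (delta * n%:R)); last by ring.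
  rewrite (_ : 2 ^+ I * gamma * 8 = gamma * (8 * 2 ^+ I)); last by ring.
  by rewrite ler_wpM2l ?ltW.
have hN : h * N%:R <= gamma * delta.
  rewrite /h mulrAC ler_pdivrMr// -mulrA ler_wpM2l//; exact: ltW.
have hN0 : 0 <= h * N%:R by rewrite mulr_ge0// ltW.
have hN1 : 12288 * M ^+ 2 * (h * N%:R) <= 1.
  by rewrite -c1E; apply: le_trans dc; rewrite ler_wpM2l// ltW.
have [T hT ET] := HC1 h I f e h0 hI Xf e0.
have XT := memX_trig_poly hX hT.
have Xg := memXB hX Xf XT.
have we0 : 0 <= w + e by rewrite addr_ge0// ltW.
have ET' : nX (fun x => f x - T x) <= (C1 + 1) * (w + e).
  apply: le_trans ET _; rewrite -/w mulrDl mul1r mulrDr.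
  have := mulr_ge0 (ltW C10) (ltW e0); clear -w0 e0; lra.
have Es : h ^+ s * nX (derive1n s T) <= C3 * (w + e).
  apply: le_trans (inverse_estimate_fwd_pow hX hA M_gt0 HM s hT h0 hN1) _.
  rewrite /C3 -mulrA; apply: ler_wpM2l; first by rewrite exprn_ge0.
  (* The difference of T is that of f minus that of f - T; the first has norm w and the second is
     bounded by the error just obtained. *)
  have -> : one_sub_pow (steklov_fwd h) s T = fun x =>
      one_sub_pow (steklov_fwd h) s f x - opoly (steklov_fwd h) ((1 - 'X) ^+ s) (fun x => f x - T x) x.
    rewrite !(bounded_op_one_sub_pow hX s bL)//; have [XL Llin _] := bL.
    have -> : (fun x => f x - T x) = fun x => -1 * T x + f x by apply/funext => x; ring.
    by rewrite (opoly_lin XL Llin _ _ XT Xf); apply/funext => x; ring.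
  have X1 : X (one_sub_pow (steklov_fwd h) s f).
    by rewrite (bounded_op_one_sub_pow hX s bL Xf); exact: (bounded_op_opoly hX _ bL Xf).
  have X2 := bounded_op_opoly hX ((1 - 'X) ^+ s) bL Xg.
  apply: le_trans (normXB hX X1 X2) _; rewrite -/w.
  have h2 := HC2 _ bL _ Xg; have h3 := ler_wpM2l (ltW C20) ET'.
  rewrite mulrDl mul1r -[C2 * (C1 + 1) * _]mulrA; apply: lerD; first by rewrite lerDl ltW.
  exact: le_trans h2 h3.
have R1 : nX (one_sub_pow (steklov h) r T) <= C4 * (w + e).
  apply: le_trans (steklov_pow_le hX hA M_gt0 HM r hT h0) _.
  have hTs := trig_poly_derive1n s hT.
  have c0 : 0 <= (2 * M * h ^+ 2) ^+ r by rewrite exprn_ge0// mulr_ge0// sqr_ge0.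
  have E2r : derive1n (2 * r) T = derive1n (2 * r - s) (derive1n s T).
    by rewrite /derive1n -iterD subnK.
  have := bernstein_norm_pow hX hA M_gt0 HM (2 * r - s) hTs; rewrite -E2r -BE => hb.
  apply: le_trans (ler_wpM2l c0 hb) _.
  have NTs := bl_norm_ge0 hX (memX_trig_poly hX hTs).
  (* Here s <= 2r is used: h^(2r) splits into h^s, paired with the s-th derivative, and h^(2r-s),
     which balances the Bernstein factors. *)
  have -> : (2 * M * h ^+ 2) ^+ r * ((B * N%:R) ^+ (2 * r - s) * nX (derive1n s T)) =
      ((2 * M) ^+ r * (B * (h * N%:R)) ^+ (2 * r - s)) * (h ^+ s * nX (derive1n s T)).
    rewrite exprMn -exprM -{1}(subnK sr) exprD !exprMn; ring.
  rewrite /C4 -[X in _ <= X]mulrA; apply: ler_pM => //.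
  - exact: mulr_ge0 (exprn_ge0 _ M20) (exprn_ge0 _ (mulr_ge0 B0 hN0)).
  - exact: mulr_ge0 (exprn_ge0 _ (ltW h0)) NTs.
  apply: ler_wpM2l; first exact: exprn_ge0.
  rewrite lerXn2r ?nnegrE ?mulr_ge0 ?(ltW g0)//.
  rewrite ler_wpM2l//; apply: le_trans hN _; rewrite ler_piMr// ltW//.
have R2 : n%:R ^- s * nX (derive1n s T) <= C5 * (w + e).
  have -> : n%:R ^- s = (gamma ^+ s)^-1 * h ^+ s.
    by rewrite /h expr_div_n mulrA mulVf ?mul1r// lt0r_neq0.
  by rewrite /C5 -mulrA -[X in _ <= X]mulrA; apply: ler_wpM2l => //; rewrite invr_ge0 ltW.
exists T; split.
- exact: trig_poly_mono Nn hT.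
- apply: le_trans ET' _; apply: ler_wpM2r => //; clear -C10 C40 C50; lra.
- apply: le_trans R2 _; apply: ler_wpM2r => //; clear -C10 C40 C50; lra.
- apply: le_trans R1 _; apply: ler_wpM2r => //; clear -C10 C40 C50; lra.
Qed.

End SimultaneousApproximation.

(** * Arcs as measurable periodic sets *)

Section Arcs.
Variable R : realType.
Implicit Types a b y : R.

Lemma circle_fun_arc a b : circle_fun (\1_(Defs.arc a b) : R -> R).
Proof.
split.
  apply: measurable_indic.
  have E : Defs.arc a b = \bigcup_k (`[a - k%:R * (2 * pi), b - k%:R * (2 * pi)[%classic `|`
      `[a + k%:R * (2 * pi), b + k%:R * (2 * pi)[%classic).
    apply/seteqP; split => y /=.
      case=> -[k|k] /andP[ya yb].
        exists k => //=; left; rewrite /= in_itv /=.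
        by move: ya yb; rewrite -pmulrn => ya yb; apply/andP; split; lra.
      exists k.+1 => //=; right; rewrite /= in_itv /=.
      by move: ya yb; rewrite NegzE mulrNz -pmulrn => ya yb; apply/andP; split; lra.
    case=> k _ [] /=; rewrite in_itv /= => /andP[ya yb].
      by exists (Posz k); rewrite -pmulrn; apply/andP; split; lra.
    by exists (- Posz k); rewrite mulrNz -pmulrn; apply/andP; split; lra.
  rewrite E; apply: bigcupT_measurable => k; apply: measurableU; exact: measurable_lebesgue_itv.
have step (y : R) (j : int) : y + (j + 1)%:~R * (2 * pi) = y + 2 * pi + j%:~R * (2 * pi).
  by rewrite intrD; ring.
move=> y; rewrite !indicE; congr (_%:R); congr nat_of_bool.
apply/idP/idP => /set_mem [j Hj]; apply/mem_set; first by exists (j + 1); rewrite step.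
by exists (j - 1); rewrite -step subrK.
Qed.

End Arcs.

(** * Estimates for the discrete semi-norm *)

Section DiscreteNorm.
Variables (R : realType) (X : set (R -> R)) (nX : (R -> R) -> R).
Hypotheses (hX : banach_lattice X nX) (hA : assumption_A X nX).
Variable M : R.
Hypotheses (M_gt0 : 0 < M)
  (HM : forall f h, X f -> 0 < h -> nX (steklov h f) <= M * nX f).
Variables (gamma gamma' : R) (m : nat -> nat) (x : nat -> nat -> R).
Hypotheses (gamma_gt0 : 0 < gamma) (gamma'_gt0 : 0 < gamma').
Hypothesis nodes : forall n, (0 < n)%N -> x n (m n).+1 = 2 * pi + x n 1%N /\
  forall k, (1 <= k <= m n)%N -> gamma / n%:R <= x n k.+1 - x n k <= gamma' / n%:R.
Implicit Types (f g H T U : R -> R) (n k l r : nat).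

(** The function whose norm is [discrete_norm]. *)
Definition node_step n f y := \sum_(1 <= k < (m n).+1)
  `|f (x n k)| * \1_(Defs.arc (x n k) (x n k.+1)) y.

Lemma node_lt n k l : (0 < n)%N -> (1 <= k)%N -> (k < l)%N -> (l <= (m n).+1)%N ->
  x n k < x n l.
Proof.
move=> n0 k1; have [_ Hn] := nodes n0; elim: l => // l IH; rewrite ltnS => kl lm.
have lm' : (1 <= l <= m n)%N by rewrite (leq_trans k1 kl) -ltnS lm.
have /andP[Hl _] := Hn l lm'.
have g0 : 0 < gamma / n%:R by rewrite divr_gt0// ltr0n.
have {}Hl : x n l < x n l.+1 by rewrite -subr_gt0; exact: lt_le_trans Hl.
move: kl; rewrite leq_eqVlt => /predU1P[->//|kl].
by apply: lt_trans (IH kl _) Hl; exact: ltnW.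
Qed.

Lemma node_le n k l : (0 < n)%N -> (1 <= k)%N -> (k <= l)%N -> (l <= (m n).+1)%N ->
  x n k <= x n l.
Proof.
move=> n0 k1; rewrite leq_eqVlt => /predU1P[->//|kl] lm; exact/ltW/node_lt.
Qed.

(** All the cells lie in the single period starting at the first node. Two representatives of y
    there coincide, so i = j, and the ordering of the nodes decides. *)
Lemma arc_disjoint n k l y : (0 < n)%N -> (1 <= k <= m n)%N -> (1 <= l <= m n)%N ->
  Defs.arc (x n k) (x n k.+1) y -> Defs.arc (x n l) (x n l.+1) y -> k = l.
Proof.
move=> n0 /andP[k1 km] /andP[l1 lm] [i /andP[i1 i2]] [j /andP[j1 j2]].
have [xe _] := nodes n0; have pi0 := pi_gt0 R.
have bnd p : (1 <= p)%N -> (p <= m n)%N -> x n 1%N <= x n p /\ x n p.+1 <= 2 * pi + x n 1%N.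
  by move=> p1 pm; split; [exact: node_le (leqW pm)|rewrite -xe; exact: node_le].
have [k3 k4] := bnd _ k1 km; have [l3 l4] := bnd _ l1 lm.
have ij : i = j.
  have d1 : (i - j)%:~R * (2 * pi) < 2 * pi :> R by rewrite intrB mulrBl; lra.
  have d2 : (j - i)%:~R * (2 * pi) < 2 * pi :> R by rewrite intrB mulrBl; lra.
  have tp : 0 < 2 * pi :> R by lra.
  rewrite -[X in _ < X]mul1r ltr_pM2r// -[1]/(1%:~R) ltr_int in d1.
  rewrite -[X in _ < X]mul1r ltr_pM2r// -[1]/(1%:~R) ltr_int in d2.
  by clear -d1 d2; lia.
rewrite -ij in j1 j2.
have [kl|lk|//] := ltngtP k l.
  exfalso; have := node_le n0 (isT : (1 <= k.+1)%N) kl (leqW lm); lra.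
exfalso; have := node_le n0 (isT : (1 <= l.+1)%N) lk (leqW km); lra.
Qed.

(** At most one term of the sum survives at y; periodicity of [H] moves y into the corresponding
    cell. Nonnegativity of [H] settles a point in no arc. *)
Lemma node_step_le n f H y : (0 < n)%N -> (forall z, 0 <= H z) -> periodic H (2 * pi) ->
  (forall k z, (1 <= k <= m n)%N -> x n k <= z < x n k.+1 -> `|f (x n k)| <= H z) ->
  node_step n f y <= H y.
Proof.
move=> n0 H0 Hper HH; rewrite /node_step.
have perz z (j : int) : H (z + j%:~R * (2 * pi)) = H z.
  have pn q z' : H (z' + q%:R * (2 * pi)) = H z' by rewrite mulr_natl periodicn.
  case: j => j; first by rewrite -pmulrn pn.
  by rewrite -(pn j.+1) NegzE mulrNz -pmulrn mulNr subrK.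
have [[k [km Hk]]|none] := pselect (exists k, (1 <= k <= m n)%N /\ Defs.arc (x n k) (x n k.+1) y).
  have kI : k \in index_iota 1 (m n).+1 by rewrite mem_index_iota ltnS.
  rewrite (bigD1_seq k) ?iota_uniq//= big_seq_cond big1 ?addr0.
    have [j Hj] := Hk; rewrite indicE mem_set// mulr1 -(perz y j); exact: HH.
  move=> l /andP[]; rewrite mem_index_iota ltnS => lm lk.
  rewrite indicE memNset ?mulr0// => Hl.
  by rewrite (arc_disjoint n0 lm km Hl Hk) eqxx in lk.
rewrite big_seq_cond big1// => l; rewrite andbT mem_index_iota ltnS => lm.
by rewrite indicE memNset ?mulr0// => Hl; apply: none; exists l.
Qed.

Lemma node_step_ge0 n f y : 0 <= node_step n f y.
Proof. by apply: sumr_ge0 => k _; rewrite mulr_ge0// indicE. Qed.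

Lemma node_step_circle_fun n f : circle_fun (node_step n f).
Proof.
split; last first.
  move=> y; apply: eq_bigr => k _; congr (_ * _).
  by have [_ ->] := circle_fun_arc (x n k) (x n k.+1).
apply: measurable_sum => k; apply: measurable_funM; first exact: measurable_cst.
by have [] := circle_fun_arc (x n k) (x n k.+1).
Qed.

Lemma node_step_memX n f : X (node_step n f).
Proof.
apply: (memX_le hX (node_step_circle_fun n f)
  (memX_cst hX (\sum_(1 <= k < (m n).+1) `|f (x n k)|)) _).1.
move=> y; rewrite ger0_norm ?node_step_ge0//; apply: le_trans (ler_norm _).
by apply: ler_sum => k _; rewrite indicE ler_piMr//; case: (_ \in _).
Qed.

Lemma discrete_norm_le n f H : (0 < n)%N -> X H -> (forall z, 0 <= H z) ->
  (forall k z, (1 <= k <= m n)%N -> x n k <= z < x n k.+1 -> `|f (x n k)| <= H z) ->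
  discrete_norm nX m x n f <= nX H.
Proof.
move=> n0 XH H0 HH; have [_ Hper] := bl_fun hX XH.
apply: (memX_le hX (node_step_circle_fun n f) XH _).2 => y.
rewrite ger0_norm ?node_step_ge0// ger0_norm//; exact: node_step_le.
Qed.

Lemma discrete_norm_triangle n f g H : (forall y, `|f y| <= `|g y| + `|H y|) ->
  discrete_norm nX m x n f <= discrete_norm nX m x n g + discrete_norm nX m x n H.
Proof.
move=> fgH; have XgH := memXD hX (node_step_memX n g) (node_step_memX n H).
apply: le_trans (bl_normD hX (node_step_memX n g) (node_step_memX n H)).
apply: (memX_le hX (node_step_circle_fun n f) XgH _).2 => y.
rewrite ger0_norm ?node_step_ge0//; apply: le_trans (ler_norm _).
rewrite /node_step -big_split; apply: ler_sum => k _ /=.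
by rewrite -mulrDl ler_wpM2r// indicE.
Qed.

(** For z in the cell of a node, the averaging window at the node lies within c = gamma' / n + h / 2
    of z, so an average of length 2c dominates; the constant is 2c / h times M. No such bound holds
    for g itself, whose values at the nodes are not controlled by its norm. *)
Lemma discrete_norm_steklov n g : (0 < n)%N -> X g ->
  discrete_norm nX m x n (steklov (gamma / n%:R) g) <=
    (2 * gamma' + gamma) / gamma * (M * nX g).
Proof.
move=> n0 Xg; have nR : 0 < n%:R :> R by rewrite ltr0n.
set h := gamma / n%:R; have h0 : 0 < h by rewrite divr_gt0.
have g'0 : 0 < gamma' / n%:R by rewrite divr_gt0.
pose c := gamma' / n%:R + h / 2.
have c0 : 0 < 2 * c by rewrite /c; lra.
have [Xa Na] := memX_abs hX Xg.
have la := memX_locint hX Xa; have lg := memX_locint hX Xg.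
have XH := memXZ hX (h^-1 * (2 * c)) (memX_steklov hA Xa c0).
have k0 : 0 <= h^-1 * (2 * c) by rewrite mulr_ge0 ?invr_ge0 ?ltW.
have HE z : h^-1 * (2 * c) * steklov (2 * c) (fun y => `|g y|) z =
    h^-1 * dint (fun y => `|g y|) (z - c) (z + c).
  rewrite (steklovE _ la c0) (_ : 2 * c / 2 = c); last by field.
  by rewrite -mulrA [2 * c * _]mulrA divff ?mul1r// lt0r_neq0.
have a0 y : 0 <= `|g y| by exact: normr_ge0.
apply: le_trans (discrete_norm_le (f := steklov h g) n0 XH _ _) _.
- move=> z; rewrite HE mulr_ge0 ?invr_ge0 ?(ltW h0)//.
  by apply: (dint_ge0 la a0); lra.
- move=> k z km /andP[z1 z2]; rewrite HE (steklovE _ lg h0) normrM gtr0_norm ?invr_gt0//.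
  apply: ler_wpM2l; first by rewrite invr_ge0 ltW.
  have ab : x n k - h / 2 <= x n k + h / 2 by lra.
  apply: le_trans (prim_norm lg ab) _.
  have [_ /(_ k km) /andP[_ hk]] := nodes n0.
  by apply: (dint_le_itv la a0); rewrite /c; lra.
rewrite (bl_normZ hX _ (memX_steklov hA Xa c0)) (ger0_norm k0).
have -> : (2 * gamma' + gamma) / gamma = h^-1 * (2 * c).
  by rewrite /c /h; field; rewrite !lt0r_neq0.
apply: ler_wpM2l => //; apply: le_trans (HM Xa c0) _.
by rewrite ler_wpM2l// ltW.
Qed.

(** Within a cell U varies by at most the integral of |U'| over a window of radius gamma' / n.
    Bernstein's inequality bounds its norm by 2 (gamma' / n) M * 1536 M n times that of U. *)
Lemma discrete_norm_trig n U : (0 < n)%N -> trig_poly n U ->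
  discrete_norm nX m x n U <= (1 + 3072 * gamma' * M ^+ 2) * nX U.
Proof.
move=> n0 hU; have nR : 0 < n%:R :> R by rewrite ltr0n.
have [hU' dU] := trig_poly_derive1 hU.
have XU := memX_trig_poly hX hU; have XU' := memX_trig_poly hX hU'.
set a := gamma' / n%:R; have a0 : 0 < a by rewrite divr_gt0.
have a20 : 0 < 2 * a by rewrite mulr_gt0.
have [Xa Na] := memX_abs hX XU; have [Xa' Na'] := memX_abs hX XU'.
have la := memX_locint hX Xa'.
have cU' := trig_poly_continuous hU'.
have XS := memX_steklov hA Xa' a20.
have XH := bl_lin hX (2 * a) XS Xa.
have b0 y : 0 <= `|U^`()%classic y| by exact: normr_ge0.
have HE z : 2 * a * steklov (2 * a) (fun y => `|U^`()%classic y|) z =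
    dint (fun y => `|U^`()%classic y|) (z - a) (z + a).
  rewrite (steklovE _ la a20) (_ : 2 * a / 2 = a); last by field.
  by rewrite mulrA divff ?mul1r// lt0r_neq0.
apply: le_trans (discrete_norm_le (f := U) n0 XH _ _) _.
- by move=> z; rewrite HE addr_ge0//; apply: (dint_ge0 la b0); lra.
- move=> k z km /andP[z1 z2]; rewrite HE.
  have [_ /(_ k km) /andP[_ hk]] := nodes n0.
  have -> : U (x n k) = U z - (U z - U (x n k)) by ring.
  rewrite -(dint_primitive _ _ cU' dU) [X in _ <= X]addrC; apply: le_trans (ler_normB _ _) _.
  apply: lerD => //; apply: le_trans (prim_norm (locint_continuous cU') z1) _.
  by apply: (dint_le_itv la b0); rewrite /a; lra.
apply: le_trans (bl_normD hX (memXZ hX _ XS) Xa) _.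
rewrite (bl_normZ hX _ XS) (gtr0_norm a20) [X in X <= _]addrC [X in _ <= X]mulrDl mul1r.
apply: lerD => //.
have [_ NB] := bernstein_norm hX hA M_gt0 HM hU.
have s1 := HM Xa' a20.
have s2 := ler_wpM2l (ltW M_gt0) (le_trans Na' NB).
apply: le_trans (ler_wpM2l (ltW a20) (le_trans s1 s2)) _.
rewrite le_eqVlt; apply/orP; left; apply/eqP; rewrite /a; field.
by rewrite lt0r_neq0.
Qed.

Lemma discrete_norm_one_sub_pow r : exists2 C, 0 < C &
  forall n g, (0 < n)%N -> X g -> discrete_norm nX m x n g <=
    discrete_norm nX m x n (one_sub_pow (steklov (gamma / n%:R)) r g) + C * nX g.
Proof.
pose D := (2 * gamma' + gamma) / gamma * M.
have D0 : 0 < D by rewrite /D mulr_gt0// divr_gt0// addr_gt0// mulr_gt0.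
elim: r => [|r [C C0 IH]].
  by exists 1 => // n g n0 Xg; rewrite lerDl mul1r (bl_norm_ge0 hX).
have [C' C'0 HC'] := opoly_norm_le hX ((1 - 'X) ^+ r) (ltW M_gt0).
exists (D * C' + C); first by rewrite addr_gt0// mulr_gt0.
move=> n g n0 Xg; set h := gamma / n%:R.
have h0 : 0 < h by rewrite divr_gt0// ltr0n.
have bL := steklov_bounded_op hX hA HM h0.
apply: le_trans (IH n g n0 Xg) _; rewrite -/h.
set W := one_sub_pow (steklov h) r g.
have WE : W = opoly (steklov h) ((1 - 'X) ^+ r) g := bounded_op_one_sub_pow hX r bL Xg.
have XW : X W by rewrite WE; exact: (bounded_op_opoly hX _ bL Xg).
have NW : nX W <= C' * nX g by rewrite WE; exact: HC'.
have -> : one_sub_pow (steklov h) r.+1 g = fun y => W y - steklov h W y by [].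
have tri : discrete_norm nX m x n W <= discrete_norm nX m x n (fun y => W y - steklov h W y)
    + discrete_norm nX m x n (steklov h W).
  apply: discrete_norm_triangle => y.
  by rewrite -{1}[W y](subrK (steklov h W y)) ler_normD.
have st := discrete_norm_steklov n0 XW; rewrite -/h in st.
have := ler_wpM2l (ltW D0) NW; rewrite /D in D0 *; move: tri st.
set d1 := discrete_norm _ _ _ _ W; set d2 := discrete_norm _ _ _ _ (fun y => _).
set d3 := discrete_norm _ _ _ _ _; set q := (2 * gamma' + gamma) / gamma.
clear; lra.
Qed.

End DiscreteNorm.

(** * Assembly of the two estimates *)

Unset Implicit Arguments.

Theorem theorem3p1 (R : realType) (X : set (R -> R)) (nX : (R -> R) -> R)
    (hX : banach_lattice X nX) (hA : assumption_A X nX)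
    (r s : nat) (r_gt0 : (0 < r)%N) (s_gt0 : (0 < s)%N) (rs : (s <= 2 * r)%N)
    (Phi : nat -> set (R -> R)) (hPhi : approximation_spaces X nX Phi)
    (gamma gamma' : R) (gamma_gt0 : 0 < gamma) (gamma'_gt0 : 0 < gamma')
    (m : nat -> nat) (x : nat -> nat -> R) (phi : nat -> nat -> R -> R)
    (hG : sampling_system Phi gamma gamma' m x phi)
    (K1 K3 : R) (K1_gt0 : 0 < K1) (K3_gt0 : 0 < K3)
    (hK1 : forall n f, (0 < n)%N -> X f ->
       nX (sampling_op m x phi n f) <= K1 * discrete_norm nX m x n f)
    (hK3 : forall n T, (0 < n)%N -> trig_poly n T ->
       nX (fun y => T y - sampling_op m x phi n T y)
         <= K3 * n%:R ^- s * nX (derive1n s T)) :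
  (exists2 C : R, 0 < C & forall n f, (0 < n)%N -> X f ->
     nX (fun y => f y - sampling_op m x phi n f y)
       <= C * (nX (one_sub_pow (steklov_fwd (gamma / n%:R)) s f)
               + discrete_norm nX m x n
                   (one_sub_pow (steklov (gamma / n%:R)) r f)))
  /\
  ((forall n f, (0 < n)%N -> X f -> trig_poly n (sampling_op m x phi n f)) ->
   exists2 C : R, 0 < C & forall n f, (0 < n)%N -> X f ->
     discrete_norm nX m x n (fun y => f y - sampling_op m x phi n f y)
       <= C * (nX (one_sub_pow (steklov_fwd (gamma / n%:R)) s f)
               + discrete_norm nX m x n
                   (one_sub_pow (steklov (gamma / n%:R)) r f))).
Proof.
have nodes n : (0 < n)%N -> x n (m n).+1 = 2 * pi + x n 1%N /\
    forall k, (1 <= k <= m n)%N -> gamma / n%:R <= x n k.+1 - x n k <= gamma' / n%:R.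
  by move=> n0; have [xe H] := hG n n0; split=> // k /H [].
have phiX n k : (0 < n)%N -> (1 <= k <= m n)%N -> X (phi n k).
  by move=> n0 km; have [_ /(_ k km) [Hp _ _ _]] := hG n n0; exact: as_sub hPhi n _ Hp.
have [M M0 HM] := steklov_bounded hX hA.
have [C C0 HC] := trig_approximation hX hA M0 HM gamma_gt0 rs.
have [C1 C10 HC1] := discrete_norm_one_sub_pow hX hA M0 HM gamma_gt0 gamma'_gt0 nodes r.
have HC2 := discrete_norm_trig hX hA M0 HM gamma_gt0 gamma'_gt0 nodes.
have [C2 C20 {}HC2] : exists2 C2, 0 < C2 & forall n U, (0 < n)%N -> trig_poly n U ->
    discrete_norm nX m x n U <= C2 * nX U.
  have k0 : 0 < 3072 :> R by rewrite ltr0n.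
  have k1 : 0 < 1 + 3072 * gamma' * M ^+ 2.
    exact: addr_gt0 ltr01 (mulr_gt0 (mulr_gt0 k0 gamma'_gt0) (exprn_gt0 2 M0)).
  exists (1 + 3072 * gamma' * M ^+ 2); [exact: k1 | exact: HC2].
have GX n f : (0 < n)%N -> X (sampling_op m x phi n f).
  case: n => // n n0; rewrite /sampling_op.
  have H (l : seq nat) : {in l, forall k, (1 <= k <= m n.+1)%N} ->
      X (fun y => \sum_(k <- l) f (x n.+1 k) * phi n.+1 k y).
    elim: l => [|k l IH] Hl.
      rewrite (_ : (fun=> _) = fun=> 0); first exact: bl_zero hX.
      by apply/funext => y; rewrite big_nil.
    rewrite (_ : (fun=> _) = fun y => f (x n.+1 k) * phi n.+1 k y +
        \sum_(k <- l) f (x n.+1 k) * phi n.+1 k y).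
      apply: (bl_lin hX); first by apply: phiX => //; exact/Hl/mem_head.
      by apply: IH => j jl; apply: Hl; rewrite in_cons jl orbT.
    by apply/funext => y; rewrite big_cons.
  by apply: H => k; rewrite mem_index_iota ltnS.
have GB n f g : (0 < n)%N ->
    sampling_op m x phi n (fun y => f y - g y) =
    fun y => sampling_op m x phi n f y - sampling_op m x phi n g y.
  case: n => // n _; apply/funext => y; rewrite /sampling_op -sumrB.
  by apply: eq_bigr => k _; rewrite mulrBl.
pose w n f := nX (one_sub_pow (steklov_fwd (gamma / n%:R)) s f).
pose v n f := discrete_norm nX m x n (one_sub_pow (steklov (gamma / n%:R)) r f).
have v0 n f : 0 <= v n f by exact: bl_norm_ge0 hX _ (node_step_memX hX m x n _).
have w0 n f : (0 < n)%N -> X f -> 0 <= w n f.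
  move=> n0 Xf; apply: (bl_norm_ge0 hX).
  have h0 : 0 < gamma / n%:R by rewrite divr_gt0// ltr0n.
  have bL := steklov_fwd_bounded_op hX hA M0 HM h0.
  rewrite (bounded_op_one_sub_pow hX s bL Xf); exact: (bounded_op_opoly hX _ bL Xf).
(* For the discrete norm of f - T, the r-th difference is split into that of f, which gives v, and
   that of T, a polynomial whose discrete norm is bounded by its norm. *)
have core n f e : (0 < n)%N -> X f -> 0 < e -> exists T,
    [/\ trig_poly n T, nX (fun y => f y - T y) <= C * (w n f + e),
      nX (fun y => T y - sampling_op m x phi n T y) <= K3 * C * (w n f + e) &
      discrete_norm nX m x n (fun y => f y - T y) <= v n f + (C2 + C1) * C * (w n f + e)].
  move=> n0 Xf e0; have [T [hT E1 E2 E3]] := HC n f e n0 Xf e0.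
  rewrite -/(w n f) in E1 E2 E3.
  exists T; split => //.
    by apply: le_trans (hK3 n T n0 hT) _; rewrite -!mulrA ler_wpM2l// ltW.
  have XT := memX_trig_poly hX hT; have Xg := memXB hX Xf XT.
  have h0 : 0 < gamma / n%:R by rewrite divr_gt0// ltr0n.
  have bL := steklov_bounded_op hX hA HM h0.
  apply: le_trans (HC1 n _ n0 Xg) _.
  have hW : trig_poly n (one_sub_pow (steklov (gamma / n%:R)) r T).
    rewrite /one_sub_pow; elim: (r) => [|q IH] //=; apply: trig_polyB => //.
    exact: trig_poly_steklov.
  have d2 := HC2 n _ n0 hW.
  have tri : discrete_norm nX m x n (one_sub_pow (steklov (gamma / n%:R)) r (fun y => f y - T y)) <=
      v n f + discrete_norm nX m x n (one_sub_pow (steklov (gamma / n%:R)) r T).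
    apply: (discrete_norm_triangle hX) => y.
    rewrite !(bounded_op_one_sub_pow hX r bL)//.
    have -> : (fun y => f y - T y) = fun y => -1 * T y + f y by apply/funext => z; ring.
    have [XL Llin _] := bL; rewrite (opoly_lin XL Llin _ _ XT Xf).
    by rewrite mulN1r addrC; exact: ler_normB.
  have e1 := ler_wpM2l (ltW C10) E1; have e2 := ler_wpM2l (ltW C20) E3.
  apply: le_trans (lerD tri e1) _; rewrite -addrA lerD2l.
  apply: le_trans (lerD (le_trans d2 e2) (lexx _)) _.
  by rewrite le_eqVlt; apply/orP; left; apply/eqP; ring.
(* The three summands bound f - T, T - G_n T and G_n (T - f) respectively. *)
pose A1 := C + K3 * C + K1 * (1 + (C2 + C1) * C).
have A10 : 0 < A1.
  by rewrite /A1 !addr_gt0// ?mulr_gt0// addr_gt0// mulr_gt0// addr_gt0.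
(* T varies with e but the constants do not, so e can be sent to 0. *)
have limit (a b c : R) : 0 < b -> (forall e, 0 < e -> a <= b * (c + e)) -> a <= b * c.
  move=> b0 H; apply/ler_addgt0Pr => e e0.
  have := H (e / b) (divr_gt0 e0 b0); rewrite mulrDr mulrCA divff ?mulr1//.
  by rewrite lt0r_neq0.
have part1 n f : (0 < n)%N -> X f ->
    nX (fun y => f y - sampling_op m x phi n f y) <= A1 * (w n f + v n f).
  move=> n0 Xf; apply: limit => // e e0.
  have [T [hT E1 E2 E3]] := core n f e n0 Xf e0.
  have XT := memX_trig_poly hX hT; have Xg := memXB hX Xf XT.
  have t1 := normX_triangle hX Xf XT (GX n f n0).
  have t2 := normX_triangle hX XT (GX n T n0) (GX n f n0).
  have t3 := hK1 n _ n0 Xg; rewrite (GB n _ _ n0) in t3.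
  rewrite (normX_distC hX (GX n T n0) (GX n f n0)) in t2.
  have t4 := ler_wpM2l (ltW K1_gt0) E3.
  apply: (le_trans t1); apply: (le_trans (lerD E1 t2)).
  apply: (le_trans (lerD (lexx _) (lerD E2 (le_trans t3 t4)))).
  have we0 : 0 <= w n f + e by rewrite addr_ge0 ?w0// ltW.
  have Kv : K1 * v n f <= K1 * (w n f + v n f + e).
    by rewrite ler_wpM2l ?(ltW K1_gt0)//; have := w0 n f n0 Xf; clear -e0; lra.
  have Dw : (C + K3 * C + K1 * ((C2 + C1) * C)) * (w n f + e) <=
      (C + K3 * C + K1 * ((C2 + C1) * C)) * (w n f + v n f + e).
    apply: ler_wpM2l; first by rewrite !addr_ge0// ?mulr_ge0// ltW// ?mulr_gt0// ?addr_gt0.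
    by have := v0 n f; clear; lra.
  have -> : A1 * (w n f + v n f + e) = K1 * (w n f + v n f + e) +
    (C + K3 * C + K1 * ((C2 + C1) * C)) * (w n f + v n f + e) by rewrite /A1; ring.
  apply: le_trans (lerD Kv Dw).
  by rewrite le_eqVlt; apply/orP; left; apply/eqP; ring.
split; first by exists A1.
(* Now T - G_n f is a polynomial of degree n, so its discrete norm is at most C2 times its norm, and
   that norm is bounded through f by the error of T and the first estimate. *)
move=> GT; pose A2 := 1 + (C2 + C1) * C + C2 * (C + A1).
have A20 : 0 < A2.
  by rewrite /A2 !addr_gt0// mulr_gt0// addr_gt0.
exists A2 => // n f n0 Xf; apply: limit => // e e0; rewrite -/(w n f) -/(v n f).
have [T [hT E1 _ E3]] := core n f e n0 Xf e0.
have XT := memX_trig_poly hX hT.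
have hD : trig_poly n (fun y => T y - sampling_op m x phi n f y).
  by apply: trig_polyB => //; exact: GT.
have tri : discrete_norm nX m x n (fun y => f y - sampling_op m x phi n f y) <=
    discrete_norm nX m x n (fun y => f y - T y) +
    discrete_norm nX m x n (fun y => T y - sampling_op m x phi n f y).
  apply: (discrete_norm_triangle hX) => y.
  by rewrite -[f y - _](subrKA (T y)) ler_normD.
have t1 := normX_triangle hX XT Xf (GX n f n0).
rewrite (normX_distC hX XT Xf) in t1.
have p1 := part1 n f n0 Xf.
have d2 := le_trans (HC2 n _ n0 hD) (ler_wpM2l (ltW C20) (le_trans t1 (lerD E1 p1))).
apply: (le_trans tri); apply: (le_trans (lerD E3 d2)).
have W0 := w0 n f n0 Xf; have V0 := v0 n f.
pose z := w n f + v n f + e.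
have z1 : v n f <= z by rewrite /z; clear -W0 e0; lra.
have z2 : w n f + e <= z by rewrite /z; clear -V0; lra.
have z3 : w n f + v n f <= z by rewrite /z; clear -e0; lra.
have c1 : 0 <= (C2 + C1) * C + C2 * C by rewrite addr_ge0// mulr_ge0// ?addr_ge0// ltW.
have c2 : 0 <= C2 * A1 by rewrite mulr_ge0// ltW.
have -> : A2 * z = z + (((C2 + C1) * C + C2 * C) * z + C2 * A1 * z) by rewrite /A2; ring.
apply: le_trans (lerD z1 (lerD (ler_wpM2l c1 z2) (ler_wpM2l c2 z3))).
by rewrite le_eqVlt; apply/orP; left; apply/eqP; ring.
Qed.
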